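(* There is an absolute constant $C>0$ such that the following holds. Let $k\ge3$ be an integer, $x\in\mathbb{R}^k$, $\delta>0$, let $m\in\mathbb{N}$ be such that $\lambda:=m/k>4$, and let $E$ be an $m\times k$ Gaussian matrix (its entries are i.i.d. standard Gaussian). Set $A=(1/2-\lambda^{-1/2})^{-2}$ and $A'=(3/2+\lambda^{-1/2})^{-2}$. Then for every $c_2\in(0,1)$, setting $c_1=C\sqrt{\ln(e^2c_2^{-1})}>0$, with probability at least $1-2e^{-m/8}-c_2$ we have both $$\mathcal{E}(x)<A\left(2\|x\|e^{-\frac{2\pi^2\|x\|^2}{\delta^2}}+c_1\sqrt{\log k}\,\lambda^{-1/2}\delta\right)$$ and $$\mathcal{E}(x)>A'\left(2\|x\|e^{-\frac{2\pi^2\|x\|^2}{\delta^2}}-2\|x\|e^{-\frac{8\pi^2\|x\|^2}{\delta^2}}-c_1\sqrt{\log k}\,\lambda^{-1/2}\delta\right),$$ where $\mathcal{E}(x)=\|x-E^\dagger Q(Ex)\|$.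
   Context: $\|\cdot\|$ is the Euclidean norm. For $\delta>0$, the uniform scalar quantizer $q_\delta:\mathbb{R}\to\delta\mathbb{Z}$ is $q_\delta(t)=n\delta$ if $t\in(n\delta-\delta/2,\,n\delta+\delta/2]$, $n\in\mathbb{Z}$; $Q=Q_\delta^{\rm MSQ}:\mathbb{R}^m\to(\delta\mathbb{Z})^m$ applies $q_\delta$ to each coordinate. $E^\dagger$ is the Moore–Penrose pseudoinverse, $E^\dagger=(E^TE)^{-1}E^T$ when $E$ has full column rank. *)

(* Defs.v *)
From HB Require Import structures.
From mathcomp Require Import all_boot all_order all_algebra.
From mathcomp Require Import all_classical all_reals all_analysis.
From mathcomp Require Import ring lra.

Set SsrOldRewriteGoalsOrder.
Set Implicit Arguments.
Unset Strict Implicit.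
Unset Printing Implicit Defensive.

Import Order.TTheory GRing.Theory Num.Theory.
Import numFieldNormedType.Exports.

Local Open Scope classical_set_scope.
Local Open Scope ring_scope.

(* The library norm `|x| on matrices is the maximum norm, hence a separate
   Euclidean norm. *)
Definition enorm (R : realType) (n : nat) (x : 'cV[R]_n) : R :=
  Num.sqrt (\sum_(i < n) x i 0 ^+ 2).

(* t lies in the half-open cell (n d - d/2, n d + d/2] iff
   n = ceil (t / d - 1/2); see quantizerP. *)
Definition quantizer (R : realType) (d t : R) : R :=
  (Num.ceil (t / d - 2^-1))%:~R * d.

Lemma quantizerP (R : realType) (d t : R) (n : int) : 0 < d ->
  n%:~R * d - d / 2 < t <= n%:~R * d + d / 2 <-> quantizer d t = n%:~R * d.
Proof.
move=> d0; rewrite /quantizer.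
have -> : (n%:~R * d - d / 2 < t <= n%:~R * d + d / 2) =
          (Num.ceil (t / d - 2^-1) == n).
  rewrite ceil_eq -[t in LHS](divfK (lt0r_neq0 d0)).
  have -> : n%:~R * d - d / 2 = (n%:~R - 2^-1) * d by ring.
  have -> : n%:~R * d + d / 2 = (n%:~R + 2^-1) * d by ring.
  rewrite ltr_pM2r// ler_pM2r// rmorphB/= lerBlDr; congr (_ && _).
  by apply/idP/idP => ?; lra.
split=> [/eqP -> //|/(mulIf (lt0r_neq0 d0))/eqP].
by rewrite eqr_int.
Qed.

Definition msq (R : realType) (m : nat) (d : R) (y : 'cV[R]_m) : 'cV[R]_m :=
  \col_(i < m) quantizer d (y i 0).

(* The four Penrose equations. *)
Definition is_mpinv (R : realType) (m n : nat) (A : 'M[R]_(m, n))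
    (X : 'M[R]_(n, m)) : Prop :=
  [/\ A *m X *m A = A, X *m A *m X = X,
      (A *m X)^T = A *m X & (X *m A)^T = X *m A].

(* Existence and uniqueness are is_mpinv_exists and is_mpinv_unique, so the
   default value 0 is never used. *)
Definition mpinv (R : realType) (m n : nat) (A : 'M[R]_(m, n)) : 'M[R]_(n, m) :=
  xget 0 [set X | is_mpinv A X].

Lemma is_mpinv_unique (R : realType) (m n : nat) (A : 'M[R]_(m, n))
    (X Y : 'M[R]_(n, m)) : is_mpinv A X -> is_mpinv A Y -> X = Y.
Proof.
move=> [x1 x2 x3 x4] [y1 y2 y3 y4].
have eAX : A *m X = A *m Y.
  rewrite -x3 -{1}y1 -(mulmxA (A *m Y)) trmx_mul x3 y3.
  by rewrite mulmxA x1.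
have eXA : X *m A = Y *m A.
  rewrite -x4 -{1}y1 -!mulmxA mulmxA trmx_mul x4 y4.
  by rewrite -mulmxA (mulmxA A X) x1.
by rewrite -x2 eXA -mulmxA eAX mulmxA y2.
Qed.

Lemma gram_unitmx (R : realType) (m n : nat) (A : 'M[R]_(m, n)) :
  row_free A -> A *m A^T \in unitmx.
Proof.
move=> fA; rewrite -row_free_unit; apply: inj_row_free => v vA.
apply: (row_free_inj fA); rewrite mul0mx.
have h : (v *m A) *m (v *m A)^T = 0 by rewrite trmx_mul !mulmxA -(mulmxA v) vA mul0mx.
have {h} : \sum_j (v *m A) 0 j ^+ 2 = 0.
  transitivity (((v *m A) *m (v *m A)^T) 0 0); last by rewrite h mxE.
  by rewrite mxE; apply: eq_bigr => j _; rewrite !mxE expr2.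
move=> /eqP; rewrite psumr_eq0 => [/allP h|j _]; last exact: sqr_ge0.
apply/rowP => j; rewrite [RHS]mxE; apply/eqP.
by have := h j (mem_index_enum _); rewrite /= sqrf_eq0.
Qed.

Lemma is_mpinv_exists (R : realType) (m n : nat) (A : 'M[R]_(m, n)) :
  exists X, is_mpinv A X.
Proof.
suff key r (B : 'M[R]_(m, r)) (C : 'M[R]_(r, n)) :
    row_free B^T -> row_free C -> exists X, is_mpinv (B *m C) X.
  rewrite -(mulmx_base A); apply: key; last exact: row_base_free.
  by rewrite /row_free mxrank_tr; exact: col_base_full.
move=> fB fC.
have uC : C *m C^T \in unitmx by exact: gram_unitmx.
have uB : B^T *m B \in unitmx by rewrite -{2}[B]trmxK; exact: gram_unitmx.
set U := invmx (C *m C^T); set V := invmx (B^T *m B).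
have CU : C *m C^T *m U = 1%:M by exact: mulmxV.
have VB : V *m (B^T *m B) = 1%:M by exact: mulVmx.
have Us : U^T = U by rewrite trmx_inv trmx_mul trmxK.
have Vs : V^T = V by rewrite trmx_inv trmx_mul trmxK.
set X := C^T *m U *m V *m B^T.
have AX : (B *m C) *m X = B *m V *m B^T.
  by rewrite /X !mulmxA -(mulmxA B C) -(mulmxA B _ U) CU mulmx1.
have XA : X *m (B *m C) = C^T *m U *m C.
  by rewrite /X -!mulmxA (mulmxA B^T) (mulmxA V) VB mul1mx.
exists X; split.
- by rewrite AX -!mulmxA (mulmxA B^T) (mulmxA V) VB mul1mx.
- rewrite XA /X !mulmxA -(mulmxA _ C C^T) -(mulmxA _ (C *m C^T) U) CU.
  by rewrite mulmx1.
- by rewrite AX !trmx_mul trmxK Vs mulmxA.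
- by rewrite XA !trmx_mul trmxK Us mulmxA.
Qed.

Lemma mpinvP (R : realType) (m n : nat) (A : 'M[R]_(m, n)) :
  is_mpinv A (mpinv A).
Proof. by have [X AX] := is_mpinv_exists A; exact: (xgetPex 0 (ex_intro _ X AX)). Qed.

Lemma mpinv_full_col_rank (R : realType) (m n : nat) (A : 'M[R]_(m, n)) :
  \rank A = n -> mpinv A = invmx (A^T *m A) *m A^T.
Proof.
move=> rA; have uA : A^T *m A \in unitmx.
  rewrite -{2}[A]trmxK; apply: gram_unitmx.
  by rewrite /row_free mxrank_tr rA.
have XA : invmx (A^T *m A) *m A^T *m A = 1%:M by rewrite -mulmxA mulVmx.
apply: is_mpinv_unique (mpinvP A) _; split.
- by rewrite -mulmxA XA mulmx1.
- by rewrite XA mul1mx.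
- by rewrite !trmx_mul trmxK trmx_inv trmx_mul trmxK mulmxA.
- by rewrite XA trmx1.
Qed.

Definition mutually_independent (R : realType) (d : measure_display)
    (T : measurableType d) (P : probability T R) (I : finType)
    (X : I -> T -> R) : Prop :=
  forall (J : {set I}) (B : I -> set R), (forall i, measurable (B i)) ->
    P [set w | forall i, i \in J -> B i (X i w)] =
    (\prod_(i in J) P (X i @^-1` B i))%E.

Record gaussian_matrix (R : realType) (d : measure_display)
    (T : measurableType d) (P : probability T R) (m n : nat)
    (E : T -> 'M[R]_(m, n)) : Prop := GaussianMatrix {
  gaussian_matrix_measurable : forall i j,
    measurable_fun [set: T] (fun w => E w i j) ;
  gaussian_matrix_law : forall i j (B : set R), measurable B ->
    P ((fun w => E w i j) @^-1` B) = normal_prob 0 1 B ;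
  gaussian_matrix_independent :
    mutually_independent P (fun (ij : 'I_m * 'I_n) w => E w ij.1 ij.2) }.

Definition recon_error (R : realType) (m k : nat) (delta : R)
    (E : 'M[R]_(m, k)) (x : 'cV[R]_k) : R :=
  enorm (x - mpinv E *m msq delta (E *m x)).

(* Main.v *)
Require Import Defs.
From HB Require Import structures.
From mathcomp Require Import all_boot all_order all_algebra.
From mathcomp Require Import all_classical all_reals all_analysis.
From mathcomp Require Import measurable_realfun.
From mathcomp Require Import ring lra.
Set Implicit Arguments.
Unset Strict Implicit.
Unset Printing Implicit Defensive.
Import Order.TTheory GRing.Theory Num.Theory.
Import numFieldNormedType.Exports.
Local Open Scope classical_set_scope.
Local Open Scope ring_scope.

(* Put r = E x - Q(E x). By the Penrose equations y = x - E^+ Q(E x) satisfies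
   E^T E y = E^T r, so ||y|| is governed by ||E^T r|| and by the extreme singular
   values of E.

   The entries of E^T r are sums over the rows of E of i.i.d. variables
   q(<e, x>) e_j, where q(t) = t - q_delta(t) has the sawtooth Fourier series.
   Integrating its Fejer means term by term against the Gaussian characteristic
   function gives E[q(<e, x>) e_j] = theta x_j, where theta is the alternating
   series 2 sum_n (-1)^(n-1) exp(-2 pi^2 n^2 ||x||^2 / delta^2); hence theta lies
   between 2 exp(-a) - 2 exp(-4a) and 2 exp(-a), with a = 2 pi^2 ||x||^2 / delta^2.

   Put l = ln(e^2/c2). If m >= 1000 k l ln k, a net argument puts the singular
   values of E in [sqrt m / 2, 3 sqrt m / 2] outside an event of probability at
   most c2/2, and a Chernoff bound for each coordinate makes E^T r - m theta x
   of order sqrt (m k l ln k) delta outside another one.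

   If m is smaller, then lambda^(-1/2) sqrt (l ln k) is bounded below, and since
   ||r|| <= sqrt m delta / 2 it suffices that all singular values are of order
   sqrt m, which fails with probability at most 2 exp(-m/8). *)

(** * Integration and independence *)

(** Fejer means replace the partial sums of the sawtooth series because positivity of their kernel
    bounds them by [delta] uniformly in the degree, as dominated convergence requires; they converge
    off the discontinuities, which a nonzero Gaussian combination almost surely avoids.

    The law of a linear combination L of entries is never computed. Independence gives its Laplace
    transform and a real characteristic function (a cosine with free phase); moments of exp(t L^2)
    and exp(-t L^2) follow by averaging exp(sqrt(2t) z L) or cos(sqrt(2t) z L) over an auxiliary
    Gaussian z.

    A and A' enter only through A >= 4 and 0 < A' <= 4/9, consequences of 0 < lambda^(-1/2) < 1/2.
    Singular values in [sqrt m / 2, 3 sqrt m / 2] give exactly the factors 4 and 4/9, so a net with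
    crude constants suffices.

    For small m the obstacle is that 2 exp(-m/8) is prescribed while the net may have 10^(4k) <=
    10^m points: each may fail with probability at most 2 (exp(-1/8) / 10)^m. The wide window
    [sqrt m / 100, 6 sqrt m] buys this, and the factor 100^2 in C pays for it. *)

Section density_pushforward.
Local Open Scope ereal_scope.
Context d1 d2 (T : measurableType d1) (S : measurableType d2) (R : realType).
Variables (mu : {measure set T -> \bar R}) (nu : {measure set S -> \bar R}).
Variables (X : T -> S) (w : T -> R).
Hypotheses (mX : measurable_fun setT X) (mw : measurable_fun setT w).
Hypothesis w0 : forall t, (0 <= w t)%R.
Hypothesis nuE : forall B, measurable B ->
  nu B = \int[mu]_t (\1_B (X t) * w t)%:E.

Import HBNNSimple.

(** Simple functions and monotone convergence. One statement serves three purposes: [X = id]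
    integrates against a density, [w = 1] against the law of an entry, and a random weight [w]
    expresses independence. *)
Lemma ge0_integral_density (f : S -> \bar R) : measurable_fun [set: S] f ->
  (forall y, 0 <= f y) -> \int[nu]_y f y = \int[mu]_t (f (X t) * (w t)%:E).
Proof.
move=> mf f0.
pose f_ := nnsfun_approx measurableT mf.
have mwE : measurable_fun setT (EFin \o w) by exact/measurable_EFinP.
have mfX n : measurable_fun setT (f_ n \o X).
  by apply: measurableT_comp mX; exact/measurable_funP.
transitivity (limn (fun n => \int[nu]_y (f_ n y)%:E)).
  rewrite -monotone_convergence//.
  - apply: eq_integral => y _; apply/esym/cvg_lim => //.
    exact: cvg_nnsfun_approx.
  - by move=> n; exact/measurable_EFinP/measurable_funP.
  - by move=> n y _; rewrite lee_fin.
  - by move=> y _ m n mn; rewrite lee_fin; exact/lefP/nd_nnsfun_approx.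
rewrite [X in limn X](_ : _ =
    (fun n => \int[mu]_t ((f_ n (X t))%:E * (w t)%:E))).
  rewrite -monotone_convergence//; last 3 first.
    - move=> n; apply: emeasurable_funM => //; apply/measurable_EFinP.
      exact: mfX.
    - by move=> n t _; rewrite mule_ge0// lee_fin.
    - move=> t _ m n mn; rewrite lee_wpmul2r ?lee_fin//.
      exact/lefP/nd_nnsfun_approx.
  apply: eq_integral => t _; apply/cvg_lim => //; apply: cvgeZr => //.
  exact: cvg_nnsfun_approx.
apply/funext => n.
have mI r : measurable_fun setT (fun t => \1_(f_ n @^-1` [set r]) (X t) : R).
  exact: measurableT_comp.
transitivity (\sum_(r \in range (f_ n))
    \int[mu]_t (r * (\1_(f_ n @^-1` [set r]) (X t) * w t))%:E).
  under eq_integral do rewrite fimfunE -fsumEFin//.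
  rewrite ge0_integral_fsum//; last 2 first.
  - by move=> y; exact/measurable_EFinP/measurable_funM.
  - by move=> y x _; rewrite nnfun_muleindic_ge0.
  apply: eq_fsbigr => r; rewrite inE => -[y _ fyr].
  rewrite integralZl_indic_nnsfun// integral_indic//= setIT nuE//.
  under [in RHS]eq_integral do rewrite EFinM.
  rewrite ge0_integralZl_EFin//.
  - by move=> t _; rewrite lee_fin mulr_ge0.
  - by apply/measurable_EFinP/measurable_funM.
  - by rewrite -fyr.
rewrite -ge0_integral_fsum//.
- apply: eq_integral => t _; rewrite fsumEFin// -EFinM; congr EFin.
  rewrite [f_ n (X t)]fimfunE mulr_fsuml.
  by apply: eq_fsbigr => r _; rewrite mulrA.
- by move=> r; apply/measurable_EFinP/measurable_funM => //; apply: measurable_funM.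
- move=> r t _; rewrite mulrA EFinM mule_ge0 ?lee_fin//.
  by rewrite -lee_fin nnfun_muleindic_ge0.
Qed.

End density_pushforward.

Lemma measurable_indic_comp d1 d2 (T : measurableType d1) (S : measurableType d2)
    (R : realType) (X : T -> S) (B : set S) :
  measurable_fun [set: T] X -> measurable B ->
  measurable_fun [set: T] (fun t => \1_B (X t) : R).
Proof. by move=> mX mB; apply: measurableT_comp => //; exact: measurable_indic. Qed.

Section independence_integral.
Context d1 d2 (T : measurableType d1) (S : measurableType d2) (R : realType).
Variables (P : probability T R) (X : T -> S).
Hypothesis mX : measurable_fun [set: T] X.

Let mX_mixin := isMeasurableFun.Build _ _ _ _ _ mX.
Let mX_pack : {mfun T >-> S} := HB.pack X mX_mixin.

(** The hypothesis says that weighting [P] by [Z] and pushing forward along [X] gives [z] times the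
    law of [X]. Independence is thus tested only on indicators of events about [X], with no
    sigma-algebra generated by [Z]. *)
Lemma ge0_integral_indep (Z : T -> R) (z : R) (f : S -> \bar R) :
  measurable_fun [set: T] Z -> (forall t, 0 <= Z t) -> 0 <= z ->
  (forall B, measurable B ->
    \int[P]_t (\1_B (X t) * Z t)%:E = z%:E * P (X @^-1` B))%E ->
  measurable_fun [set: S] f -> (forall y, 0 <= f y)%E ->
  (\int[P]_t (f (X t) * (Z t)%:E) = z%:E * \int[P]_t f (X t))%E.
Proof.
move=> mZ Z0 z0 ZE mf f0.
have := @ge0_integral_density _ _ _ _ _ P
  (mscale (NngNum z0) (pushforward P mX_pack)) X Z mX mZ Z0.
move=> <- //; last by move=> B mB; rewrite ZE.
rewrite ge0_integral_mscale//=; congr (_ * _)%E.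
by rewrite ge0_integral_pushforward.
Qed.

End independence_integral.

Lemma bounded_integrable d (T : measurableType d) (R : realType)
    (P : probability T R) (f : T -> R) (M : R) :
  measurable_fun [set: T] f -> (forall t, `|f t| <= M) ->
  P.-integrable [set: T] (EFin \o f).
Proof.
move=> mf fM; apply: measurable_bounded_integrable => //.
  have PT : (P [set: T] <= 1)%E by rewrite probability_setT.
  exact: le_lt_trans PT (ltry _).
exists M; split; first by rewrite num_real.
by move=> N MN t _ /=; rewrite (le_trans (fM t))// ltW.
Qed.

Lemma Rintegral_cst_prob d (T : measurableType d) (R : realType)
  (P : probability T R) (c : R) : \int[P]_t c = c.
Proof.
have PT : fine (P [set: T]) = 1 by rewrite probability_setT.
by rewrite Rintegral_cst// -[RHS]mulr1; congr (_ * _).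
Qed.

Lemma Rintegral_indic d (T : measurableType d) (R : realType)
  (P : probability T R) (A : set T) : measurable A ->
  \int[P]_t (\1_A t : R) = fine (P A).
Proof. by move=> mA; rewrite /Rintegral integral_indic// setIT. Qed.

Lemma EFin_Rintegral d (T : measurableType d) (R : realType)
  (mu : {measure set T -> \bar R}) (f : T -> R) :
  mu.-integrable [set: T] (EFin \o f) ->
  (\int[mu]_t f t)%:E = (\int[mu]_t (f t)%:E)%E.
Proof. by move=> fi; rewrite fineK//; exact: integrable_fin_num. Qed.

Lemma integrable_dominated d (T : measurableType d) (R : realType)
    (mu : {measure set T -> \bar R}) (g f : T -> R) :
  measurable_fun [set: T] f -> (forall x, `|f x| <= g x) ->
  mu.-integrable [set: T] (EFin \o g) -> mu.-integrable [set: T] (EFin \o f).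
Proof.
move=> mf fg; apply: le_integrable => //; first exact/measurable_EFinP.
by move=> x _; rewrite /= lee_fin (le_trans (fg x))// ler_norm.
Qed.

Lemma integrableD_real d (T : measurableType d) (R : realType)
    (mu : {measure set T -> \bar R}) (f g : T -> R) :
  mu.-integrable [set: T] (EFin \o f) -> mu.-integrable [set: T] (EFin \o g) ->
  mu.-integrable [set: T] (EFin \o (fun x => f x + g x)).
Proof. by move=> fi gi; have := integrableD measurableT fi gi. Qed.

Lemma integrableB_real d (T : measurableType d) (R : realType)
    (mu : {measure set T -> \bar R}) (f g : T -> R) :
  mu.-integrable [set: T] (EFin \o f) -> mu.-integrable [set: T] (EFin \o g) ->
  mu.-integrable [set: T] (EFin \o (fun x => f x - g x)).
Proof. by move=> fi gi; have := integrableB measurableT fi gi. Qed.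

Lemma integrableZl_real d (T : measurableType d) (R : realType)
    (mu : {measure set T -> \bar R}) (k : R) (f : T -> R) :
  mu.-integrable [set: T] (EFin \o f) ->
  mu.-integrable [set: T] (EFin \o (fun x => k * f x)).
Proof. by move=> fi; have := integrableZl measurableT k fi. Qed.

Lemma norm_indic (T : Type) (R : realType) (A : set T) (x : T) :
  `|\1_A x : R| <= 1.
Proof. by rewrite indicE; case: (_ \in _); rewrite ?normr1 ?normr0. Qed.

Section independence_Rintegral.
Context d1 d2 (T : measurableType d1) (S : measurableType d2) (R : realType).
Variables (P : probability T R) (X : T -> S).
Hypothesis mX : measurable_fun [set: T] X.

Lemma Rintegral_indep (Z : T -> R) (c : R) (f : S -> R) (M : R) :
  measurable_fun [set: T] Z -> (forall t, `|Z t| <= c) ->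
  (forall B, measurable B ->
    \int[P]_t (\1_B (X t) * Z t) = fine (P (X @^-1` B)) * \int[P]_t Z t) ->
  measurable_fun [set: S] f -> (forall y, `|f y| <= M) ->
  \int[P]_t (f (X t) * Z t) = (\int[P]_t f (X t)) * \int[P]_t Z t.
Proof.
move=> mZ Zc ZE mf fM.
have mfX : measurable_fun [set: T] (f \o X) by exact: measurableT_comp.
have iZ := bounded_integrable P mZ Zc.
have ifX : P.-integrable setT (EFin \o (fun t => f (X t))).
  by apply: (@bounded_integrable _ _ _ _ _ M) => // t; exact: fM.
have ifZ : P.-integrable setT (EFin \o (fun t => f (X t) * Z t)).
  apply: (@bounded_integrable _ _ _ _ _ (M * c)) => [|t].
    exact: measurable_funM.
  by rewrite normrM ler_pM.
have ic a : P.-integrable setT (EFin \o (fun t : T => a : R)).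
  exact: finite_measure_integrable_cst.
set z := \int[P]_t Z t.
have z0 : 0 <= z + c.
  rewrite -[c in leRHS](Rintegral_cst_prob P) -RintegralD//.
  apply: Rintegral_ge0 => t _; rewrite -lerBlDr sub0r.
  by have := Zc t; rewrite ler_norml => /andP[].
(* Adding the bounds makes both factors nonnegative; the nonnegative case applies to the shifted
   product, and the extra terms cancel after expansion. *)
pose Z' t := Z t + c; pose f' y := f y + M.
have iZ' : P.-integrable setT (EFin \o Z').
  by apply: (@bounded_integrable _ _ _ _ _ (c + `|c|)) => [|t];
    [exact: measurable_funD|rewrite (le_trans (ler_normD _ _))// lerD].
have if' : P.-integrable setT (EFin \o (fun t => f' (X t))).
  apply: (@bounded_integrable _ _ _ _ _ (M + `|M|)) => [|t].
    exact: measurable_funD.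
  by rewrite (le_trans (ler_normD _ _))// lerD.
have if'Z' : P.-integrable setT (EFin \o (fun t => f' (X t) * Z' t)).
  apply: (@bounded_integrable _ _ _ _ _ ((M + `|M|) * (c + `|c|))) => [|t].
    by apply: measurable_funM; exact: measurable_funD.
  by rewrite normrM ler_pM// (le_trans (ler_normD _ _))// lerD.
have Ef'Z' : (\int[P]_t ((EFin \o f') (X t) * (Z' t)%:E))%E =
   (\int[P]_t (f' (X t) * Z' t))%:E by rewrite EFin_Rintegral.
have Ef' : (\int[P]_t (EFin \o f') (X t))%E = (\int[P]_t f' (X t))%:E.
  by rewrite EFin_Rintegral.
have iD (g h : T -> R) : P.-integrable setT (EFin \o g) ->
    P.-integrable setT (EFin \o h) ->
    P.-integrable setT (EFin \o (fun t => g t + h t)).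
  move=> ig ih; rewrite (_ : EFin \o _ = (EFin \o g) \+ (EFin \o h))%E//.
  exact: integrableD.
have E : (\int[P]_t (f' (X t) * Z' t))%:E =
    ((z + c) * \int[P]_t f' (X t))%:E.
  rewrite EFinM -Ef' -Ef'Z'; apply: (ge0_integral_indep mX) => //.
  - exact: measurable_funD.
  - by move=> t; have := Zc t; rewrite ler_norml /Z' => /andP[? _]; lra.
  - move=> B mB.
    have mBX : measurable_fun setT (fun t => \1_B (X t) : R).
      exact: measurable_indic_comp.
    have iB : P.-integrable setT (EFin \o (fun t => \1_B (X t) : R)).
      apply: (@bounded_integrable _ _ _ _ _ 1) => // t.
      by rewrite indicE; case: (_ \in _); rewrite ?normr1 ?normr0.
    have mXB : measurable (X @^-1` B) by rewrite -[X in measurable X]setTI; exact: mX.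
    have iBZ : P.-integrable setT (EFin \o (fun t => \1_B (X t) * Z t)).
      apply: (@bounded_integrable _ _ _ _ _ c) => [|t].
        exact: measurable_funM.
      rewrite normrM -[leRHS]mul1r ler_pM//.
      by rewrite indicE; case: (_ \in _); rewrite ?normr1 ?normr0.
    have iBc : P.-integrable setT (EFin \o (fun t => \1_B (X t) * c)).
      apply: (@bounded_integrable _ _ _ _ _ `|c|) => [|t].
        exact: measurable_funM.
      rewrite normrM -[leRHS]mul1r ler_pM//.
      by rewrite indicE; case: (_ \in _); rewrite ?normr1 ?normr0.
    rewrite -(@EFin_Rintegral _ _ _ _ (fun t => \1_B (X t) * Z' t)).
      under eq_Rintegral do rewrite mulrDr.
      rewrite RintegralD// ZE// RintegralZr//.
      have -> : \int[P]_t \1_B (X t) = fine (P (X @^-1` B)).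
        by rewrite -Rintegral_indic.
      by rewrite -mulrDr EFinM muleC fineK// fin_num_measure.
    rewrite (_ : EFin \o _ =
        EFin \o (fun t => \1_B (X t) * Z t + \1_B (X t) * c)); last first.
      by apply/funext => t/=; rewrite mulrDr.
    exact: iD.
  - by apply/measurable_EFinP; exact: measurable_funD.
  - move=> y; rewrite lee_fin.
    by have := fM y; rewrite ler_norml /f' => /andP[? _]; lra.
move: E => [].
under eq_Rintegral do rewrite /f' /Z' mulrDl !mulrDr addrA.
have iMZ : P.-integrable setT (EFin \o (fun t => M * Z t)).
  apply: (@bounded_integrable _ _ _ _ _ (`|M| * c)) => [|t].
    exact: measurable_funM.
  by rewrite normrM ler_pM.
have ifc : P.-integrable setT (EFin \o (fun t => f (X t) * c)).
  apply: (@bounded_integrable _ _ _ _ _ (M * `|c|)) => [|t].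
    exact: measurable_funM.
  by rewrite normrM ler_pM.
rewrite RintegralD//; [|by do 2 apply: (iD) => //].
rewrite RintegralD//; [|by apply: (iD) => //].
rewrite RintegralD// RintegralZl// RintegralZr// /f' RintegralD// !Rintegral_cst_prob.
by rewrite -/z; lra.
Qed.

End independence_Rintegral.

Lemma measurable_forall_fin d (T : measurableType d) (I : finType)
    (J : pred I) (D : I -> set T) : (forall i, measurable (D i)) ->
  measurable [set w | forall i, J i -> D i w].
Proof.
move=> mD; rewrite (_ : [set w | _] = \bigcap_(i in [set` J]) D i).
  by apply: fin_bigcap_measurable => //; exact: finite_finset.
by apply/seteqP; split.
Qed.

Section mutual_independence.
Context d1 d2 (T : measurableType d1) (S : measurableType d2) (R : realType).
Variables (P : probability T R) (I : finType) (X : I -> T -> S).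
Hypothesis mX : forall i, measurable_fun [set: T] (X i).
Hypothesis iX : forall (J : {set I}) (B : I -> set S),
  (forall i, measurable (B i)) ->
  P [set w | forall i, i \in J -> B i (X i w)] =
  (\prod_(i in J) P (X i @^-1` B i))%E.

Let mXB i B : measurable B -> measurable (X i @^-1` B).
Proof. by move=> mB; rewrite -[X in measurable X]setTI; exact: mX. Qed.

(** The indicator over [J] is what makes the induction close: to split off [F i], the remaining
    factors must be tested against indicators of [X i], and such a test merely moves [i] into
    [J]. *)
Lemma ge0_integral_prod_indep_seq (F : I -> S -> R) (e : I -> R)
    (s : seq I) (J : {set I}) (B : I -> set S) :
  (forall i, measurable_fun [set: S] (F i)) -> (forall i y, 0 <= F i y) ->
  (forall i, \int[P]_t (F i (X i t))%:E = (e i)%:E)%E ->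
  (forall i, measurable (B i)) -> uniq s -> {in s, forall i, i \notin J} ->
  (\int[P]_t ((\prod_(i <- s) F i (X i t)) *
     \1_[set w | forall i, i \in J -> B i (X i w)] t)%:E =
   (\prod_(i <- s) e i)%:E * \prod_(i in J) P (X i @^-1` B i))%E.
Proof.
move=> mF F0 Fe.
have e0 i : 0 <= e i.
  by rewrite -lee_fin -Fe; apply: integral_ge0 => t _; rewrite lee_fin.
have mFX i : measurable_fun [set: T] (fun t => F i (X i t)).
  exact: (measurableT_comp (mF i) (mX i)).
have mJ (K : {set I}) (C : I -> set S) : (forall i, measurable (C i)) ->
    measurable [set w | forall i, i \in K -> C i (X i w)].
  by move=> mC; apply: measurable_forall_fin => i; exact: mXB.
elim: s J B => [|i s IH] J B mB.
  move=> _ _; under eq_integral do rewrite big_nil mul1r.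
  by rewrite big_nil mul1e integral_indic ?setIT//= ?iX//; exact: mJ.
move=> /= /andP[iNs us] NJ.
under eq_integral do rewrite big_cons -mulrA EFinM.
pose z := \prod_(j <- s) e j * fine (\prod_(j in J) P (X j @^-1` B j))%E.
have fPJ : (\prod_(j in J) P (X j @^-1` B j))%E \is a fin_num.
  by rewrite -iX// fin_num_measure//; exact: mJ.
have zE : (z%:E = (\prod_(j <- s) e j)%:E * \prod_(j in J) P (X j @^-1` B j))%E.
  by rewrite EFinM fineK.
rewrite (@ge0_integral_indep _ _ _ _ _ P (X i) (mX i) _ z (EFin \o F i)).
- by rewrite zE Fe big_cons muleC muleA EFinM.
- apply: measurable_funM; first exact: measurable_prod.
  by apply: measurable_indic; exact: mJ.
- by move=> t; rewrite mulr_ge0 ?prodr_ge0.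
- apply: mulr_ge0; first by rewrite prodr_ge0.
  by rewrite fine_ge0// prode_ge0.
- move=> C mC.
  pose B' j := if j == i then C else B j.
  have iNJ : i \notin J by apply: NJ; rewrite mem_head.
  have B'J j : j \in J -> B' j = B j.
    by rewrite /B'; case: eqP => // ->; rewrite (negbTE iNJ).
  have mB' j : measurable (B' j) by rewrite /B'; case: ifP.
  transitivity (\int[P]_t ((\prod_(j <- s) F j (X j t)) *
     \1_[set w | forall j, j \in (i |: J) -> B' j (X j w)] t)%:E)%E.
    apply: eq_integral => t _; congr EFin; rewrite mulrCA; congr (_ * _).
    rewrite !indicE -natrM mulnb; congr (_%:R); congr nat_of_bool.
    apply/andP/idP; rewrite !inE.
      move=> [Ct BJ] j; rewrite in_setU1 => /predU1P[->|jJ].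
        by rewrite /B' eqxx.
      by rewrite B'J//; exact: BJ.
    move=> H; split; first by have := H i (setU11 _ _); rewrite /B' eqxx.
    by move=> j jJ; rewrite -B'J//; apply: H; rewrite setU1r.
  rewrite IH//; last first.
    move=> j js; rewrite in_setU1 negb_or NJ ?inE ?js ?orbT// andbT.
    by apply: contraNneq iNs => <-.
  rewrite big_setU1//= zE -muleA; congr (_ * _)%E.
  rewrite muleC; congr (_ * _)%E; last by rewrite /B' eqxx.
  by apply: eq_bigr => j jJ; rewrite B'J.
- exact/measurable_EFinP.
- by move=> y; rewrite lee_fin.
Qed.

Lemma ge0_integral_prod_indep (F : I -> S -> R) (e : I -> R) :
  (forall i, measurable_fun [set: S] (F i)) -> (forall i y, 0 <= F i y) ->
  (forall i, \int[P]_t (F i (X i t))%:E = (e i)%:E)%E ->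
  (\int[P]_t (\prod_i F i (X i t))%:E = (\prod_i e i)%:E)%E.
Proof.
move=> mF F0 Fe.
have := @ge0_integral_prod_indep_seq F e (index_enum I) finset.set0 (fun=> setT)
  mF F0 Fe (fun=> measurableT) (index_enum_uniq I).
rewrite (_ : [set w | _] = setT); last first.
  by apply/seteqP; split => // w _ i; rewrite inE.
under eq_integral do rewrite indicT mulr1.
by rewrite big_set0 mule1; apply => i _; rewrite inE.
Qed.

End mutual_independence.

(** * Rectangles, and independence of the rows of an array *)

Section tuple_rectangles.
Context d (S : measurableType d) (n : nat).

Definition tuple_rectangles : set_system (n.-tuple S) :=
  [set A | exists2 C : 'I_n -> set S, forall i, measurable (C i) &
     A = [set t | forall i, C i (tnth t i)]].

Lemma measurable_tuple_rectangle (C : 'I_n -> set S) :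
  (forall i, measurable (C i)) ->
  measurable [set t : n.-tuple S | forall i, C i (tnth t i)].
Proof.
move=> mC.
have := @measurable_forall_fin _ (n.-tuple S) _ predT (fun i => [set t | C i (tnth t i)]).
rewrite (_ : [set w | _] = [set t | forall i, C i (tnth t i)]).
  by apply => i; rewrite -[X in measurable X]setTI; exact: measurable_tnth.
by apply/seteqP; split => t /= H i; [exact: H|move=> _; exact: H].
Qed.

Lemma measurable_tupleE :
  measurable = <<s tuple_rectangles >> :> set_system (n.-tuple S).
Proof.
apply/seteqP; split; last first.
  apply: smallest_sub; first exact: sigma_algebra_measurable.
  by move=> _ [C mC ->]; exact: measurable_tuple_rectangle.
apply: smallest_sub; first exact: smallest_sigma_algebra.
move=> A; rewrite -bigcup_seq => -[i _ [B mB <-]].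
apply: sub_sigma_algebra; exists (fun j => if j == i then B else setT).
  by move=> j; case: ifP.
apply/seteqP; split => t /=.
  by move=> [_ Bt] j; case: eqP => // ->.
by move=> /(_ i); rewrite eqxx.
Qed.

Lemma setI_closed_tuple_rectangles : setI_closed tuple_rectangles.
Proof.
move=> _ _ [C mC ->] [D mD ->]; exists (fun i => C i `&` D i).
  by move=> i; exact: measurableI.
apply/seteqP; split => t /=; first by move=> [? ?] i; split.
by move=> H; split => i; have [] := H i.
Qed.

(** Rectangles form a pi-system that generates the product sigma-algebra, so they determine a finite
    measure. *)
Lemma tuple_rectangles_unique (R : realType)
    (m1 m2 : {measure set (n.-tuple S) -> \bar R}) :
  (m1 setT < +oo)%E ->
  (forall C : 'I_n -> set S, (forall i, measurable (C i)) ->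
    m1 [set t | forall i, C i (tnth t i)] =
    m2 [set t | forall i, C i (tnth t i)]) ->
  forall A, measurable A -> m1 A = m2 A.
Proof.
move=> m1oo m12 A mA.
apply: (measure_unique tuple_rectangles (fun=> setT)) => //.
- exact: measurable_tupleE.
- exact: setI_closed_tuple_rectangles.
- by move=> _; exists (fun=> setT) => //; apply/seteqP; split.
- by rewrite bigcup_const.
- by move=> _ [C mC ->]; exact: m12.
Qed.

End tuple_rectangles.

Section row_independence.
Context d1 d2 (T : measurableType d1) (S : measurableType d2) (R : realType).
Variables (P : probability T R) (I : finType) (k : nat).
Variable (g : I * 'I_k -> T -> S).
Hypothesis mg : forall p, measurable_fun [set: T] (g p).
Hypothesis ig : forall (J : {set I * 'I_k}) (B : I * 'I_k -> set S),
  (forall p, measurable (B p)) ->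
  P [set w | forall p, p \in J -> B p (g p w)] =
  (\prod_(p in J) P (g p @^-1` B p))%E.

Definition tuple_row (i : I) (w : T) : k.-tuple S := [tuple g (i, l) w | l < k].

Lemma measurable_tuple_row i : measurable_fun [set: T] (tuple_row i).
Proof.
apply/measurable_fun_tnthP => l.
by rewrite (_ : _ \o _ = g (i, l))//; apply/funext => w /=; rewrite tnth_mktuple.
Qed.

Let mgB p B : measurable B -> measurable (g p @^-1` B).
Proof. by move=> mB; rewrite -[X in measurable X]setTI; exact: mg. Qed.

Let mrow i A : measurable A -> measurable (tuple_row i @^-1` A).
Proof.
by move=> mA; rewrite -[X in measurable X]setTI; exact: measurable_tuple_row.
Qed.

(** Induction on the rows in [s], with further events on entries outside these rows. The entry
    events give the next row something to be absorbed into once its event is a rectangle. *)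
Lemma tuple_row_indep_seq (s : seq I) (A : I -> set (k.-tuple S))
    (J : {set I * 'I_k}) (B : I * 'I_k -> set S) :
  (forall i, measurable (A i)) -> (forall p, measurable (B p)) ->
  uniq s -> (forall p, p \in J -> p.1 \notin s) ->
  (P [set w | (forall i, i \in s -> A i (tuple_row i w)) /\
             (forall p, p \in J -> B p (g p w))] =
   (\prod_(i <- s) P (tuple_row i @^-1` A i)) *
   \prod_(p in J) P (g p @^-1` B p))%E.
Proof.
elim: s J A B => [|i s IH] J A B mA mB.
  move=> _ _; rewrite big_nil mul1e -ig//; congr (P _).
  by apply/seteqP; split => w /=; [case|].
move=> /= /andP[iNs us] NJ.
pose Ev := [set w | (forall j, j \in s -> A j (tuple_row j w)) /\
             (forall p, p \in J -> B p (g p w))].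
have mEv : measurable Ev.
  apply: measurableI.
    by apply: (@measurable_forall_fin _ _ _ (mem s)) => j; exact: mrow.
  by apply: measurable_forall_fin => j; exact: mgB.
have PEv : (P Ev = (\prod_(j <- s) P (tuple_row j @^-1` A j)) *
   \prod_(p in J) P (g p @^-1` B p))%E.
  by apply: IH => // p pJ; have := NJ p pJ; rewrite inE negb_or => /andP[].
have Ev0 : (0 <= fine (P Ev)) by rewrite fine_ge0.
have PEvf : (P Ev \is a fin_num) by rewrite fin_num_measure.
pose X : {mfun T >-> k.-tuple S} := HB.pack (tuple_row i)
  (isMeasurableFun.Build _ _ _ _ _ (measurable_tuple_row i)).
(* As functions of the event on row [i], both sides are finite measures, so rectangles suffice. A
   rectangle is a set of constraints on the entries of row [i], collected in [Ji]; adding them to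
   [J] reduces it to the induction hypothesis. *)
have m12 : (P (tuple_row i @^-1` A i `&` Ev) =
    (fine (P Ev))%:E * P (tuple_row i @^-1` A i))%E.
  apply: (@tuple_rectangles_unique _ _ _ _ (pushforward (mrestr P mEv) X)
    (mscale (NngNum Ev0) (pushforward P X))) => //.
    rewrite [X in (X < _)%E](_ : _ = P Ev) -?ge0_fin_numE//.
    by rewrite -[RHS](congr1 P (setTI Ev)).
  move=> C mC; pose D := [set t : k.-tuple S | forall l, C l (tnth t l)].
  change (P (tuple_row i @^-1` D `&` Ev) =
    (fine (P Ev))%:E * P (tuple_row i @^-1` D))%E.
  have row_rect : tuple_row i @^-1` D = [set w | forall l, C l (g (i, l) w)].
    by apply/seteqP; split => w /= H l; have := H l; rewrite /= tnth_mktuple.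
  rewrite row_rect fineK// PEv.
  pose Ji : {set I * 'I_k} := finset (fun p => p.1 == i).
  pose B' p := if p.1 == i then C p.2 else B p.
  have mB' p : measurable (B' p) by rewrite /B'; case: ifP.
  have disj : fintype.disjoint (mem J) (mem Ji).
    rewrite disjoint_subset; apply/fintype.subsetP => p pJ; rewrite !inE.
    by apply: contraTN (NJ p pJ) => /eqP ->; rewrite mem_head.
  have B'J p : p \in J -> B' p = B p.
    move=> pJ; rewrite /B'; case: eqP => // pi.
    by have := NJ p pJ; rewrite pi mem_head.
  have -> : [set w | forall l, C l (g (i, l) w)] `&` Ev =
     [set w | (forall j, j \in s -> A j (tuple_row j w)) /\
             (forall p, p \in J :|: Ji -> B' p (g p w))].
    apply/seteqP; split => w /=.
      move=> [CH [AH BH]]; split => // -[j l]; rewrite !inE /= => /orP[pJ|/eqP ->].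
        by rewrite B'J//; exact: BH.
      by rewrite /B'/= eqxx; exact: CH.
    move=> [AH BH]; split.
      move=> l; have := BH (i, l); rewrite /B'/= eqxx; apply.
      by rewrite !inE eqxx orbT.
    split=> // p pJ; rewrite -B'J//; apply: BH.
    by rewrite inE pJ.
  rewrite IH//; last first.
    move=> p; rewrite !inE => /orP[pJ|/eqP ->//].
    by have := NJ p pJ; rewrite inE negb_or => /andP[].
  rewrite (eq_bigl [predU J & Ji]) => [|p]; last by rewrite !inE.
  rewrite bigU//= -[LHS]/(_ * (_ * _))%E muleA; congr (_ * _ * _)%E.
    by apply: eq_bigr => p pJ; rewrite B'J.
  have -> : [set w | forall l, C l (g (i, l) w)] =
     [set w | forall p, p \in Ji -> B' p (g p w)].
    apply/seteqP; split => w /= H.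
      by move=> [j l]; rewrite inE/= => /eqP ->; rewrite /B'/= eqxx.
    by move=> l; have := H (i, l); rewrite inE/= eqxx /B'/= eqxx; apply.
  by rewrite ig.
rewrite big_cons -muleA -PEv muleC.
transitivity (P (tuple_row i @^-1` A i `&` Ev)).
  congr (P _).
  apply/seteqP; split => w /=.
    move=> [AH BH]; split; first by apply: AH; rewrite mem_head.
    by split => // j js; apply: AH; rewrite inE js orbT.
  move=> [Ai [AH BH]]; split => // j; rewrite inE => /predU1P[->//|]; exact: AH.
by rewrite m12 fineK.
Qed.

Lemma tuple_row_indep (J : {set I}) (A : I -> set (k.-tuple S)) :
  (forall i, measurable (A i)) ->
  P [set w | forall i, i \in J -> A i (tuple_row i w)] =
  (\prod_(i in J) P (tuple_row i @^-1` A i))%E.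
Proof.
move=> mA.
have := @tuple_row_indep_seq (enum J) A finset.set0 (fun=> setT) mA
  (fun=> measurableT) (enum_uniq _).
rewrite big_set0 mule1 -big_enum/= => <-; last by move=> p; rewrite inE.
congr (P _); apply/seteqP; split => w /=.
  by move=> H; split => [i|p]; rewrite ?inE// mem_enum; exact: H.
by move=> [H _] i iJ; apply: H; rewrite mem_enum.
Qed.

End row_independence.

(** * Gaussian integrals *)

Section gaussian_1d.
Variable R : realType.
Notation mu := (@lebesgue_measure R).
Notation gamma := (@normal_prob R 0 1).

Lemma ge0_integral_normal01 (f : R -> \bar R) : measurable_fun [set: R] f ->
  (forall x, 0 <= f x)%E ->
  (\int[gamma]_x f x = \int[mu]_x (f x * (normal_pdf 0 1 x)%:E))%E.
Proof.
move=> mf f0; apply: (@ge0_integral_density _ _ _ _ _ mu gamma id) => //.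
- exact: measurable_normal_pdf.
- by move=> x; exact: normal_pdf_ge0.
- move=> B mB; transitivity (\int[mu]_(x in B) (normal_pdf 0 1 x)%:E)%E => //.
  rewrite [LHS]integral_mkcond; apply: eq_integral => x _.
  by rewrite patchE indicE; case: ifPn => _; rewrite ?mul1r ?mul0r.
Qed.

Lemma normal_pdf01E (x : R) :
  normal_pdf 0 1 x = (Num.sqrt (pi *+ 2))^-1 * expR (- (x ^+ 2 / 2)).
Proof.
rewrite normal_pdfE ?oner_eq0// /normal_peak /normal_fun.
by rewrite subr0 expr1n mul1r mulNr.
Qed.

(** Up to the factor [a], with a^2 = 1 / (1 - 2 s), the integrand times the standard density is the
    centred normal density of variance a^2. *)
Lemma integral_normal_expR_sqr (s : R) : s < 2^-1 ->
  (\int[gamma]_x (expR (s * x ^+ 2))%:E = (Num.sqrt (1 - 2 * s))^-1%:E)%E.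
Proof.
move=> s2; have s0 : 0 < 1 - 2 * s by lra.
set a := (Num.sqrt (1 - 2 * s))^-1.
have a0 : 0 < a by rewrite invr_gt0 sqrtr_gt0.
have aN0 : a != 0 by rewrite gt_eqF.
have a2 : a ^- 2 = 1 - 2 * s by rewrite /a exprVn invrK sqr_sqrtr// ltW.
rewrite ge0_integral_normal01//; last first.
  apply/measurable_EFinP/measurableT_comp => //.
  by apply: measurable_funM => //; exact: measurable_funX.
transitivity (\int[mu]_x (a%:E * (normal_pdf 0 a x)%:E))%E.
  apply: eq_integral => x _; rewrite -!EFinM; congr EFin.
  rewrite normal_pdf01E normal_pdfE// /normal_peak /normal_fun subr0.
  rewrite -mulrnAr sqrtrM ?sqr_ge0// sqrtr_sqr gtr0_norm// invfM.
  rewrite mulrCA -expRD [RHS]mulrA (mulrA a) divff// mul1r.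
  congr (_ * expR _).
  have -> : - x ^+ 2 / (a ^+ 2 *+ 2) = - (x ^+ 2 * a ^- 2) / 2.
    by rewrite -mulr_natr invfM mulrA mulNr.
  rewrite a2.
  by field.
rewrite ge0_integralZl//=.
- by rewrite integral_normal_pdf mule1.
- by apply/measurable_EFinP; exact: measurable_normal_pdf.
- by move=> x _; rewrite lee_fin normal_pdf_ge0.
- by rewrite lee_fin ltW.
Qed.

(** Completing the square turns the tilted density into the normal density with mean [t]. *)
Lemma integral_normal_expR (t : R) :
  (\int[gamma]_x (expR (t * x))%:E = (expR (t ^+ 2 / 2))%:E)%E.
Proof.
rewrite ge0_integral_normal01//.
transitivity (\int[mu]_x ((expR (t ^+ 2 / 2))%:E * (normal_pdf t 1 x)%:E))%E.
  apply: eq_integral => x _; rewrite -!EFinM; congr EFin.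
  rewrite normal_pdf01E normal_pdfE ?oner_eq0// /normal_peak /normal_fun.
  rewrite expr1n mul1r mulrCA -expRD [RHS]mulrCA -expRD; congr (_ * expR _).
  by field.
rewrite ge0_integralZl//=.
- by rewrite integral_normal_pdf mule1.
- by apply/measurable_EFinP; exact: measurable_normal_pdf.
- by move=> x _; rewrite lee_fin normal_pdf_ge0.
- by apply/measurable_EFinP; apply: measurableT_comp => //; exact: mulrl_measurable.
Qed.

End gaussian_1d.

Lemma Rintegral_dominated_cvg d (T : measurableType d) (R : realType)
    (mu : {measure set T -> \bar R}) (f_ : nat -> T -> R) (f g : T -> R) :
  (forall n, measurable_fun [set: T] (f_ n)) -> measurable_fun [set: T] f ->
  {ae mu, forall x, f_ n x @[n --> \oo] --> f x} ->
  mu.-integrable [set: T] (EFin \o g) ->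
  (forall n x, `|f_ n x| <= g x) ->
  mu.-integrable [set: T] (EFin \o f) /\
  \int[mu]_x f_ n x @[n --> \oo] --> \int[mu]_x f x.
Proof.
move=> mf_ mf f_f ig f_g.
have [|||||ifE _ cf] := @dominated_convergence _ T R mu setT measurableT
    (fun n => EFin \o f_ n) (EFin \o f) (EFin \o g).
- by move=> n; exact/measurable_EFinP.
- exact/measurable_EFinP.
- by apply: filterS f_f => x cx _; exact: cvg_EFin (nearW _ _) cx.
- exact: ig.
- by apply: aeW => x n _ /=; rewrite lee_fin.
split=> //; apply: fine_cvg; rewrite fineK ?integrable_fin_num//.
Qed.

(** * Gaussian integration by parts and characteristic functions *)

Section gaussian_char.
Variable R : realType.
Notation mu := (@lebesgue_measure R).
Notation gamma := (@normal_prob R 0 1).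

(** The fundamental theorem of calculus on [-n, n]; as [f] is integrable, the symmetric limit is its
    integral over the line. *)
Lemma integral_derive_line (F f : R -> R) :
  (forall x : R, is_derive x 1 F (f x)) -> continuous f ->
  mu.-integrable [set: R] (EFin \o f) ->
  (F n%:R - F (- n%:R)) @[n --> \oo] --> 0 ->
  \int[mu]_x f x = 0.
Proof.
move=> dF cf fi Fn.
have mf : measurable_fun [set: R] f.
  by apply/measurable_EFinP; exact: (measurable_int mu).
pose I (n : nat) : set R := `[- n%:R, n%:R]%classic.
have [|//||||_ h] := @Rintegral_dominated_cvg _ (measurableTypeR R) R mu (fun n => f \_ (I n)) f
  (fun x => `|f x|).
- move=> n; apply: (iffLR (@measurable_restrictT _ _ _ _ (I n) f _)).
    exact: measurable_itv.
  exact: measurable_funTS.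
- apply: aeW => x; apply: cvg_near_cst; near=> n; rewrite patchE mem_set//.
  rewrite /I/= in_itv/= -ler_norml; near: n.
  exact: nbhs_infty_ger.
- exact: integrable_abse fi.
- by move=> n x; rewrite patchE; case: ifPn => // _; rewrite normr0.
(* The shift to [n.+1] keeps the interval nondegenerate. *)
have FE n : \int[mu]_x (f \_ (I n.+1)) x = F n.+1%:R - F (- n.+1%:R).
  rewrite -Rintegral_mkcond /Rintegral (@continuous_FTC2 _ f F)//.
  - by rewrite -subr_gt0 opprK -mulr2n mulrn_wgt0.
  - exact: continuous_subspaceT.
  - have cF x : {for x, continuous F}.
      by apply/differentiable_continuous/derivable1_diffP; exact: ex_derive.
    split => [x _||]; first exact: ex_derive.
      exact/cvg_at_right_filter/cF.
    exact/cvg_at_left_filter/cF.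
  - by move=> x _; rewrite derive1E; exact: derive_val.
have h1 : \int[mu]_x (f \_ (I n.+1)) x @[n --> \oo] --> (0 : R).
  under eq_fun do rewrite FE.
  by have := Fn; rewrite -cvg_shiftS.
have h2 : \int[mu]_x (f \_ (I n.+1)) x @[n --> \oo] --> \int[mu]_x f x.
  by have := h; rewrite -cvg_shiftS.
exact: (cvg_unique _ h2 h1).
Unshelve. all: by end_near. Qed.

End gaussian_char.

Section derive_comp.
Variable R : realType.
Implicit Types (b c x : R) (f : R -> R).

Lemma is_derive_affine b c x : is_derive x 1 (fun y : R => b * y + c) b.
Proof.
rewrite (_ : (fun y => _) = (b \*: id) + cst c); last by apply/funext.
by apply: is_derive_eq; rewrite -[RHS]mulr1 addr0.
Qed.

Lemma is_derive_sin_affine b c x :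
  is_derive x 1 (fun y : R => sin (b * y + c)) (b * cos (b * x + c)).
Proof.
rewrite mulrC; apply: (@is_derive1_comp _ sin (fun y => b * y + c)).
exact: is_derive_affine.
Qed.

Lemma is_derive_cos_affine b c x :
  is_derive x 1 (fun y : R => cos (b * y + c)) (- (b * sin (b * x + c))).
Proof.
rewrite mulrC -mulNr; apply: (@is_derive1_comp _ cos (fun y => b * y + c)).
exact: is_derive_affine.
Qed.

Lemma is_derive_expR_sqr b x :
  is_derive x 1 (fun y : R => expR (b * y ^+ 2)) (2 * b * x * expR (b * x ^+ 2)).
Proof.
have d2 : is_derive x 1 (fun y : R => b * y ^+ 2) (2 * b * x).
  rewrite (_ : (fun y => _) = (b \*: (id ^+ 2))); last first.
    by apply/funext => y; rewrite /= fctE.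
  by apply: is_derive_eq; rewrite /= expr1 scaler1 /GRing.scale/= mulrCA mulrA.
rewrite mulrC; exact: (@is_derive1_comp _ expR (fun y => b * y ^+ 2)).
Qed.

End derive_comp.

Section gaussian_char.
Variable R : realType.
Notation mu := (@lebesgue_measure R).
Notation gamma := (@normal_prob R 0 1).

Lemma integral_normal01 (f : R -> R) : gamma.-integrable [set: R] (EFin \o f) ->
  mu.-integrable [set: R] (EFin \o (fun x => f x * normal_pdf 0 1 x)) /\
  \int[gamma]_x f x = \int[mu]_x (f x * normal_pdf 0 1 x).
Proof.
move=> fi; have mf : measurable_fun [set: R] f.
  by apply/measurable_EFinP; exact: (measurable_int gamma).
have mp : measurable_fun [set: R] (normal_pdf 0 1 : R -> R).
  exact: measurable_normal_pdf.
have p0 x : 0 <= normal_pdf 0 1 x :> R by exact: normal_pdf_ge0.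
split.
  apply/integrableP; split; first by apply/measurable_EFinP; exact: measurable_funM.
  case/integrableP : (fi) => _; rewrite ge0_integral_normal01//; last first.
    by apply: measurableT_comp => //; exact/measurable_EFinP.
  apply: le_lt_trans; rewrite le_eqVlt; apply/orP; left; apply/eqP.
  by apply: eq_integral => x _; rewrite /= normrM (ger0_norm (p0 x)) EFinM.
rewrite /Rintegral integralE [in RHS]integralE; congr fine.
have mfE : measurable_fun setT (EFin \o f) by exact/measurable_EFinP.
congr (_ - _)%E.
  rewrite ge0_integral_normal01//; last exact: measurable_funepos.
  apply: eq_integral => x _; rewrite !funeposE maxe_pMl ?lee_fin//.
  by rewrite mul0e -EFinM.
rewrite ge0_integral_normal01//; last exact: measurable_funeneg.
apply: eq_integral => x _; rewrite !funenegE maxe_pMl ?lee_fin//.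
by rewrite mul0e -EFinM mulNr.
Qed.

(** |x| <= 1 + x^2 / 4 <= exp(x^2 / 4), and 1/4 is below the critical exponent 1/2. *)
Lemma integrable_normal_norm : gamma.-integrable [set: R] (EFin \o (fun x => `|x|)).
Proof.
apply: (@integrable_dominated _ (measurableTypeR R) R gamma (fun x : R => expR (4^-1 * x ^+ 2))).
- exact: measurableT_comp.
- move=> x; rewrite normr_id; apply: le_trans (expR_ge1Dx _).
  by rewrite -real_normK ?num_real//; have := sqr_ge0 (`|x| - 2); lra.
- apply/integrableP; split.
    apply/measurable_EFinP/measurableT_comp => //.
    by apply: measurable_funM => //; exact: measurable_funX.
  under eq_integral do rewrite /= ger0_norm ?expR_ge0//.
  by rewrite integral_normal_expR_sqr ?ltry//; lra.
Qed.

Lemma integrable_normal_bounded (f : R -> R) (M : R) :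
  measurable_fun [set: R] f -> (forall x, `|f x| <= M) ->
  gamma.-integrable [set: R] (EFin \o f).
Proof. exact: (@bounded_integrable _ (measurableTypeR R) R gamma). Qed.

Lemma integrable_normal_id_bounded (f : R -> R) (M : R) :
  measurable_fun [set: R] f -> (forall x, `|f x| <= M) ->
  gamma.-integrable [set: R] (EFin \o (fun x => x * f x)).
Proof.
move=> mf fM.
have M0 : 0 <= M by rewrite (le_trans _ (fM 0)).
apply: (@integrable_dominated _ (measurableTypeR R) R gamma (fun x : R => M * `|x|)).
- exact: measurable_funM.
- by move=> x; rewrite normrM mulrC ler_wpM2r.
- exact/integrableZl_real/integrable_normal_norm.
Qed.

Lemma measurable_sin_affine (b c : R) : measurable_fun [set: R] (fun x => sin (b * x + c)).
Proof.
apply: continuous_measurable_fun => x.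
apply/differentiable_continuous/derivable1_diffP.
by have [] := is_derive_sin_affine b c x.
Qed.

Lemma measurable_cos_affine (b c : R) : measurable_fun [set: R] (fun x => cos (b * x + c)).
Proof.
apply: continuous_measurable_fun => x.
apply/differentiable_continuous/derivable1_diffP.
by have [] := is_derive_cos_affine b c x.
Qed.

Lemma is_derive_normal_pdf01 (x : R) :
  is_derive x 1 (normal_pdf 0 1 : R -> R) (- x * normal_pdf 0 1 x).
Proof.
rewrite (_ : normal_pdf 0 1 = (Num.sqrt (pi *+ 2))^-1 \*: (fun x : R => expR (- 2^-1 * x ^+ 2))); last first.
  by apply/funext => y; rewrite normal_pdf01E /= /GRing.scale/= mulNr (mulrC 2^-1).
have := is_derive_expR_sqr (- 2^-1) x => h.
apply: is_derive_eq; rewrite /= /GRing.scale/=.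
by rewrite mulrN divff ?pnatr_eq0//; ring.
Qed.

(** Stein's identity: the difference of the two integrands, times the density, is the derivative of
    sin(b x + c) times the density. *)
Lemma stein_sin (b c : R) :
  \int[gamma]_x (x * sin (b * x + c)) = b * \int[gamma]_x cos (b * x + c).
Proof.
have is_ : gamma.-integrable setT (EFin \o (fun x => x * sin (b * x + c))).
  apply: (@integrable_normal_id_bounded _ 1) => [|x]; first exact: measurable_sin_affine.
  by rewrite ler_norml sin_geN1 sin_le1.
have ic : gamma.-integrable setT (EFin \o (fun x => cos (b * x + c))).
  apply: (@integrable_normal_bounded _ 1) => [|x]; first exact: measurable_cos_affine.
  by rewrite ler_norml cos_geN1 cos_le1.
have ibc : gamma.-integrable setT (EFin \o (fun x => b * cos (b * x + c))).
  exact: integrableZl_real.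
have idiff : gamma.-integrable setT
    (EFin \o (fun x => b * cos (b * x + c) - x * sin (b * x + c))).
  exact: integrableB_real.
apply/esym/eqP; rewrite -RintegralZl// -subr_eq0 -RintegralB//; apply/eqP.
have [im ->] := integral_normal01 idiff.
apply: (@integral_derive_line _ (fun x => sin (b * x + c) * normal_pdf 0 1 x)).
- move=> x.
  have h1 := is_derive_sin_affine b c x.
  have h2 := is_derive_normal_pdf01 x.
  apply: is_derive_eq; rewrite /GRing.scale/=.
  by ring.
- move=> x; apply: cvgM; last first.
    by apply: continuous_normal_pdf; rewrite oner_eq0.
  have cts (f : R -> R) df : is_derive x 1 f df -> f @ x --> f x.
    by move=> [h _]; apply/differentiable_continuous/derivable1_diffP.
  apply: cvgB; apply: cvgM; try exact: cvg_cst; try exact: cvg_id.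
    exact: cts (is_derive_cos_affine b c x).
  exact: cts (is_derive_sin_affine b c x).
- exact: im.
(* The boundary terms need only some decay: exp(n^2 / 2) >= 1 + n^2 / 2 >= (n + 1) / 2. *)
- have p n : normal_pdf 0 1 n%:R <= n.+1%:R^-1 * 2 :> R.
    rewrite normal_pdf01E.
    have h1 : (Num.sqrt (pi *+ 2))^-1 <= 1 :> R.
      have pi2 : 1 <= pi *+ 2 :> R by have := pi_ge2 R; rewrite mulr2n; lra.
      rewrite invf_le1 ?sqrtr_gt0; last by apply: lt_le_trans pi2.
      by rewrite -{1}(sqrtr1 R) ler_wsqrtr.
    apply: (@le_trans _ _ (expR (- (n%:R ^+ 2 / 2)))).
      by rewrite ler_piMl ?expR_ge0.
    rewrite expRN invf_ple ?posrE ?expR_gt0 ?mulr_gt0 ?invr_gt0//.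
    rewrite invfM invrK; apply: le_trans (expR_ge1Dx _).
    rewrite -natr1; have := sqr_ge0 (n%:R - 2^-1 : R); lra.
  apply: (@squeeze_cvgr _ _ _ _ (fun n => - (n.+1%:R^-1 * 4)) (fun n => n.+1%:R^-1 * 4)).
  + near=> n; rewrite -ler_norml.
    rewrite (_ : normal_pdf 0 1 (- n%:R) = normal_pdf 0 1 n%:R); last first.
      by rewrite !normal_pdf01E sqrrN.
    have s1 (u : R) : `|sin u * normal_pdf 0 1 n%:R| <= n.+1%:R^-1 * 2.
      rewrite normrM [X in _ * X]ger0_norm ?normal_pdf_ge0//; apply: le_trans (p n).
      by rewrite ler_piMl ?normal_pdf_ge0// ler_norml sin_geN1 sin_le1.
    apply: le_trans (ler_normB _ _) _; apply: le_trans (lerD (s1 _) (s1 _)) _.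
    by rewrite -mulrDr -natrD.
  + rewrite -oppr0 -(mul0r 4); apply: cvgN; apply: cvgMl.
    exact: cvg_harmonic.
  + by rewrite -(mul0r 4); apply: cvgMl; exact: cvg_harmonic.
Unshelve. all: by end_near. Qed.

(** As a function of [b] the integral satisfies C' = - b C, by differentiation under the integral
    and Stein's identity. Hence C(b) exp(b^2 / 2) is constant, equal to cos c. The phase [c] covers
    cosine and sine together. *)
Lemma gaussian_char (b c : R) :
  \int[gamma]_x cos (b * x + c) = cos c * expR (- (b ^+ 2 / 2)).
Proof.
pose f u x : R := cos (u * x + c).
pose C u := \int[gamma]_x f u x.
have d1f (u x : R) : is_derive u 1 (f ^~ x) (- (x * sin (u * x + c))).
  rewrite (_ : f ^~ x = (fun y => cos (x * y + c))); last first.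
    by apply/funext => y; rewrite /f mulrC.
  rewrite [u * x]mulrC; exact: is_derive_cos_affine.
have fi u : gamma.-integrable setT (EFin \o f u).
  apply: (@integrable_normal_bounded _ 1) => [|x]; first exact: measurable_cos_affine.
  by rewrite ler_norml cos_geN1 cos_le1.
have is_ u : gamma.-integrable setT (EFin \o (fun x => x * sin (u * x + c))).
  apply: (@integrable_normal_id_bounded _ 1) => [|x]; first exact: measurable_sin_affine.
  by rewrite ler_norml sin_geN1 sin_le1.
have dC (u : R) : is_derive u 1 C (- (u * C u)).
  have Iu : [set` `]u - 1, u + 1[] u by rewrite /= in_itv/=; apply/andP; split; lra.
  have dfE (x y : R) : partial1of2 f x y = - (y * sin (x * y + c)).
    by rewrite partial1of2E; exact: derive_val.
  have fder (x y : R) : [set` `]u - 1, u + 1[] x -> setT y -> derivable (f ^~ y) x 1.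
    by move=> _ _; exact: ex_derive.
  have fub (x y : R) : [set` `]u - 1, u + 1[] x -> setT y ->
      `|partial1of2 f x y| <= `|y|.
    move=> _ _; rewrite dfE normrN normrM ler_piMr//.
    by rewrite ler_norml sin_geN1 sin_le1.
  apply: DeriveDef.
    exact: (@derivable_under_integral R _ (measurableTypeR R) gamma f setT
      measurableT u (u - 1) (u + 1) Iu (fun x _ => fi x) fder (fun y => `|y|)
      (fun y => normr_ge0 y) integrable_normal_norm fub).
  rewrite -derive1E (@differentiation_under_integral R _ (measurableTypeR R) gamma f setT
      measurableT u (u - 1) (u + 1) Iu (fun x _ => fi x) fder (fun y => `|y|)
      (fun y => normr_ge0 y) integrable_normal_norm fub).
  rewrite /C -stein_sin -mulN1r -RintegralZl//.
  by apply: eq_Rintegral => x _; rewrite dfE mulN1r.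
pose h u := C u * expR (2^-1 * u ^+ 2).
have dh (u : R) : is_derive u 1 h 0.
  have d1 := dC u.
  have d2 := is_derive_expR_sqr 2^-1 u.
  apply: is_derive_eq; rewrite /GRing.scale/= divff ?pnatr_eq0//.
  by ring.
have h0 : h 0 = cos c.
  rewrite /h expr0n/= mulr0 expR0 mulr1 /C /f.
  under eq_Rintegral do rewrite mul0r add0r.
  exact: (@Rintegral_cst_prob _ (measurableTypeR R) R gamma).
rewrite -h0 (is_derive_0_is_cst 0 b dh) /h -mulrA -expRD.
by rewrite mulrC (_ : _ + _ = 0) ?expR0 ?mul1r//; lra.
Qed.

End gaussian_char.

Section gaussian_variable.
Context d (T : measurableType d) (R : realType) (P : probability T R).
Notation gamma := (@normal_prob R 0 1).
Variable g : T -> R.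
Hypothesis mg : measurable_fun [set: T] g.
Hypothesis gE : forall B, measurable B -> P (g @^-1` B) = normal_prob 0 1 B.

Lemma ge0_integral_normal_law (f : R -> \bar R) : measurable_fun [set: R] f ->
  (forall x, 0 <= f x)%E -> (\int[P]_w f (g w) = \int[gamma]_x f x)%E.
Proof.
move=> mf f0.
rewrite (@ge0_integral_density _ _ _ (measurableTypeR R) _ P gamma g (cst 1))//.
  by apply: eq_integral => w _; rewrite /= mule1.
move=> B mB; transitivity (P (g @^-1` B)); first by rewrite gE.
have mgB : measurable (g @^-1` B) by rewrite -[X in measurable X]setTI; exact: mg.
rewrite -[in LHS](setIT (g @^-1` B)) -integral_indic//.
by apply: eq_integral => w _; rewrite mulr1.
Qed.

Lemma Rintegral_normal_law (f : R -> R) : measurable_fun [set: R] f ->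
  \int[P]_w f (g w) = \int[gamma]_x f x.
Proof.
move=> mf; have mfE : measurable_fun [set: R] (EFin \o f) by exact/measurable_EFinP.
rewrite /Rintegral integralE [in RHS]integralE; congr (fine (_ - _)).
  rewrite -ge0_integral_normal_law//; last exact: measurable_funepos.
  by apply: eq_integral => x _; rewrite !funeposE.
rewrite -ge0_integral_normal_law//; last exact: measurable_funeneg.
by apply: eq_integral => x _; rewrite !funenegE.
Qed.

End gaussian_variable.

(** * Linear combinations of independent standard Gaussians *)

Section gaussian_family.
Context d (T : measurableType d) (R : realType) (P : probability T R).
Notation gamma := (@normal_prob R 0 1).
Variables (I : finType) (g : I -> T -> R).
Hypothesis mg : forall i, measurable_fun [set: T] (g i).
Hypothesis gE : forall i B, measurable B -> P (g i @^-1` B) = normal_prob 0 1 B.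
Hypothesis ig : mutually_independent P g.

Let norm_cos (x : R) : `|cos x| <= 1.
Proof. by rewrite ler_norml cos_geN1 cos_le1. Qed.

Let norm_sin (x : R) : `|sin x| <= 1.
Proof. by rewrite ler_norml sin_geN1 sin_le1. Qed.

Lemma measurable_cosT (f : T -> R) : measurable_fun [set: T] f ->
  measurable_fun [set: T] (fun w => cos (f w)).
Proof.
move=> mf; apply: measurableT_comp => //.
by apply: continuous_measurable_fun; exact: continuous_cos.
Qed.

Lemma measurable_sinT (f : T -> R) : measurable_fun [set: T] f ->
  measurable_fun [set: T] (fun w => sin (f w)).
Proof.
move=> mf; apply: measurableT_comp => //.
by apply: continuous_measurable_fun; exact: continuous_sin.
Qed.

Lemma measurable_lincomb (b : I -> R) (s : seq I) :
  measurable_fun [set: T] (fun w => \sum_(i <- s) b i * g i w).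
Proof. by apply: measurable_sum => i; apply: measurable_funM. Qed.

Let mgB i B : measurable B -> measurable (g i @^-1` B).
Proof. by move=> mB; rewrite -[X in measurable X]setTI; exact: mg. Qed.

(** The free phase replaces complex exponentials: the addition formula leaves a cosine of the
    remaining sum, with phase [c], and a sine, which is the same cosine with phase c - pi / 2. The
    second is multiplied by the mean of sin(b_i g_i), which is 0. Events over [J] serve to test
    independence on indicators. *)
Lemma gaussian_lincomb_char_seq (b : I -> R) (c : R) (s : seq I) (J : {set I})
    (B : I -> set R) :
  (forall i, measurable (B i)) -> uniq s -> {in s, forall i, i \notin J} ->
  \int[P]_w (cos (\sum_(i <- s) b i * g i w + c) *
     \1_[set w | forall i, i \in J -> B i (g i w)] w) =
  cos c * expR (- ((\sum_(i <- s) b i ^+ 2) / 2)) *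
  \prod_(i in J) fine (P (g i @^-1` B i)).
Proof.
have mJ (K : {set I}) (C : I -> set R) : (forall i, measurable (C i)) ->
    measurable [set w | forall i, i \in K -> C i (g i w)].
  by move=> mC; apply: measurable_forall_fin => i; exact: mgB.
have prodE (K : {set I}) (C : I -> set R) : (forall i, measurable (C i)) ->
    fine (P [set w | forall i, i \in K -> C i (g i w)]) =
    \prod_(i in K) fine (P (g i @^-1` C i)).
  move=> mC; rewrite ig// -[RHS]/(fine (_)%:E) -prodEFin; congr fine.
  by apply: eq_bigr => i _; rewrite fineK// fin_num_measure//; exact: mgB.
elim: s c J B => [|i s IH] c J B mB.
  move=> _ _; under eq_Rintegral do rewrite big_nil add0r.
  rewrite big_nil mul0r oppr0 expR0 mulr1 RintegralZl//; last first.
    apply: (@bounded_integrable _ _ _ _ _ 1) => [|w]; last exact: norm_indic.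
    by apply: measurable_indic; exact: mJ.
  by rewrite Rintegral_indic ?prodE//; exact: mJ.
move=> /= /andP[iNs us] NJ.
have iNJ : i \notin J by apply: NJ; rewrite mem_head.
have sNJ : {in s, forall j, j \notin J}.
  by move=> j js; apply: NJ; rewrite inE js orbT.
pose ind w : R := \1_[set w | forall j, j \in J -> B j (g j w)] w.
have mind : measurable_fun [set: T] ind by apply: measurable_indic; exact: mJ.
pose S w := \sum_(j <- s) b j * g j w.
pose Z c' w := cos (S w + c') * ind w.
have mZ c' : measurable_fun [set: T] (Z c').
  apply: measurable_funM => //; apply: measurable_cosT.
  by apply: measurable_funD => //; exact: measurable_lincomb.
have Z1 c' w : `|Z c' w| <= 1.
  rewrite normrM -[leRHS]mulr1 ler_pM//; exact: norm_indic.
have ZE c' : \int[P]_w Z c' w = cos c' * expR (- ((\sum_(j <- s) b j ^+ 2) / 2)) *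
    \prod_(j in J) fine (P (g j @^-1` B j)) by rewrite /Z /S /ind IH.
have ZB c' C : measurable C -> \int[P]_w (\1_C (g i w) * Z c' w) =
    fine (P (g i @^-1` C)) * \int[P]_w Z c' w.
  move=> mC; pose B' j := if j == i then C else B j.
  have mB' j : measurable (B' j) by rewrite /B'; case: ifP.
  have B'J j : j \in J -> B' j = B j.
    by rewrite /B'; case: eqP => // ->; rewrite (negbTE iNJ).
  transitivity (\int[P]_w (cos (S w + c') *
     \1_[set w | forall j, j \in (i |: J) -> B' j (g j w)] w)).
    apply: eq_Rintegral => w _; rewrite /Z mulrCA; congr (_ * _).
    rewrite !indicE -natrM mulnb; congr (_%:R); congr nat_of_bool.
    apply/andP/idP; rewrite !inE.
      move=> [Ct BJ] j; rewrite in_setU1 => /predU1P[->|jJ].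
        by rewrite /B' eqxx.
      by rewrite B'J//; exact: BJ.
    move=> H; split; first by have := H i (setU11 _ _); rewrite /B' eqxx.
    by move=> j jJ; rewrite -B'J//; apply: H; rewrite setU1r.
  rewrite /S IH//; last first.
    move=> j js; rewrite in_setU1 negb_or sNJ// andbT.
    by apply: contraNneq iNs => <-.
  rewrite big_setU1//= ZE mulrCA; congr (_ * _); first by rewrite /B' eqxx.
  by congr (_ * _); apply: eq_bigr => j jJ; rewrite B'J.
have mcosi : measurable_fun [set: R] (fun x => cos (b i * x) : R).
  by have := @measurable_cos_affine R (b i) 0; under eq_fun do rewrite addr0.
have msini : measurable_fun [set: R] (fun x => sin (b i * x) : R).
  by have := @measurable_sin_affine R (b i) 0; under eq_fun do rewrite addr0.
have IZ (f : R -> R) c' : measurable_fun [set: R] f -> (forall x, `|f x| <= 1) ->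
    P.-integrable setT (EFin \o (fun w => f (g i w) * Z c' w)).
  move=> mf f1; apply: (@bounded_integrable _ _ _ _ _ (1 * 1)) => [|w].
    by apply: measurable_funM => //; exact: measurableT_comp.
  by rewrite normrM ler_pM.
transitivity (\int[P]_w (cos (b i * g i w) * Z c w -
    sin (b i * g i w) * Z (c - pi / 2) w)).
  apply: eq_Rintegral => w _; rewrite /Z big_cons -addrA cosD.
  by rewrite addrA cosBpihalf; rewrite /ind /S; ring.
have EZ (f : R -> R) c' : measurable_fun [set: R] f -> (forall x, `|f x| <= 1) ->
    \int[P]_w (f (g i w) * Z c' w) = (\int[gamma]_x f x) * \int[P]_w Z c' w.
  move=> mf f1; rewrite (@Rintegral_indep _ _ _ _ _ P (g i) (mg i) _ 1 _ 1)//.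
    by rewrite (@Rintegral_normal_law _ _ _ P (g i))// => B0 mB0; exact: gE.
  by move=> C mC; exact: ZB.
rewrite RintegralB//; [|exact: (IZ (fun x => cos (b i * x)))
  |exact: (IZ (fun x => sin (b i * x)))].
rewrite (EZ (fun x => cos (b i * x)))// (EZ (fun x => sin (b i * x)))//.
have -> : \int[gamma]_x cos (b i * x) = expR (- (b i ^+ 2 / 2)).
  have := @gaussian_char R (b i) 0; rewrite cos0 mul1r => <-.
  by apply: eq_Rintegral => x _; rewrite addr0.
have -> : \int[gamma]_x sin (b i * x) = 0.
  have S0 : \int[gamma]_x cos (b i * x + - (pi / 2)) = 0.
    by rewrite gaussian_char cosN cos_pihalf mul0r.
  by rewrite -[RHS]S0; apply: eq_Rintegral => x _; rewrite cosBpihalf.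
rewrite mul0r subr0 ZE big_cons mulrDl opprD expRD.
by ring.
Qed.

Lemma gaussian_lincomb_char (b : I -> R) (c : R) (s : seq I) : uniq s ->
  \int[P]_w cos (\sum_(i <- s) b i * g i w + c) =
  cos c * expR (- ((\sum_(i <- s) b i ^+ 2) / 2)).
Proof.
move=> us; have := @gaussian_lincomb_char_seq b c s finset.set0 (fun=> setT)
  (fun=> measurableT) us.
rewrite big_set0 mulr1 => <-; last by move=> i _; rewrite inE.
apply: eq_Rintegral => w _; rewrite (_ : [set w | _] = setT) ?indicT ?mulr1//.
by apply/seteqP; split => // w' _ i; rewrite inE.
Qed.

End gaussian_family.

Lemma Rintegral_swap d1 d2 (T1 : measurableType d1) (T2 : measurableType d2)
    (R : realType) (P1 : probability T1 R) (P2 : probability T2 R)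
    (f : T1 -> T2 -> R) (M : R) :
  measurable_fun [set: T1 * T2] (fun p => f p.1 p.2) ->
  (forall x y, `|f x y| <= M) ->
  \int[P1]_x \int[P2]_y f x y = \int[P2]_y \int[P1]_x f x y.
Proof.
move=> mf fM.
have fi : (P1 \x P2)%E.-integrable [set: T1 * T2]
    (fun p => (f p.1 p.2)%:E).
  by apply: (@bounded_integrable _ _ _ _ _ M) => // -[x y]; exact: fM.
have f1 x : P2.-integrable setT (EFin \o f x).
  apply: (@bounded_integrable _ _ _ _ _ M) => //.
  exact: (measurableT_comp mf (measurable_pair1 x)).
have f2 y : P1.-integrable setT (EFin \o (f ^~ y)).
  apply: (@bounded_integrable _ _ _ _ _ M) => //.
  exact: (measurableT_comp mf (measurable_pair2 y)).
rewrite /Rintegral.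
under eq_integral do rewrite EFin_Rintegral//.
under [in RHS]eq_integral do rewrite EFin_Rintegral//.
by rewrite (Fubini fi).
Qed.

Section gaussian_lincomb.
Context d (T : measurableType d) (R : realType) (P : probability T R).
Notation gamma := (@normal_prob R 0 1).
Variables (I : finType) (g : I -> T -> R).
Hypothesis mg : forall i, measurable_fun [set: T] (g i).
Hypothesis gE : forall i B, measurable B -> P (g i @^-1` B) = normal_prob 0 1 B.
Hypothesis ig : mutually_independent P g.
Variables (s : seq I) (us : uniq s).

Let L (b : I -> R) w := \sum_(i <- s) b i * g i w.
Let N2 (b : I -> R) := \sum_(i <- s) b i ^+ 2.

Let mL b : measurable_fun [set: T] (L b).
Proof. exact: measurable_lincomb. Qed.

Lemma sum_sqr_ge0 b : 0 <= N2 b.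
Proof. by apply: sumr_ge0 => i _; exact: sqr_ge0. Qed.

Lemma gaussian_lincomb_expR (b : I -> R) :
  (\int[P]_w (expR (L b w))%:E = (expR (N2 b / 2))%:E)%E.
Proof.
have := @ge0_integral_prod_indep_seq _ _ T (measurableTypeR R) R P I g mg ig
  (fun i x => expR (b i * x)) (fun i => expR (b i ^+ 2 / 2)) s finset.set0
  (fun=> setT) (fun i => measurableT_comp (@measurable_expR R) (@mulrl_measurable R setT (b i)))
  (fun i x => expR_ge0 _) _ (fun=> measurableT) us.
rewrite big_set0 mule1 /N2 mulr_suml expR_sum => <-.
- apply: eq_integral => w _; rewrite (_ : [set w | _] = setT) ?indicT ?mulr1.
    by rewrite /L expR_sum.
  by apply/seteqP; split => // w' _ i; rewrite inE.
- move=> i; rewrite (@ge0_integral_normal_law _ _ _ P (g i) (mg i) (gE i)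
    (fun x => (expR (b i * x))%:E)).
  + by rewrite integral_normal_expR.
  + by apply/measurable_EFinP; exact: (measurableT_comp (@measurable_expR R) (@mulrl_measurable R setT (b i))).
  + by move=> x; rewrite lee_fin expR_ge0.
- by move=> i; rewrite inE.
Qed.

(** The square is linearized: exp(t L^2) is the mean of exp(sqrt(2t) z L) over a standard Gaussian
    z. Exchanging the integrals leaves the Laplace transform of L, then a one-dimensional integral
    in z. *)
Lemma gaussian_lincomb_expR_sqr (b : I -> R) (t : R) : 0 <= t ->
  t * N2 b < 2^-1 ->
  (\int[P]_w (expR (t * L b w ^+ 2))%:E = (Num.sqrt (1 - 2 * (t * N2 b)))^-1%:E)%E.
Proof.
move=> t0 tb; pose a := Num.sqrt (2 * t).
have a2 : a ^+ 2 = 2 * t by rewrite sqr_sqrtr// mulr_ge0.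
pose f (p : T * measurableTypeR R) : \bar R := (expR (a * p.2 * L b p.1))%:E.
have mf : measurable_fun [set: T * measurableTypeR R] f.
  apply/measurable_EFinP; apply: measurableT_comp => //.
  apply: measurable_funM; first by apply: measurable_funM.
  exact: (measurableT_comp (mL b)).
transitivity (\int[P]_w \int[gamma]_z f (w, z))%E.
  apply: eq_integral => w _; rewrite /f/=.
  transitivity (\int[gamma]_x (expR ((a * L b w) * x))%:E)%E; last first.
    by apply: eq_integral => x _; rewrite mulrAC.
  by rewrite integral_normal_expR exprMn a2; congr (expR _)%:E; field.
rewrite (@fubini_tonelli _ _ _ _ _ P gamma f mf)//; last first.
  by move=> p; rewrite /f lee_fin expR_ge0.
rewrite -integral_normal_expR_sqr//.
apply: eq_integral => z _; rewrite /f/=.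
transitivity (\int[P]_w (expR (L (fun i => a * z * b i) w))%:E)%E.
  apply: eq_integral => w _; rewrite /L big_distrr/=; congr (expR _)%:E.
  by apply: eq_bigr => i _; rewrite mulrA.
rewrite gaussian_lincomb_expR; congr (expR _)%:E; rewrite /N2.
under eq_bigr do rewrite exprMn.
by rewrite -big_distrr/= exprMn a2; field.
Qed.

(** The same linearization with a negative sign: exp(-t (L - y)^2) is the mean of cos(sqrt(2t) z (L
    - y)). *)
Lemma gaussian_lincomb_expRN_sqr (b : I -> R) (t y : R) : 0 <= t ->
  \int[P]_w expR (- (t * (L b w - y) ^+ 2)) =
  \int[gamma]_z (cos (Num.sqrt (2 * t) * z * y) * expR (- (t * N2 b * z ^+ 2))).
Proof.
move=> t0; set a := Num.sqrt (2 * t).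
have a2 : a ^+ 2 = 2 * t by rewrite sqr_sqrtr// mulr_ge0.
pose f w (z : measurableTypeR R) : R := cos (a * z * (L b w - y)).
have mf : measurable_fun [set: T * measurableTypeR R] (fun p => f p.1 p.2).
  apply: measurable_cosT.
  apply: measurable_funM; first by apply: measurable_funM.
  by apply: measurable_funB => //; exact: (measurableT_comp (mL b)).
transitivity (\int[P]_w \int[gamma]_z f w z).
  apply: eq_Rintegral => w _; rewrite /f/=.
  transitivity (\int[gamma]_x cos (a * (L b w - y) * x + 0)); last first.
    by apply: eq_Rintegral => x _; rewrite addr0 mulrAC.
  by rewrite gaussian_char cos0 mul1r exprMn a2; congr expR; field.
rewrite (@Rintegral_swap _ _ _ _ _ P gamma f 1)//; last first.
  by move=> w z; rewrite ler_norml cos_geN1 cos_le1.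
apply: eq_Rintegral => z _; rewrite /f.
transitivity (\int[P]_w cos (L (fun i => a * z * b i) w + - (a * z * y))).
  apply: eq_Rintegral => w _; rewrite mulrBr; congr (cos (_ - _)).
  by rewrite /L big_distrr/=; apply: eq_bigr => i _; rewrite mulrA.
rewrite gaussian_lincomb_char// cosN; congr (_ * expR _).
under eq_bigr do rewrite exprMn.
by rewrite -big_distrr/= exprMn a2 -/(N2 b); field.
Qed.

Let measurable_gauss (u : R) : measurable_fun [set: R] (fun z : R => expR (- (u * z ^+ 2))).
Proof.
apply: measurableT_comp => //; apply: measurableT_comp => //.
by apply: measurable_funM => //; exact: measurable_funX.
Qed.

Lemma Rintegral_normal_expRN_sqr (u : R) : 0 <= u ->
  \int[gamma]_z expR (- (u * z ^+ 2)) = (Num.sqrt (1 + 2 * u))^-1.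
Proof.
move=> u0; rewrite /Rintegral; under eq_integral do rewrite -mulNr.
by rewrite integral_normal_expR_sqr ?mulrN ?opprK//; lra.
Qed.

(** The cosine is bounded by 1. The case [y = 0] gives the lower chi-square tail; a general [y]
    excludes atoms. *)
Lemma gaussian_lincomb_expRN_sqr_le (b : I -> R) (t y : R) : 0 <= t ->
  \int[P]_w expR (- (t * (L b w - y) ^+ 2)) <= (Num.sqrt (1 + 2 * (t * N2 b)))^-1.
Proof.
move=> t0; have tN : 0 <= t * N2 b by rewrite mulr_ge0 ?sum_sqr_ge0.
have e1 z : expR (- (t * N2 b * z ^+ 2)) <= 1.
  by rewrite -expR0 ler_expR oppr_le0 mulr_ge0 ?sqr_ge0.
rewrite gaussian_lincomb_expRN_sqr// -Rintegral_normal_expRN_sqr//.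
have mc : measurable_fun setT (fun z => cos (Num.sqrt (2 * t) * z * y) : R).
  apply: (@measurable_cosT _ (measurableTypeR R)).
  by apply: measurable_funM => //; apply: measurable_funM.
apply: le_Rintegral => //.
- apply: (@bounded_integrable _ (measurableTypeR R) R gamma _ 1) => [|z].
    by apply: measurable_funM; [exact: mc|exact: measurable_gauss].
  rewrite normrM -[leRHS]mulr1 ler_pM ?(ger0_norm (expR_ge0 _))//.
  by rewrite ler_norml cos_geN1 cos_le1.
- apply: (@bounded_integrable _ (measurableTypeR R) R gamma _ 1) => [|z].
    exact: measurable_gauss.
  by rewrite ger0_norm ?expR_ge0.
- by move=> z _; rewrite ler_piMl ?expR_ge0// cos_le1.
Qed.

(** The indicator of L = y is at most exp(-t (L - y)^2) for every t >= 0, and the mean of the latter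
    tends to 0 as t grows. *)
Lemma gaussian_lincomb_atomless (b : I -> R) (y : R) : 0 < N2 b ->
  P [set w | L b w = y] = 0%E.
Proof.
move=> b0; have mA : measurable [set w | L b w = y].
  rewrite (_ : [set w | _] = L b @^-1` [set y])//.
  by rewrite -[X in measurable X]setTI; exact: mL.
have Pfin : P [set w | L b w = y] \is a fin_num by rewrite fin_num_measure.
rewrite -(fineK Pfin); congr EFin; set p := fine _.
have p0 : 0 <= p by rewrite fine_ge0.
have ple t : 0 <= t -> p <= (Num.sqrt (1 + 2 * (t * N2 b)))^-1.
  move=> t0; apply: le_trans (gaussian_lincomb_expRN_sqr_le b y t0).
  rewrite /p -(Rintegral_indic P)//; apply: le_Rintegral => //.
  - apply: (@bounded_integrable _ _ _ _ _ 1); first exact: measurable_indic.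
    exact: norm_indic.
  - apply: (@bounded_integrable _ _ _ _ _ 1) => [|w].
      apply: measurableT_comp => //; apply: measurableT_comp => //.
      apply: measurable_funM => //; apply: measurable_funX.
      exact: measurable_funB.
    rewrite ger0_norm ?expR_ge0// -expR0 ler_expR oppr_le0.
    by rewrite mulr_ge0 ?sqr_ge0.
  - move=> w _; rewrite indicE; case: (boolP (_ \in _)) => [|_]; last exact: expR_ge0.
    by rewrite inE /= => ->; rewrite subrr expr0n mulr0 oppr0 expR0.
apply/eqP; rewrite eq_le p0 andbT leNgt; apply/negP => p_gt0.
(* With this t the bound is (1 + 2 p^(-2))^(-1/2), which is smaller than p. *)
have := ple (p ^- 2 / N2 b).
have p2 : 0 < p ^- 2 by rewrite invr_gt0 exprn_gt0.
rewrite divfK ?gt_eqF// => /(_ (divr_ge0 (ltW p2) (ltW b0))).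
apply/negP; rewrite -ltNge invf_plt ?posrE ?sqrtr_gt0//; last by lra.
by rewrite -(ltr_pXn2r (n:=2)) ?nnegrE ?invr_ge0 ?sqrtr_ge0// sqr_sqrtr ?exprVn; lra.
Qed.

(** Minus the derivative at u = 0 of the mean of cos(L + u g_j), whose closed form is known because
    L + u g_j is again a linear combination. *)
Lemma gaussian_lincomb_sin (b : I -> R) (j : I) : j \in s ->
  P.-integrable [set: T] (EFin \o g j) /\
  \int[P]_w (sin (L b w) * g j w) = b j * expR (- (N2 b / 2)).
Proof.
move=> js.
have gi : P.-integrable setT (EFin \o (fun w => `|g j w|)).
  apply/integrableP; split.
    by apply/measurable_EFinP; exact: measurableT_comp.
  have mn : measurable_fun [set: R] (fun x : R => (`|x|)%:E).
    by apply/measurable_EFinP; exact: normr_measurable.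
  have n0 (x : R) : (0 <= (`|x|)%R%:E)%E by rewrite lee_fin.
  under eq_integral do rewrite /= normr_id.
  rewrite (@ge0_integral_normal_law _ _ _ P (g j) (mg j) (gE j) _ mn n0).
  have /integrableP[_] := integrable_normal_norm R.
  by under eq_integral do rewrite /= normr_id.
split; first exact: (integrable_dominated (mg j) (fun w => lexx _) gi).
pose f (u : R) w : R := cos (L b w + u * g j w).
pose bu u i := b i + u * (i == j)%:R.
have Lbu u w : L (bu u) w = L b w + u * g j w.
  rewrite /L /bu; under eq_bigr do rewrite mulrDl.
  rewrite big_split/=; congr (_ + _).
  rewrite (bigD1_seq j)//= eqxx mulr1 big1 ?addr0// => i /negbTE ->.
  by rewrite mulr0 mul0r.
have N2bu u : N2 (bu u) = N2 b + 2 * u * b j + u ^+ 2.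
  rewrite /N2 /bu; under eq_bigr do rewrite sqrrD.
  rewrite big_split/= big_split/=; congr (_ + _ + _).
    rewrite (bigD1_seq j)//= eqxx mulr1 big1 ?addr0; first by ring.
    by move=> i /negbTE ->; rewrite !mulr0 mul0rn.
  rewrite (bigD1_seq j)//= eqxx mulr1 big1 ?addr0// => i /negbTE ->.
  by rewrite mulr0 expr0n.
have CE u : \int[P]_w f u w = expR (- 2^-1 * (u ^+ 2 + 2 * b j * u) - N2 b / 2).
  transitivity (\int[P]_w cos (L (bu u) w + 0)).
    by apply: eq_Rintegral => w _; rewrite addr0 Lbu.
  rewrite gaussian_lincomb_char// cos0 mul1r -/(N2 _) N2bu.
  by congr expR; field.
have d1f (u : R) w : is_derive u 1 (f ^~ w) (- (g j w * sin (L b w + u * g j w))).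
  rewrite (_ : f ^~ w = (fun u => cos (g j w * u + L b w))); last first.
    by apply/funext => v; rewrite /f mulrC addrC.
  rewrite (addrC (L b w)) (mulrC u); exact: is_derive_cos_affine.
have mfu u : measurable_fun setT (f u).
  by apply: measurable_cosT; apply: measurable_funD => //; apply: measurable_funM.
have fi u : P.-integrable setT (EFin \o f u).
  apply: (@bounded_integrable _ _ _ _ _ 1) => // w.
  by rewrite ler_norml cos_geN1 cos_le1.
have I0 : [set` `](-1 : R), 1[] 0 by rewrite /= in_itv/=; apply/andP; split; lra.
have dfE (x : R) w : partial1of2 f x w = - (g j w * sin (L b w + x * g j w)).
  by rewrite partial1of2E; exact: derive_val.
have fder (x : R) w : [set` `](-1 : R), 1[] x -> setT w -> derivable (f ^~ w) x 1.
  by move=> _ _; exact: ex_derive.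
have fub (x : R) w : [set` `](-1 : R), 1[] x -> setT w ->
    `|partial1of2 f x w| <= `|g j w|.
  move=> _ _; rewrite dfE normrN normrM ler_piMr//.
  by rewrite ler_norml sin_geN1 sin_le1.
have := @differentiation_under_integral R _ T P f setT
      measurableT 0 (-1) 1 I0 (fun x _ => fi x) fder (fun w => `|g j w|)
      (fun w => normr_ge0 _) gi fub.
rewrite (_ : (fun x => _) = (fun u => expR (- 2^-1 * (u ^+ 2 + 2 * b j * u) - N2 b / 2))); last first.
  by apply/funext => u; rewrite CE.
have dq : is_derive (0 : R) 1
    (fun u : R => - 2^-1 * (u ^+ 2 + 2 * b j * u) - N2 b / 2) (- b j).
  rewrite (_ : (fun u => _) = (- 2^-1) \*: (id ^+ 2 + (2 * b j) \*: id) + cst (- (N2 b / 2))); last first.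
    by apply/funext.
  apply: is_derive_eq.
  by rewrite /= /GRing.scale/=; field.
rewrite derive1E (@derive_val _ _ _ _ _ _ _ (@is_derive1_comp _ expR _ (0 : R) _ _ _ dq)).
rewrite expr0n/= !mulr0 addr0 mulr0 add0r mulrN.
move=> h; rewrite [RHS]mulrC -[RHS]opprK h -mulN1r -RintegralZl//; last first.
  have := integrable_dominated (g := fun w => `|g j w|)
    (f := fun w => partial1of2 f 0 w) _ _ gi.
  apply => [|w]; last exact: fub.
  under eq_fun do rewrite dfE mul0r addr0.
  apply: measurableT_comp => //; apply: measurable_funM => //.
  by apply: measurable_sinT; exact: mL.
by apply: eq_Rintegral => w _; rewrite dfE mul0r addr0 mulN1r opprK mulrC.
Qed.

End gaussian_lincomb.

(** * Fejer means of the quantization residual *)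

Section fejer.
Variable R : realType.
Implicit Types (u t : R) (N : nat).

(* Fejer mean of the Fourier series of the 2pi-periodic function equal to the
   identity on ]-pi, pi[; its derivative is [1 - fejer_kernel N u / N.+1], where
   the alternating signs recentre the Fejer kernel at pi. *)
Definition sawtooth_fejer N u : R :=
  \sum_(i < N) (1 - i.+1%:R / N.+1%:R) * (-1) ^+ i * 2 / i.+1%:R * sin (i.+1%:R * u).

Definition fejer_kernel N u : R :=
  N.+1%:R + 2 * \sum_(i < N) (N - i)%:R * (-1) ^+ i.+1 * cos (i.+1%:R * u).

Let dirichlet N u : R := 1 + 2 * \sum_(i < N) (-1) ^+ i.+1 * cos (i.+1%:R * u).

(** Multiplication by 1 + cos u clears the denominator of the Dirichlet kernel recentred at pi, so
    that no half angles appear. *)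
Let dirichletE N u :
  (1 + cos u) * dirichlet N u = (-1) ^+ N * (cos (N%:R * u) + cos (N.+1%:R * u)).
Proof.
elim: N => [|N IH].
  by rewrite /dirichlet big_ord0 mulr0 addr0 mulr1 expr0 mul1r mul0r cos0 mul1r.
have -> : dirichlet N.+1 u = dirichlet N u + 2 * ((-1) ^+ N.+1 * cos (N.+1%:R * u)).
  by rewrite /dirichlet big_ord_recr/= mulrDr addrA.
rewrite mulrDr IH exprS.
have -> : cos (N.+2%:R * u) = cos (N.+1%:R * u) * cos u - sin (N.+1%:R * u) * sin u.
  by rewrite -cosD -[in LHS]natr1 mulrDl mul1r.
have -> : cos (N%:R * u) = cos (N.+1%:R * u) * cos u + sin (N.+1%:R * u) * sin u.
  by rewrite -cosB -[in RHS]natr1 mulrDl mul1r addrK.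
by ring.
Qed.

(** The kernel is the sum of the Dirichlet kernels of degree at most N, and their closed forms
    telescope. Positivity and the decay in N of the normalized kernel away from pi can both be read
    off. *)
Lemma fejer_kernelE N u :
  (1 + cos u) * fejer_kernel N u = 1 + (-1) ^+ N * cos (N.+1%:R * u).
Proof.
elim: N => [|N IH].
  by rewrite /fejer_kernel big_ord0 mulr0 addr0 mulr1 expr0 mul1r mul1r.
have -> : fejer_kernel N.+1 u = fejer_kernel N u + dirichlet N.+1 u.
  rewrite /fejer_kernel /dirichlet -[N.+2%:R]natr1 addrACA; congr (_ + _).
  rewrite -mulrDr; congr (2 * _).
  rewrite big_ord_recr/= [in RHS]big_ord_recr/= subSnn mul1r addrA; congr (_ + _).
  rewrite -big_split/=; apply: eq_bigr => i _.
  by rewrite subSn ?(ltnW (ltn_ord i))// -natr1 !mulrDl mul1r.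
by rewrite mulrDr IH dirichletE exprS; ring.
Qed.

Lemma fejer_kernel_ge0 N u : 0 < 1 + cos u -> 0 <= fejer_kernel N u.
Proof.
move=> c0; rewrite -(pmulr_rge0 _ c0) fejer_kernelE.
have : `|(-1) ^+ N * cos (N.+1%:R * u)| <= 1.
  by rewrite normrM normrX normrN1 expr1n mul1r ler_norml cos_geN1 cos_le1.
by rewrite ler_norml => /andP[]; lra.
Qed.

Lemma fejer_kernel_le N u : 0 < 1 + cos u -> fejer_kernel N u <= 2 / (1 + cos u).
Proof.
move=> c0; rewrite ler_pdivlMr// mulrC fejer_kernelE.
have : `|(-1) ^+ N * cos (N.+1%:R * u)| <= 1.
  by rewrite normrM normrX normrN1 expr1n mul1r ler_norml cos_geN1 cos_le1.
by rewrite ler_norml => /andP[]; lra.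
Qed.

Lemma is_derive_sawtooth_fejer N u :
  is_derive u 1 (fun t => t - sawtooth_fejer N t) (fejer_kernel N u / N.+1%:R).
Proof.
pose a (i : nat) : R := (1 - i.+1%:R / N.+1%:R) * (-1) ^+ i * 2 / i.+1%:R.
have di (i : 'I_N) : is_derive u 1 (a i \*: (fun t => sin (i.+1%:R * t + 0)))
    (a i *: (i.+1%:R * cos (i.+1%:R * u + 0))).
  by apply: is_deriveZ; exact: is_derive_sin_affine.
have ds := @is_derive_sum _ _ _ N (fun i => a i \*: (fun t => sin (i.+1%:R * t + 0)))
  u 1 _ di.
rewrite (_ : (fun t => _) =
    id - \sum_(i < N) a i \*: (fun t => sin (i.+1%:R * t + 0))); last first.
  apply/funext => t; rewrite /sawtooth_fejer !fctE; congr (_ - _).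
  rewrite fct_sumE; apply: eq_bigr => i _.
  by rewrite /= addr0 /GRing.scale/=.
apply: is_derive_eq; rewrite /fejer_kernel mulrDl divff ?pnatr_eq0//; congr (_ + _).
rewrite -mulrA mulr_suml big_distrr/= -sumrN; apply: eq_bigr => i _.
rewrite addr0 /GRing.scale/= /a natrB ?(ltnW (ltn_ord i))// exprS.
have i0 : i.+1%:R != 0 :> R by rewrite pnatr_eq0.
have N0 : N.+1%:R != 0 :> R by rewrite pnatr_eq0.
have -> : N%:R - i%:R = N.+1%:R - i.+1%:R :> R by rewrite -!natr1; ring.
move: i0 N0; move: (i.+1%:R : R) (N.+1%:R : R) => p q p0 q0.
by field; rewrite ?p0 ?q0.
Qed.

Lemma cos_gtN1 t : 0 <= t < pi -> 0 < 1 + cos t.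
Proof.
move=> /andP[t0 tpi]; rewrite addrC -ltrBlDr sub0r -cospi.
by rewrite ltr_cos// in_itv/= ?t0 ?pi_ge0 ?lexx ?ltW.
Qed.

Let sawtooth_fejer_MVT N a b : a < b ->
  exists2 c, a < c < b & (b - sawtooth_fejer N b) - (a - sawtooth_fejer N a) =
    fejer_kernel N c / N.+1%:R * (b - a).
Proof.
move=> ab; have [|c cab ->] := @MVT R _ _ a b ab (fun x _ => is_derive_sawtooth_fejer N x).
  apply: continuous_subspaceT => x.
  apply/differentiable_continuous/derivable1_diffP.
  exact: (@ex_derive _ _ _ _ _ _ _ (is_derive_sawtooth_fejer N x)).
by exists c => //; move: cab; rewrite in_itv.
Qed.

Lemma sawtooth_fejer0 N : sawtooth_fejer N 0 = 0.
Proof. by rewrite /sawtooth_fejer big1// => i _; rewrite mulr0 sin0 mulr0. Qed.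

Lemma sin_natr_pi n : sin (n%:R * pi) = 0 :> R.
Proof.
elim: n => [|n IH]; first by rewrite mul0r sin0.
by rewrite -natr1 mulrDl mul1r sinDpi IH oppr0.
Qed.

Lemma sawtooth_fejer_pi N : sawtooth_fejer N pi = 0.
Proof. by rewrite /sawtooth_fejer big1// => i _; rewrite sin_natr_pi mulr0. Qed.

Lemma sawtooth_fejerN N u : sawtooth_fejer N (- u) = - sawtooth_fejer N u.
Proof.
by rewrite /sawtooth_fejer -sumrN; apply: eq_bigr => i _; rewrite mulrN sinN mulrN.
Qed.

(** u minus the Fejer mean is nondecreasing on [0, pi], since its derivative is a positive kernel,
    and it takes the values 0 and pi at the ends. *)
Lemma sawtooth_fejer_ge0_bound N u : 0 <= u <= pi ->
  0 <= u - sawtooth_fejer N u <= pi.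
Proof.
move=> /andP[u0 upi]; apply/andP; split.
  move: u0; rewrite le_eqVlt => /predU1P[<-|u0]; first by rewrite sawtooth_fejer0 subr0.
  have [c /andP[c0 cu]] := sawtooth_fejer_MVT N u0.
  rewrite sawtooth_fejer0 !subr0 => ->.
  rewrite mulr_ge0// ?divr_ge0 ?(ltW u0)// fejer_kernel_ge0// cos_gtN1//.
  by rewrite ltW//= (lt_le_trans cu).
move: upi; rewrite le_eqVlt => /predU1P[->|upi]; first by rewrite sawtooth_fejer_pi subr0.
have [c /andP[uc cpi]] := sawtooth_fejer_MVT N upi.
rewrite sawtooth_fejer_pi subr0 => h; rewrite -subr_ge0 h.
rewrite mulr_ge0// ?subr_ge0 ?(ltW upi)// divr_ge0// fejer_kernel_ge0// cos_gtN1//.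
by rewrite cpi andbT (le_trans u0)// ltW.
Qed.

Lemma sawtooth_fejer_bound N u : `|u| <= pi -> `|u - sawtooth_fejer N u| <= pi.
Proof.
move=> upi; have [u0|u0] := leP 0 u.
  have /andP[h1 h2] : 0 <= u - sawtooth_fejer N u <= pi.
    by apply: sawtooth_fejer_ge0_bound; rewrite u0 -(ger0_norm u0).
  by rewrite ger0_norm.
have /andP[h1 h2] : 0 <= - u - sawtooth_fejer N (- u) <= pi.
  by apply: sawtooth_fejer_ge0_bound; rewrite -(ltr0_norm u0) normr_ge0.
by move: h1 h2; rewrite sawtooth_fejerN -opprD => h1 h2; rewrite -normrN ger0_norm.
Qed.

(** On [0, u] the derivative of the error is at most 2 / ((1 + cos u) (N + 1)), which tends to 0. At
    pi itself the means are all 0, so the jump has to be excluded. *)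
Lemma sawtooth_fejer_cvg u : `|u| < pi -> sawtooth_fejer N u @[N --> \oo] --> u.
Proof.
wlog u0 : u / 0 < u => [hw|].
  move=> upi; have [u0|u0|<-] := ltrgtP 0 u; first exact: hw.
    have /hw : 0 < - u by rewrite oppr_gt0.
    rewrite normrN => /(_ upi) h.
    rewrite (_ : (fun N => _) = (fun N => - sawtooth_fejer N (- u))).
      by rewrite -[X in _ --> X]opprK; exact: cvgN h.
    by apply/funext => N; rewrite sawtooth_fejerN opprK.
  by under eq_fun do rewrite sawtooth_fejer0; exact: cvg_cst.
rewrite gtr0_norm// => upi.
have cu0 : 0 < 1 + cos u by rewrite cos_gtN1// upi ltW.
pose K := 2 / (1 + cos u) * u.
have K0 : 0 <= K by rewrite mulr_ge0 ?(ltW u0)// divr_ge0// ltW.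
apply: (@squeeze_cvgr _ _ _ _ (fun N => u - N.+1%:R^-1 * K) (cst u)).
- near=> N.
  have [c /andP[c0 cu]] := sawtooth_fejer_MVT N u0.
  rewrite sawtooth_fejer0 !subr0 => h.
  have cc : 0 < 1 + cos c by rewrite cos_gtN1// (ltW c0) (lt_trans cu).
  have ccu : 1 + cos u <= 1 + cos c.
    rewrite lerD2l ltW// ltr_cos ?in_itv/= ?(ltW c0) ?(ltW u0) ?(ltW upi)//.
    by rewrite ltW// (lt_trans cu).
  have h1 : 0 <= fejer_kernel N c by exact: fejer_kernel_ge0.
  have h2 : fejer_kernel N c <= 2 / (1 + cos u).
    apply: le_trans (fejer_kernel_le N cc) _.
    by rewrite ler_wpM2l// lef_pV2.
  have N0 : 0 <= N.+1%:R^-1 :> R by rewrite invr_ge0.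
  have b1 : 0 <= u - sawtooth_fejer N u by rewrite h !mulr_ge0// ltW.
  have b2 : u - sawtooth_fejer N u <= N.+1%:R^-1 * K.
    by rewrite h /K mulrA [X in X * u]mulrC ler_wpM2r ?(ltW u0)// ler_wpM2l.
  by apply/andP; split; [rewrite lerBlDr addrC -lerBlDr|rewrite -subr_ge0].
- rewrite -[X in _ --> X]subr0; apply: cvgB; first exact: cvg_cst.
  by rewrite -(mul0r K); apply: cvgMl; exact: cvg_harmonic.
- exact: cvg_cst.
Unshelve. all: by end_near. Qed.

End fejer.

Section quantization_residual.
Variables (R : realType) (delta : R).
Hypothesis delta0 : 0 < delta.
Implicit Types (t u : R) (N : nat) (z : int).

Definition residual t : R := t - quantizer delta t.

Lemma residual_itv t : - (delta / 2) < residual t <= delta / 2.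
Proof.
have [_ /(_ erefl)] := quantizerP t (Num.ceil (t / delta - 2^-1)) delta0.
rewrite /residual -/(quantizer delta t) => /andP[h1 h2].
by apply/andP; split; lra.
Qed.

Lemma residual_bound t : `|residual t| <= delta / 2.
Proof. by have /andP[/ltW h1 h2] := residual_itv t; rewrite ler_norml h1. Qed.

Lemma measurable_quantizer : measurable_fun [set: R] (quantizer delta).
Proof.
apply: nondecreasing_measurable => // x y xy.
by rewrite /quantizer ler_pM2r// ler_int ceil_le// lerB// ler_pM2r ?invr_gt0.
Qed.

Lemma measurable_residual : measurable_fun [set: R] residual.
Proof. by apply: measurable_funB => //; exact: measurable_quantizer. Qed.

Lemma sin_int_period u z : sin (u + z%:~R * (pi *+ 2)) = sin u :> R.
Proof.
have hn v n : sin (v + n%:R * (pi *+ 2)) = sin v :> R.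
  by rewrite mulr_natl (periodicn (@sinD2pi R)).
case: (intP z) => [|n|n]; first by rewrite mul0r addr0.
  exact: hn.
rewrite -[LHS](hn _ n.+1); congr sin.
by rewrite mulrNz mulNr -addrA addNr addr0.
Qed.

Lemma sawtooth_fejer_period N u z :
  sawtooth_fejer N (u + z%:~R * (pi *+ 2)) = sawtooth_fejer N u.
Proof.
rewrite /sawtooth_fejer; apply: eq_bigr => i _; congr (_ * _).
rewrite mulrDr mulrA.
have -> : i.+1%:R * z%:~R = (i.+1%:Z * z)%:~R :> R by rewrite intrM.
exact: sin_int_period.
Qed.

(** Rescaled to period [delta] and slope 1. It is a trigonometric polynomial in [t] itself, so
    characteristic functions apply; periodicity lets [residual t] replace [t] when the approximation
    is estimated. *)
Definition residual_fejer N t : R :=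
  delta / (pi *+ 2) * sawtooth_fejer N (pi *+ 2 / delta * t).

Let pi2 : 0 < pi *+ 2 :> R.
Proof. by rewrite mulrn_wgt0// pi_gt0. Qed.

Lemma residual_fejerE N t :
  residual_fejer N t =
  delta / (pi *+ 2) * sawtooth_fejer N (pi *+ 2 / delta * residual t).
Proof.
rewrite /residual_fejer; congr (_ * _).
rewrite -[in RHS](@sawtooth_fejer_period _ _ (Num.ceil (t / delta - 2^-1))).
congr (sawtooth_fejer _ _); rewrite /residual /quantizer.
by move: (pi *+ 2) => p; field; rewrite gt_eqF.
Qed.

(** Both the residual and its distance to the Fejer mean are at most delta / 2. The bound is free of
    N, as domination requires. *)
Lemma residual_fejer_bound N t : `|residual_fejer N t| <= delta.
Proof.
have c0 : 0 < delta / (pi *+ 2) by rewrite divr_gt0.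
have h : `|residual t - residual_fejer N t| <= delta / 2.
  have -> : residual t - residual_fejer N t = delta / (pi *+ 2) *
      (pi *+ 2 / delta * residual t -
       sawtooth_fejer N (pi *+ 2 / delta * residual t)).
    rewrite residual_fejerE [RHS]mulrBr; congr (_ - _).
    by move: pi2; move: (pi *+ 2) => p p0; field; rewrite !gt_eqF.
  rewrite normrM (gtr0_norm c0).
  have -> : delta / 2 = delta / (pi *+ 2) * pi.
    by move: (@pi_gt0 R); move: (pi : R) => p p0; rewrite -mulr_natr; field; rewrite gt_eqF.
  rewrite ler_pM2l//; apply: sawtooth_fejer_bound.
  rewrite normrM gtr0_norm ?divr_gt0// mulrAC ler_pdivrMr//.
  rewrite -[pi *+ 2]mulr_natr -mulrA ler_pM2l ?pi_gt0//.
  by have := residual_bound t; lra.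
have := residual_bound t; have := ler_normB (residual t) (residual t - residual_fejer N t).
by rewrite opprB addrC subrK; lra.
Qed.

Lemma residual_fejer_cvg t : residual t != delta / 2 ->
  residual_fejer N t @[N --> \oo] --> residual t.
Proof.
move=> tN; have /andP[h1 h2] := residual_itv t.
have {}h2 : residual t < delta / 2 by rewrite lt_neqAle tN.
have E : delta / (pi *+ 2) * (pi *+ 2 / delta * residual t) = residual t.
  by move: pi2; move: (pi *+ 2) => p p0; field; rewrite !gt_eqF.
suff : delta / (pi *+ 2) * sawtooth_fejer N (pi *+ 2 / delta * residual t)
    @[N --> \oo] --> delta / (pi *+ 2) * (pi *+ 2 / delta * residual t).
  by rewrite E; under eq_fun do rewrite -residual_fejerE.
apply: cvgMr; apply: sawtooth_fejer_cvg.
rewrite normrM gtr0_norm ?divr_gt0// mulrAC ltr_pdivrMr//.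
have : `|residual t| < delta / 2 by rewrite ltr_norml h1.
by rewrite -[pi *+ 2]mulr_natr -mulrA ltr_pM2l ?pi_gt0//; lra.
Qed.

Lemma residual0 : residual 0 = 0.
Proof.
have h : quantizer delta 0 = 0%:~R * delta.
  apply/quantizerP => //; rewrite mulr0z mul0r.
  by rewrite sub0r add0r oppr_lt0 divr_gt0//= divr_ge0// ltW.
by rewrite /residual h mulr0z mul0r subr0.
Qed.

Lemma residual_half t : residual t = delta / 2 ->
  exists z : int, t = (z%:~R + 2^-1) * delta.
Proof.
move=> h; exists (Num.ceil (t / delta - 2^-1)).
by move: h; rewrite /residual /quantizer; lra.
Qed.

End quantization_residual.

Section alternating.
Variable R : realType.

Lemma alternating_sum_itv (N : nat) (w : nat -> R) :
  (forall i, 0 <= w i) -> (forall i, w i.+1 <= w i) ->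
  0 <= \sum_(i < N) (-1) ^+ i * w i <= w 0%N.
Proof.
elim: N w => [|N IH] w w0 wd; first by rewrite big_ord0 lexx w0.
rewrite big_ord_recl/= expr0 mul1r.
have -> : \sum_(i < N) (-1) ^+ bump 0 i * w (bump 0 i) =
    - \sum_(i < N) (-1) ^+ i * w i.+1.
  by rewrite -sumrN; apply: eq_bigr => i _; rewrite /bump/= add1n exprS mulN1r mulNr.
have /andP[h1 h2] := IH (w \o succn) (fun i => w0 _) (fun i => wd _).
by have := wd 0%N; move: h1 h2 => /=; lra.
Qed.

Lemma alternating_sum_lower (N : nat) (w : nat -> R) :
  (forall i, 0 <= w i) -> (forall i, w i.+1 <= w i) ->
  w 0%N - w 1%N <= \sum_(i < N.+1) (-1) ^+ i * w i.
Proof.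
move=> w0 wd; rewrite big_ord_recl/= expr0 mul1r.
have -> : \sum_(i < N) (-1) ^+ bump 0 i * w (bump 0 i) =
    - \sum_(i < N) (-1) ^+ i * w i.+1.
  by rewrite -sumrN; apply: eq_bigr => i _; rewrite /bump/= add1n exprS mulN1r mulNr.
have /andP[h1 h2] := @alternating_sum_itv N (w \o succn) (fun i => w0 _) (fun i => wd _).
by move: h1 h2 => /=; lra.
Qed.

(* The mean of the [N]-th Fejer approximation of [residual delta L * g j], for a
   Gaussian combination [L], is [theta_fejer a N] times the coefficient of [g j]. *)
Definition theta_fejer (a : R) (N : nat) : R :=
  2 * \sum_(i < N) (-1) ^+ i * ((1 - i.+1%:R / N.+1%:R) * expR (- (a * i.+1%:R ^+ 2))).

(** The Fejer weights and the exponentials both decrease in the index, so Leibniz's estimate for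
    alternating sums applies; the error 2 / (N + 2) is the deficit of the first Fejer weight. *)
Lemma theta_fejer_itv (a : R) (N : nat) : 0 <= a ->
  2 * (expR (- a) - expR (- (4 * a))) - 2 * N.+2%:R^-1 <= theta_fejer a N.+1
  <= 2 * expR (- a).
Proof.
(* Extension by 0 beyond the degree gives a nonincreasing sequence on all of [nat]. *)
move=> a0; pose w (i : nat) : R := if (i < N.+1)%N then
  (1 - i.+1%:R / N.+2%:R) * expR (- (a * i.+1%:R ^+ 2)) else 0.
have c0 i : (i < N.+1)%N -> 0 <= 1 - i.+1%:R / N.+2%:R :> R.
  by move=> iN; rewrite subr_ge0 ler_pdivrMr// mul1r ler_nat ltnW.
have w0 i : 0 <= w i.
  by rewrite /w; case: ifPn => // iN; rewrite mulr_ge0 ?expR_ge0// c0.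
have wd i : w i.+1 <= w i.
  rewrite {1}/w; case: ifPn => // iN; rewrite /w (ltnW iN).
  rewrite ler_pM ?expR_ge0 ?c0//.
    by rewrite lerD2l lerN2 ler_pM2r ?invr_gt0// ler_nat.
  rewrite ler_expR lerN2 ler_wpM2l// ler_pXn2r ?nnegrE//.
  by rewrite ler_nat.
have tE : theta_fejer a N.+1 = 2 * \sum_(i < N.+1) (-1) ^+ i * w i.
  by rewrite /theta_fejer; congr (_ * _); apply: eq_bigr => i _; rewrite /w ltn_ord.
have e1 : expR (- a) <= 1 by rewrite -expR0 ler_expR; lra.
have i0 : 0 <= N.+2%:R^-1 :> R by rewrite invr_ge0.
have w00 : w 0%N = (1 - N.+2%:R^-1) * expR (- a).
  by rewrite /w/= mul1r expr1n mulr1.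
have w01 : w 1%N <= expR (- (4 * a)).
  rewrite /w; case: ifPn => [_|_]; last exact: expR_ge0.
  have -> : a * 2 ^+ 2 = 4 * a by ring.
  rewrite ler_piMl ?expR_ge0// lerBlDr lerDl divr_ge0//.
have := alternating_sum_lower N w0 wd; have /andP[_] := alternating_sum_itv N.+1 w0 wd.
rewrite tE w00; move: (\sum_(i < _) _) => S h1 h2.
have h3 : N.+2%:R^-1 * expR (- a) <= N.+2%:R^-1 by rewrite ler_piMr.
have h4 : 0 <= N.+2%:R^-1 * expR (- a) by rewrite mulr_ge0 ?expR_ge0.
move: h1 h2 h3 h4 w01; move: (N.+2%:R^-1 : R) (expR (- a)) (expR (- (4 * a))) (w 1%N).
by move=> i e f v *; apply/andP; split; nra.
Qed.

End alternating.

Lemma Rintegral_sum d (T : measurableType d) (R : realType)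
    (mu : {measure set T -> \bar R}) (I : Type) (r : seq I) (f : I -> T -> R) :
  (forall i, mu.-integrable [set: T] (EFin \o f i)) ->
  mu.-integrable [set: T] (EFin \o (fun x => \sum_(i <- r) f i x)) /\
  \int[mu]_x (\sum_(i <- r) f i x) = \sum_(i <- r) \int[mu]_x f i x.
Proof.
move=> fi; elim: r => [|i r [IH1 IH2]].
  rewrite big_nil (_ : (fun x => _) = cst 0); last first.
    by apply/funext => x; rewrite big_nil.
  by split; [exact: integrable0|rewrite /Rintegral integral0].
rewrite (_ : (fun x => _) = (fun x => f i x + \sum_(i <- r) f i x)); last first.
  by apply/funext => x; rewrite big_cons.
rewrite big_cons -IH2 RintegralD//; split => //.
exact: integrableD_real.
Qed.

(** * Correlation of the residual with a Gaussian entry *)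

Section residual_mean.
Context d (T : measurableType d) (R : realType) (P : probability T R).
Variables (I : finType) (g : I -> T -> R).
Hypothesis mg : forall i, measurable_fun [set: T] (g i).
Hypothesis gE : forall i B, measurable B -> P (g i @^-1` B) = normal_prob 0 1 B.
Hypothesis ig : mutually_independent P g.
Variables (s : seq I) (us : uniq s) (b : I -> R).
Variables (delta : R) (delta0 : 0 < delta).

Let L w := \sum_(i <- s) b i * g i w.
Let N2 := \sum_(i <- s) b i ^+ 2.
Let a := 2 * pi ^+ 2 * N2 / delta ^+ 2.

Let mL : measurable_fun [set: T] L.
Proof. exact: measurable_lincomb. Qed.

Let mLk (c : R) : measurable_fun [set: T] (fun w => c * L w).
Proof. exact: measurable_funM. Qed.

Let mfejer N : measurable_fun [set: T] (fun w => residual_fejer delta N (L w)).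
Proof.
apply: measurable_funM => //; apply: measurable_sum => i.
apply: measurable_funM => //; apply: measurable_sinT.
by apply: measurable_funM => //; exact: mLk.
Qed.

Let gi j : j \in s -> P.-integrable [set: T] (EFin \o g j).
Proof. by move=> js; have [] := gaussian_lincomb_sin mg gE ig us (fun=> 0) js. Qed.

Let gni j : j \in s -> P.-integrable [set: T] (EFin \o (fun w => delta * `|g j w|)).
Proof. by move=> js; apply: integrableZl_real; exact: integrable_abse (gi js). Qed.

(** The i-th term has frequency k_i = 2 pi (i + 1) / delta. The amplitude delta / (2 pi) times 2 /
    (i + 1) times k_i equals 2, and k_i^2 N2 / 2 = a (i + 1)^2. *)
Lemma Rintegral_residual_fejer N j : j \in s ->
  \int[P]_w (residual_fejer delta N (L w) * g j w) = theta_fejer a N * b j.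
Proof.
move=> js; pose k (i : nat) : R := i.+1%:R * (pi *+ 2 / delta).
pose c (i : nat) : R := delta / (pi *+ 2) *
  ((1 - i.+1%:R / N.+1%:R) * (-1) ^+ i * 2 / i.+1%:R).
have Lk i w : \sum_(l <- s) (k i * b l) * g l w = k i * L w.
  by rewrite /L big_distrr/=; apply: eq_bigr => l _; rewrite mulrA.
have si i : P.-integrable [set: T] (EFin \o (fun w => sin (k i * L w) * g j w)).
  apply: (integrable_dominated (g := fun w => delta^-1 * (delta * `|g j w|))).
  - by apply: measurable_funM => //; apply: measurable_sinT; exact: mLk.
  - move=> w; rewrite mulKf ?gt_eqF// normrM ler_piMl//.
    by rewrite ler_norml sin_geN1 sin_le1.
  - exact/integrableZl_real/gni.
transitivity (\int[P]_w \sum_(i < N) c i * (sin (k i * L w) * g j w)).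
  apply: eq_Rintegral => w _.
  rewrite /residual_fejer /sawtooth_fejer big_distrr/= big_distrl/=.
  by apply: eq_bigr => i _; rewrite /c /k !mulrA.
have csi (i : 'I_N) : P.-integrable [set: T]
    (EFin \o (fun w => c i * (sin (k i * L w) * g j w))).
  exact/integrableZl_real/si.
rewrite (Rintegral_sum _ csi).2 /theta_fejer -mulrA mulr_suml big_distrr/=.
apply: eq_bigr => i _; rewrite RintegralZl//.
have -> : \int[P]_w (sin (k i * L w) * g j w) =
    k i * b j * expR (- (a * i.+1%:R ^+ 2)).
  under eq_Rintegral do rewrite -Lk.
  have [_ ->] := gaussian_lincomb_sin mg gE ig us (fun l => k i * b l) js.
  congr (_ * expR (- _)).
  under eq_bigr do rewrite exprMn.
  rewrite -big_distrr/= -/N2 /a /k -[pi *+ 2]mulr_natr.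
  by field; rewrite gt_eqF.
rewrite /c /k -[pi *+ 2]mulr_natr.
move: (expR _) => e.
have i0 : i.+1%:R != 0 :> R by rewrite pnatr_eq0.
have N0 : N.+1%:R != 0 :> R by rewrite pnatr_eq0.
have p0 : (pi : R) != 0 by rewrite gt_eqF ?pi_gt0.
have d0 : delta != 0 by rewrite gt_eqF.
move: i0 N0 p0 d0; move: (i.+1%:R : R) (N.+1%:R : R) (pi : R) delta => p q r dl.
by move=> p0 q0 r0 dl0; field; rewrite ?p0 ?q0 ?r0 ?dl0.
Qed.

Lemma residual_lincomb_ae : 0 < N2 ->
  {ae P, forall w, residual delta (L w) != delta / 2}.
Proof.
move=> N20.
(* An enumeration of the jump points (z + 1/2) delta; numbers that code no integer repeat the point
   for z = 0. *)
pose y (n : nat) : R := ((odflt 0 (unpickle n : option int))%:~R + 2^-1) * delta.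
have : P.-negligible (\bigcup_n [set w | L w = y n]).
  apply: negligible_bigcup => n.
  exists [set w | L w = y n]; split => //.
    rewrite (_ : [set w | _] = L @^-1` [set y n])//.
    by rewrite -[X in measurable X]setTI; exact: mL.
  exact: gaussian_lincomb_atomless.
apply: negligibleS => w /= /negP; rewrite negbK => /eqP h.
have [z zE] := residual_half h.
by exists (pickle z) => //=; rewrite /y pickleK.
Qed.

(** Dominated convergence makes [theta_fejer a N * b j] converge for each j. A coefficient [b j]
    other than 0 thus yields the limit of [theta_fejer a N], which does not depend on j and inherits
    the bounds. *)
Lemma Rintegral_residual : exists theta : R,
  2 * (expR (- a) - expR (- (4 * a))) <= theta <= 2 * expR (- a) /\
  {in s, forall j, \int[P]_w (residual delta (L w) * g j w) = theta * b j}.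
Proof.
have a0 : 0 <= a.
  by rewrite /a divr_ge0 ?sqr_ge0// mulr_ge0 ?sum_sqr_ge0// mulr_ge0 ?sqr_ge0.
have [N20|N20] := leP N2 0.
  have bj0 j : j \in s -> b j = 0.
    move=> js; have : N2 == 0 by rewrite eq_le N20 sum_sqr_ge0.
    rewrite psumr_eq0 => [/allP /(_ j js)|i _]; last exact: sqr_ge0.
    by rewrite sqrf_eq0 => /eqP.
  have L0 w : L w = 0 by rewrite /L big_seq big1// => j /bj0 ->; rewrite mul0r.
  have aE : a = 0.
    by rewrite /a (_ : N2 = 0) ?mulr0 ?mul0r//; apply/eqP; rewrite eq_le N20 sum_sqr_ge0.
  (* In the degenerate case a = 0 and the admissible interval is [0, 2]. *)
  exists 0; rewrite aE mulr0 subrr mulr0 lexx mulr_ge0 ?expR_ge0//; split=> // j js.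
  rewrite mul0r; under eq_Rintegral do rewrite L0 residual0// mul0r.
  exact: Rintegral_cst_prob.
have cv j : j \in s -> theta_fejer a N * b j @[N --> \oo] -->
    \int[P]_w (residual delta (L w) * g j w).
  move=> js; under eq_fun do rewrite -Rintegral_residual_fejer//.
  apply: (Rintegral_dominated_cvg _ _ _ (gni js) _).2 => /=.
  - by move=> N; exact: measurable_funM.
  - apply: measurable_funM => //.
    by apply: measurableT_comp => //; exact: measurable_residual.
  - apply: filterS (residual_lincomb_ae N20) => w h.
    by apply: cvgMl; exact: residual_fejer_cvg.
  - by move=> N w; rewrite normrM ler_wpM2r// residual_fejer_bound.
have [j js bj0] : exists2 j, j \in s & b j != 0.
  apply: contrapT => h; move: N20; rewrite /N2 big_seq big1 ?ltxx// => j js.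
  apply/eqP; rewrite sqrf_eq0; apply: contrapT => /negP bj; apply: h.
  by exists j.
set e := \int[P]_w (residual delta (L w) * g j w).
have cth : theta_fejer a N @[N --> \oo] --> e / b j.
  have -> : (fun N => theta_fejer a N) = (fun N => theta_fejer a N * b j / b j).
    by apply/funext => N; rewrite mulfK.
  by apply: cvgMl; exact: cv.
have cth1 : theta_fejer a N.+1 @[N --> \oo] --> e / b j.
  by have := cth; rewrite -cvg_shiftS.
exists (e / b j); split.
  apply/andP; split.
    have ch : 2 * (expR (- a) - expR (- (4 * a))) - 2 * N.+2%:R^-1 @[N --> \oo] -->
        2 * (expR (- a) - expR (- (4 * a))).
      rewrite -[X in _ --> X]subr0; apply: cvgB; first exact: cvg_cst.
      rewrite -(mulr0 2); apply: cvgMr.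
      by have := @cvg_harmonic R; rewrite -cvg_shiftS.
    apply: ler_cvg_to ch cth1 _; near=> N.
    by have /andP[] := theta_fejer_itv N a0.
  apply: ler_cvg_to cth1 (cvg_cst _) _; near=> N.
  by have /andP[] := theta_fejer_itv N a0.
move=> l ls.
have : theta_fejer a N * b l @[N --> \oo] --> e / b j * b l by exact: cvgMl.
by apply: cvg_unique => //; exact: cv.
Unshelve. all: by end_near. Qed.

End residual_mean.

(** * Exponential moments and deviations *)

Lemma markov_expR d (T : measurableType d) (R : realType) (P : probability T R)
    (f : T -> R) (a e : R) : measurable_fun [set: T] f ->
  (\int[P]_w (expR (f w))%:E <= e%:E)%E ->
  (P [set w | (a <= f w)%R] <= (e * expR (- a))%:E)%E.
Proof.
move=> mf fe; have mA : measurable [set w | (a <= f w)%R].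
  rewrite (_ : [set w | _] = f @^-1` `[a, +oo[%classic).
    by rewrite -[X in measurable X]setTI; apply: mf.
  by apply/seteqP; split => w /=; rewrite in_itv/= andbT.
rewrite EFinM -lee_pdivrMr ?expR_gt0// expRN invrK muleC.
apply: le_trans fe; rewrite -(integral_cst P mA)//.
rewrite integral_mkcond; apply: ge0_le_integral => //.
- by move=> w _; rewrite patchE; case: ifPn => _ //; rewrite lee_fin expR_ge0.
- apply/(measurable_restrictT _ mA).1; exact: measurable_cst.
- by apply/measurable_EFinP; exact: measurableT_comp.
- move=> w _; rewrite patchE; case: ifPn => [|_]; last by rewrite lee_fin expR_ge0.
  by rewrite inE /= => h; rewrite lee_fin ler_expR.
Qed.

Section expR_bounds.
Variable R : realType.
Implicit Types x y : R.

Lemma expR_le_inv x : x < 1 -> expR x <= (1 - x)^-1.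
Proof.
move=> x1; rewrite -[x]opprK expRN opprK lef_pV2 ?posrE ?expR_gt0 ?subr_gt0//.
exact: expR_ge1Dx.
Qed.

(** For y > 1/2, y <= 2 y^2. Otherwise exp y <= 1 / (1 - y) <= 1 + y + 2 y^2. *)
Lemma expR_le_quadratic y : expR y <= y + expR (2 * y ^+ 2).
Proof.
have h := expR_ge1Dx (2 * y ^+ 2).
have [y2|y2] := leP y 2^-1; last first.
  apply: (@le_trans _ _ (expR (2 * y ^+ 2))); last by rewrite lerDr; lra.
  by rewrite ler_expR; nra.
apply: (@le_trans _ _ (1 + y + 2 * y ^+ 2)); last by lra.
apply: le_trans (expR_le_inv _) _; first by lra.
have y1 : 0 < 1 - y by lra.
rewrite -[leLHS]mul1r ler_pdivrMr//.
have -> : (1 + y + 2 * y ^+ 2) * (1 - y) = 1 + y ^+ 2 * (1 - 2 * y) by ring.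
by rewrite lerDl mulr_ge0 ?sqr_ge0//; lra.
Qed.

Lemma invsqrt_le_expR y : 0 <= y <= 2^-1 -> (Num.sqrt (1 - y))^-1 <= expR y.
Proof.
move=> /andP[y0 y2]; have y1 : 0 < 1 - y by lra.
rewrite invf_ple ?posrE ?sqrtr_gt0 ?expR_gt0// -expRN.
rewrite -(@ler_pXn2r _ 2) ?nnegrE ?expR_ge0 ?sqrtr_ge0// sqr_sqrtr; last exact: ltW.
rewrite -expRM_natl mulrN expRN invf_ple ?posrE ?expR_gt0//.
apply: (@le_trans _ _ (1 + 2 * y)); last by have := expR_ge1Dx (2 * y); lra.
by rewrite -[leLHS]mul1r ler_pdivrMr//; nra.
Qed.

End expR_bounds.

Lemma normal_law_expR_sqr d (T : measurableType d) (R : realType)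
    (P : probability T R) (g : T -> R) (u : R) :
  measurable_fun [set: T] g ->
  (forall B, measurable B -> P (g @^-1` B) = normal_prob 0 1 B) ->
  u < 2^-1 ->
  P.-integrable [set: T] (EFin \o (fun w => expR (u * g w ^+ 2))) /\
  \int[P]_w expR (u * g w ^+ 2) = (Num.sqrt (1 - 2 * u))^-1.
Proof.
move=> mg gE u2.
have me : measurable_fun [set: R] (fun x : R => expR (u * x ^+ 2)).
  by apply: measurableT_comp => //; apply: measurable_funM => //; exact: measurable_funX.
have E : (\int[P]_w (expR (u * g w ^+ 2))%:E = (Num.sqrt (1 - 2 * u))^-1%:E)%E.
  have := @ge0_integral_normal_law _ _ _ P g mg gE (fun x => (expR (u * x ^+ 2))%:E).
  move=> ->.
  - exact: integral_normal_expR_sqr.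
  - exact/measurable_EFinP.
  - by move=> x; rewrite lee_fin expR_ge0.
split; last by rewrite /Rintegral E.
apply/integrableP; split; first by apply/measurable_EFinP; exact: (measurableT_comp me mg).
under eq_integral do rewrite /= ger0_norm ?expR_ge0//.
by rewrite E ltry.
Qed.

Section residual_mgf.
Context d (T : measurableType d) (R : realType) (P : probability T R).
Variables (g L : T -> R) (delta : R).
Hypothesis mg : measurable_fun [set: T] g.
Hypothesis gE : forall B, measurable B -> P (g @^-1` B) = normal_prob 0 1 B.
Hypothesis mL : measurable_fun [set: T] L.
Hypothesis delta0 : 0 < delta.

Let Y w := residual delta (L w) * g w.
Let m := \int[P]_w Y w.

(* Centring does not give a sub-Gaussian bound from [`|Y| <= delta / 2 * `|g|]
   directly; [expR y <= y + expR (2 * y ^+ 2)] removes the linear term, whose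
   mean is zero, and leaves a chi-square moment. *)
Lemma residual_mgf (t : R) : t ^+ 2 * delta ^+ 2 <= 4^-1 ->
  (\int[P]_w (expR (t * (Y w - m)))%:E <= (expR (4 * (t ^+ 2 * delta ^+ 2)))%:E)%E.
Proof.
set v := t ^+ 2 * delta ^+ 2 => v4.
have v0 : 0 <= v by rewrite mulr_ge0 ?sqr_ge0.
have mY : measurable_fun [set: T] Y.
  apply: measurable_funM => //; apply: measurableT_comp => //.
  exact: measurable_residual.
have [i4 I4] := @normal_law_expR_sqr _ _ _ P g 4^-1 mg gE ltac:(lra).
have [iv Iv] := @normal_law_expR_sqr _ _ _ P g v mg gE ltac:(lra).
have g4 w : `|g w| <= expR (4^-1 * g w ^+ 2).
  apply: le_trans (expR_ge1Dx _).
  by rewrite -real_normK ?num_real//; have := sqr_ge0 (`|g w| - 2); lra.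
have Yle w : `|Y w| <= delta / 2 * `|g w|.
  by rewrite normrM ler_wpM2r// residual_bound.
have Y4 w : `|Y w| <= delta / 2 * expR (4^-1 * g w ^+ 2).
  by rewrite (le_trans (Yle w))// ler_wpM2l// divr_ge0// ltW.
have iY : P.-integrable setT (EFin \o Y).
  apply: (integrable_dominated mY Y4); exact: integrableZl_real.
(* |Y| <= (delta / 2) exp(g^2 / 4), and the mean of exp(g^2 / 4) is sqrt 2. *)
have m2 : m ^+ 2 <= delta ^+ 2 / 2.
  have mle : `|m| <= delta / 2 * (Num.sqrt (1 - 2 * 4^-1))^-1.
    rewrite -I4 -RintegralZl//; apply: le_trans (le_normr_Rintegral _ iY) _ => //.
    apply: le_Rintegral => //; first exact: integrable_abse iY.
    exact: integrableZl_real.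
  rewrite -real_normK ?num_real//; apply: le_trans (lerXn2r 2 _ _ mle) _.
  - by rewrite nnegrE.
  - by rewrite nnegrE mulr_ge0 ?invr_ge0 ?sqrtr_ge0// divr_ge0// ltW.
  rewrite exprMn exprVn sqr_sqrtr; last by lra.
  have -> : 1 - 2 * 4^-1 = 2^-1 :> R by field.
  by rewrite invrK; lra.
pose K := expR (2 * v).
pose h w := t * (Y w - m) + K * expR (v * g w ^+ 2).
have eh w : expR (t * (Y w - m)) <= h w.
  apply: le_trans (expR_le_quadratic _) _; rewrite /h lerD2l /K -expRD ler_expR.
  have Y2 : Y w ^+ 2 <= delta ^+ 2 / 4 * g w ^+ 2.
    rewrite -[Y w ^+ 2]real_normK ?num_real//.
    apply: le_trans (lerXn2r 2 _ _ (Yle w)) _.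
    - by rewrite nnegrE.
    - by rewrite nnegrE mulr_ge0// divr_ge0// ltW.
    rewrite exprMn real_normK ?num_real//.
    by rewrite exprMn exprVn; lra.
  (* From (Y - m)^2 <= 2 Y^2 + 2 m^2; then 2 t^2 (Y - m)^2 <= v g^2 + 2 v, whose constant part is
     the factor [K]. *)
  have Ym : (Y w - m) ^+ 2 <= delta ^+ 2 / 2 * g w ^+ 2 + delta ^+ 2.
    by have := sqr_ge0 (Y w + m); lra.
  rewrite exprMn.
  have := ler_wpM2l (sqr_ge0 t) Ym.
  rewrite /v; lra.
have ih : P.-integrable setT (EFin \o h).
  apply: integrableD_real; last exact: integrableZl_real.
  apply/integrableZl_real/integrableB_real => //.
  exact: finite_measure_integrable_cst.
have me : measurable_fun setT (fun w => expR (t * (Y w - m))).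
  apply: measurableT_comp => //; apply: measurable_funM => //.
  exact: measurable_funB.
have ie : P.-integrable setT (EFin \o (fun w => expR (t * (Y w - m)))).
  by apply: integrable_dominated ih => // w; rewrite ger0_norm ?expR_ge0.
rewrite -EFin_Rintegral// lee_fin.
apply: (@le_trans _ _ (\int[P]_w h w)); first exact: le_Rintegral.
have iYm : P.-integrable setT (EFin \o (fun w => Y w - m)).
  apply: integrableB_real => //; exact: finite_measure_integrable_cst.
rewrite /h RintegralD//; [|exact: integrableZl_real..].
rewrite RintegralZl// RintegralZl// RintegralB//; last exact: finite_measure_integrable_cst.
rewrite Rintegral_cst_prob subrr mulr0 add0r Iv.
have -> : 4 * v = 2 * v + 2 * v by lra.
(* The chi-square factor (1 - 2 v)^(-1/2) is at most exp(2 v) because 2 v <= 1/2, the origin of the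
   restriction on t. *)
rewrite expRD ler_wpM2l ?expR_ge0// invsqrt_le_expR//.
by apply/andP; split; lra.
Qed.

End residual_mgf.

Section gaussian_matrix_tails.
Context d (T : measurableType d) (R : realType) (P : probability T R).
Variables (m k : nat) (E : T -> 'M[R]_(m, k)).
Hypothesis hE : gaussian_matrix P E.

Let g (p : 'I_m * 'I_k) w := E w p.1 p.2.

Let mg p : measurable_fun [set: T] (g p).
Proof. exact: (gaussian_matrix_measurable hE). Qed.

Let gE p B : measurable B -> P (g p @^-1` B) = normal_prob 0 1 B.
Proof. exact: (gaussian_matrix_law hE). Qed.

Let ig : mutually_independent P g.
Proof. exact: (gaussian_matrix_independent hE). Qed.

(** The positions of row i: a dot product with a row is a linear combination over this sequence of
    the family of all entries. *)
Let rs (i : 'I_m) := [seq (i, l) | l <- enum 'I_k].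

Let urs i : uniq (rs i).
Proof. by rewrite map_inj_uniq ?enum_uniq// => a b []. Qed.

Let mem_rs i l : (i, l) \in rs i.
Proof. by apply: map_f; rewrite mem_enum. Qed.

Let rsE (F : 'I_m * 'I_k -> R) i : \sum_(p <- rs i) F p = \sum_l F (i, l).
Proof. by rewrite big_map big_enum. Qed.

Definition sqnorm n (u : 'cV[R]_n) := \sum_i u i 0 ^+ 2.

Lemma mulmx_row (u : 'cV[R]_k) i w :
  (E w *m u) i 0 = \sum_(p <- rs i) u p.2 0 * g p w.
Proof. by rewrite rsE mxE; apply: eq_bigr => l _; rewrite mulrC. Qed.

Lemma sqnorm_rs (u : 'cV[R]_k) i : \sum_(p <- rs i) u p.2 0 ^+ 2 = sqnorm u.
Proof. by rewrite rsE. Qed.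

Lemma sqnorm_ge0 n (u : 'cV[R]_n) : 0 <= sqnorm u.
Proof. by apply: sumr_ge0 => i _; exact: sqr_ge0. Qed.

Lemma measurable_mulmx_row (u : 'cV[R]_k) i :
  measurable_fun [set: T] (fun w => (E w *m u) i 0).
Proof.
under eq_fun do rewrite mulmx_row.
exact: (@measurable_lincomb _ _ _ _ _ mg).
Qed.

Let tdot (u : 'cV[R]_k) (t : k.-tuple (measurableTypeR R)) : R :=
  \sum_l tnth t l * u l 0.

Let measurable_tdot u : measurable_fun setT (tdot u).
Proof.
apply: measurable_sum => l; apply: measurable_funM => //.
exact: measurable_tnth.
Qed.

Let tdot_row u i w : tdot u (tuple_row g i w) = (E w *m u) i 0.
Proof. by rewrite mxE; apply: eq_bigr => l _; rewrite tnth_mktuple. Qed.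

Lemma row_chernoff (F : 'I_m -> k.-tuple (measurableTypeR R) -> R) (M a : R) :
  (forall i, measurable_fun setT (F i)) ->
  (forall i, (\int[P]_w (expR (F i (tuple_row g i w)))%:E <= M%:E)%E) ->
  (P [set w | (a <= \sum_i F i (tuple_row g i w))%R] <= (M ^+ m * expR (- a))%:E)%E.
Proof.
move=> mF FM.
have mrow i := @measurable_tuple_row _ _ _ (measurableTypeR R) _ _ g mg i.
pose e i := fine (\int[P]_w (expR (F i (tuple_row g i w)))%:E).
have eE i : (\int[P]_w (expR (F i (tuple_row g i w)))%:E = (e i)%:E)%E.
  rewrite /e fineK// ge0_fin_numE; last first.
    by apply: integral_ge0 => w _; rewrite lee_fin expR_ge0.
  exact: le_lt_trans (FM i) (ltry _).
have e0 i : 0 <= e i.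
  by rewrite -lee_fin -eE; apply: integral_ge0 => w _; rewrite lee_fin expR_ge0.
have eM i : e i <= M by rewrite -lee_fin -eE.
apply: markov_expR.
  by apply: measurable_sum => i; exact: (measurableT_comp (mF i) (mrow i)).
have := @ge0_integral_prod_indep _ _ T (k.-tuple (measurableTypeR R)) R P _
  (tuple_row g) mrow _ (fun i t => expR (F i t)) e _ (fun i t => expR_ge0 _) eE.
under eq_integral do rewrite -expR_sum.
move=> ->.
- rewrite lee_fin; apply: (@le_trans _ _ (\prod_(i < m) M)).
    by apply: ler_prod => i _; rewrite e0 eM.
  by rewrite prodr_const card_ord.
- by move=> J B mB; exact: (tuple_row_indep mg ig).
- by move=> i; apply: measurableT_comp => //; exact: measurable_expR.
Qed.

Lemma sqnorm_mulmx_sum (u : 'cV[R]_k) w : sqnorm (E w *m u) =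
  \sum_i tdot u (tuple_row g i w) ^+ 2.
Proof. by apply: eq_bigr => i _; rewrite tdot_row. Qed.

Lemma measurable_sqnorm_mulmx (u : 'cV[R]_k) :
  measurable_fun [set: T] (fun w => sqnorm (E w *m u)).
Proof.
by apply: measurable_sum => i; apply: measurable_funX; exact: measurable_mulmx_row.
Qed.

(** The Chernoff bound for a chi-square variable. Homogeneity in u is kept, since net points need
    not be unit vectors; for u = 0 the strict inequality makes the event empty. *)
Lemma sqnorm_mulmx_upper (u : 'cV[R]_k) (s h : R) : 0 <= s < 2^-1 ->
  (P [set w | (h * m%:R * sqnorm u < sqnorm (E w *m u))%R] <=
   (((Num.sqrt (1 - 2 * s))^-1 * expR (- (s * h))) ^+ m)%:E)%E.
Proof.
move=> /andP[s0 s2]; set S := [set w | _].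
have mS : measurable S.
  rewrite (_ : S = (fun w => sqnorm (E w *m u)) @^-1` `](h * m%:R * sqnorm u), +oo[%classic).
    by rewrite -[X in measurable X]setTI; apply: measurable_sqnorm_mulmx.
  by apply/seteqP; split => w /=; rewrite in_itv/= andbT.
have [u0|uN] := eqVneq (sqnorm u) 0.
  have uE : u = 0.
    move/eqP: u0; rewrite /sqnorm psumr_eq0 => [/allP u00|i _]; last exact: sqr_ge0.
    apply/matrixP => i j; rewrite ord1 mxE; apply/eqP.
    by have := u00 i (mem_index_enum i); rewrite /= sqrf_eq0.
  rewrite (_ : S = set0) ?measure0.
    by rewrite lee_fin exprn_ge0// mulr_ge0 ?expR_ge0// invr_ge0 sqrtr_ge0.
  apply/seteqP; split => w //=; rewrite /S/= u0 mulr0 uE mulmx0.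
  by rewrite /sqnorm big1 ?ltxx// => i _; rewrite mxE expr0n.
have up : 0 < sqnorm u by rewrite lt_neqAle eq_sym uN sqnorm_ge0.
pose t := s / sqnorm u.
have t0 : 0 <= t by rewrite divr_ge0// ltW.
have tu : t * sqnorm u = s by rewrite /t divfK.
pose F (i : 'I_m) v := t * tdot u v ^+ 2.
have := @row_chernoff F (Num.sqrt (1 - 2 * s))^-1 (s * h * m%:R).
rewrite exprMn -expRM_natl => hc.
have -> : m%:R * - (s * h) = - (s * h * m%:R) by ring.
apply: le_trans (hc _ _).
- apply: le_measure; rewrite ?inE//.
    rewrite (_ : [set w | _] =
        (fun w => t * sqnorm (E w *m u)) @^-1` `[(s * h * m%:R), +oo[%classic).
      rewrite -[X in measurable X]setTI.
      by apply: measurable_funM => //; exact: measurable_sqnorm_mulmx.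
    apply/seteqP; split => w /=; rewrite in_itv/= andbT sqnorm_mulmx_sum;
      by rewrite big_distrr.
  move=> w /=; rewrite /F -big_distrr/= -sqnorm_mulmx_sum -tu => /ltW h1.
  by have := ler_wpM2l t0 h1; apply: le_trans; rewrite le_eqVlt; apply/orP; left; apply/eqP; ring.
- move=> i; apply: measurable_funM => //; apply: measurable_funX.
  exact: measurable_tdot.
- move=> i; rewrite /F.
  under eq_integral do rewrite tdot_row mulmx_row.
  rewrite (@gaussian_lincomb_expR_sqr _ _ _ _ _ g mg gE ig _ (urs i) (fun p => u p.2 0) t)//;
    by rewrite sqnorm_rs tu.
Qed.

Lemma sqnorm_mulmx_lower (u : 'cV[R]_k) (s h : R) : 0 <= s ->
  (P [set w | (sqnorm (E w *m u) < h * m%:R * sqnorm u)%R] <=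
   (((Num.sqrt (1 + 2 * s))^-1 * expR (s * h)) ^+ m)%:E)%E.
Proof.
move=> s0; set S := [set w | _].
have mS : measurable S.
  rewrite (_ : S = (fun w => sqnorm (E w *m u)) @^-1` `]-oo, (h * m%:R * sqnorm u)[%classic).
    by rewrite -[X in measurable X]setTI; apply: measurable_sqnorm_mulmx.
  by apply/seteqP; split => w /=; rewrite in_itv/=.
have [u0|uN] := eqVneq (sqnorm u) 0.
  rewrite (_ : S = set0) ?measure0.
    by rewrite lee_fin exprn_ge0// mulr_ge0 ?expR_ge0// invr_ge0 sqrtr_ge0.
  apply/seteqP; split => w //=; rewrite /S/= u0 mulr0.
  by rewrite ltNge sqnorm_ge0.
have up : 0 < sqnorm u by rewrite lt_neqAle eq_sym uN sqnorm_ge0.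
pose t := s / sqnorm u.
have t0 : 0 <= t by rewrite divr_ge0// ltW.
have tu : t * sqnorm u = s by rewrite /t divfK.
pose F (i : 'I_m) v := - t * tdot u v ^+ 2.
have := @row_chernoff F (Num.sqrt (1 + 2 * s))^-1 (- (s * h * m%:R)).
rewrite exprMn -expRM_natl opprK => hc.
have -> : m%:R * (s * h) = s * h * m%:R by ring.
apply: le_trans (hc _ _).
- apply: le_measure; rewrite ?inE//.
    rewrite (_ : [set w | _] =
        (fun w => - t * sqnorm (E w *m u)) @^-1` `[(- (s * h * m%:R)), +oo[%classic).
      rewrite -[X in measurable X]setTI.
      by apply: measurable_funM => //; exact: measurable_sqnorm_mulmx.
    apply/seteqP; split => w /=; rewrite in_itv/= andbT sqnorm_mulmx_sum;
      by rewrite big_distrr.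
  move=> w /=; rewrite /F -big_distrr/= -sqnorm_mulmx_sum -tu => /ltW h1.
  rewrite mulNr lerN2.
  by have := ler_wpM2l t0 h1 => /le_trans; apply; rewrite le_eqVlt; apply/orP; left; apply/eqP; ring.
- move=> i; apply: measurable_funM => //; apply: measurable_funX.
  exact: measurable_tdot.
- move=> i; rewrite /F.
  have := @gaussian_lincomb_expRN_sqr_le _ _ _ _ _ g mg gE ig _ (urs i) (fun p => u p.2 0) t 0 t0.
  rewrite sqnorm_rs tu -lee_fin EFin_Rintegral.
    under eq_integral do rewrite subr0.
    under [in X in _ -> X]eq_integral do rewrite tdot_row mulmx_row mulNr.
    by [].
  apply: (@bounded_integrable _ _ _ _ _ 1) => [|w].
    apply: measurableT_comp => //; apply: measurableT_comp => //.
    apply: measurable_funM => //; apply: measurable_funX.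
    by apply: measurable_funB => //; exact: (@measurable_lincomb _ _ _ _ _ mg).
  by rewrite ger0_norm ?expR_ge0// -expR0 ler_expR oppr_le0 mulr_ge0 ?sqr_ge0.
Qed.

(** Chernoff's bound at both signs, one factor per row. The parameter t delta = beta / 8 minimizes 4
    (t delta)^2 - (t delta) beta, with value - beta^2 / 16; beta <= 4 keeps (t delta)^2 <= 1/4. *)
Lemma residual_deviation (x : 'cV[R]_k) (delta beta : R) :
  (0 < m)%N -> 0 < delta -> 0 <= beta <= 4 ->
  let a := 2 * pi ^+ 2 * sqnorm x / delta ^+ 2 in
  exists theta : R,
    2 * (expR (- a) - expR (- (4 * a))) <= theta <= 2 * expR (- a) /\
    forall j, (P [set w | (m%:R * beta * delta <=
        `|\sum_i residual delta ((E w *m x) i 0) * E w i j - m%:R * theta * x j 0|)%R] <=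
      (2 * expR (- (m%:R * beta ^+ 2 / 16)))%:E)%E.
Proof.
move=> m0 d0 /andP[b0 b4] a.
have mR0 : 0 < m%:R :> R by rewrite ltr0n.
have /choice[th thP] i : exists theta : R,
    2 * (expR (- a) - expR (- (4 * a))) <= theta <= 2 * expR (- a) /\
    forall j, \int[P]_w (residual delta ((E w *m x) i 0) * E w i j) = theta * x j 0.
  have [theta [h1 h2]] := @Rintegral_residual _ _ _ _ _ g mg gE ig _ (urs i)
    (fun p => x p.2 0) delta d0.
  rewrite sqnorm_rs in h1; exists theta; split => // j.
  by rewrite -(h2 (i, j) (mem_rs i j)); apply: eq_Rintegral => w _; rewrite mulmx_row.
(* Each row supplies its own constant; their average lies in the same interval and is the only one
   the sum over rows sees. *)
exists ((\sum_i th i) / m%:R); split.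
  have sumc (c : R) : c * m%:R = \sum_(i < m) c.
    by rewrite sumr_const card_ord mulr_natr.
  rewrite ler_pdivlMr// ler_pdivrMr// !sumc.
  by apply/andP; split; apply: ler_sum => i _; have [/andP[]] := thP i.
move=> j; pose f w := \sum_i residual delta ((E w *m x) i 0) * E w i j -
  (\sum_i th i) * x j 0.
have mr i : measurable_fun [set: T] (fun w => residual delta ((E w *m x) i 0)).
  exact: (measurableT_comp (measurable_residual d0) (measurable_mulmx_row x i)).
have mf : measurable_fun setT f.
  apply: measurable_funB => //; apply: measurable_sum => i.
  by apply: measurable_funM => //; exact: (mg (i, j)).
have tail (e : R) : e ^+ 2 = 1 ->
    (P [set w | (m%:R * beta * delta <= e * f w)%R] <=
     (expR (- (m%:R * beta ^+ 2 / 16)))%:E)%E.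
  move=> e2; have [->|bN] := eqVneq beta 0.
    rewrite expr0n/= !(mulr0, mul0r, oppr0, expR0); apply: probability_le1.
    rewrite (_ : [set w | _] = (fun w => e * f w) @^-1` `[0, +oo[%classic).
      by rewrite -[X in measurable X]setTI; apply: measurable_funM.
    by apply/seteqP; split => w /=; rewrite in_itv/= andbT.
  have bp : 0 < beta by rewrite lt_neqAle eq_sym bN.
  pose t := e * (beta / (8 * delta)).
  have t0 : 0 < beta / (8 * delta) by rewrite divr_gt0// mulr_gt0.
  have t2 : t ^+ 2 * delta ^+ 2 = beta ^+ 2 / 64.
    by rewrite /t exprMn e2; field; rewrite gt_eqF.
  pose F (i : 'I_m) (v : k.-tuple (measurableTypeR R)) : R :=
    t * (residual delta (tdot x v) * tnth v j - th i * x j 0).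
  have := @row_chernoff F (expR (4 * (t ^+ 2 * delta ^+ 2))) (m%:R * beta ^+ 2 / 8).
  rewrite -expRM_natl -expRD t2 => hc.
  have -> : - (m%:R * beta ^+ 2 / 16) =
      m%:R * (4 * (beta ^+ 2 / 64)) + - (m%:R * beta ^+ 2 / 8) by field.
  have FE w : \sum_i F i (tuple_row g i w) = t * f w.
    rewrite /F -big_distrr/= /f sumrB -mulr_suml; congr (_ * (_ - _)).
    by apply: eq_bigr => i _; rewrite tdot_row tnth_mktuple.
  rewrite (_ : [set w | _] =
    [set w | (m%:R * beta ^+ 2 / 8 <= \sum_i F i (tuple_row g i w))%R]).
    apply: hc => i.
    - apply: measurable_funM => //; apply: measurable_funB => //.
      apply: measurable_funM; last exact: measurable_tnth.
      exact: (measurableT_comp (measurable_residual d0) (measurable_tdot x)).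
    - have := @residual_mgf _ _ _ P (g (i, j)) (fun w => (E w *m x) i 0) delta
        (mg (i, j)) (gE (i, j)) (measurable_mulmx_row x i) d0 t.
      rewrite t2 (thP i).2 => h; apply: le_trans (h _); last first.
        by rewrite -(@ler_pM2r _ 64)//; nra.
      rewrite le_eqVlt; apply/orP; left; apply/eqP; apply: eq_integral => w _.
      by rewrite /F tdot_row tnth_mktuple.
  apply/seteqP; split => w /=; rewrite FE.
    move=> h; have := ler_wpM2l (ltW t0) h.
    rewrite (_ : beta / (8 * delta) * (m%:R * beta * delta) = m%:R * beta ^+ 2 / 8).
      by move/le_trans; apply; rewrite /t -mulrA mulrCA.
    by field; rewrite gt_eqF.
  move=> h; rewrite -(ler_pM2l t0).
  rewrite (_ : beta / (8 * delta) * (m%:R * beta * delta) = m%:R * beta ^+ 2 / 8).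
    by apply: le_trans h _; rewrite /t -mulrA mulrCA.
  by field; rewrite gt_eqF.
have mtail (e : R) : measurable [set w | (m%:R * beta * delta <= e * f w)%R].
  rewrite (_ : [set w | _] = (fun w => e * f w) @^-1` `[m%:R * beta * delta, +oo[%classic).
    by rewrite -[X in measurable X]setTI; apply: measurable_funM.
  by apply/seteqP; split => w /=; rewrite in_itv/= andbT.
rewrite (_ : [set w | _] = [set w | (m%:R * beta * delta <= 1 * f w)%R] `|`
    [set w | (m%:R * beta * delta <= -1 * f w)%R]).
  apply: le_trans (measureU2 _ _ _) _; [exact: mtail|exact: mtail|].
  rewrite -[2 in leRHS]/(1 + 1) mulrDl mul1r EFinD; apply: leeD; apply: tail.
    by rewrite expr1n.
  by rewrite sqrrN expr1n.
have mE : m%:R * ((\sum_i th i) / m%:R) = \sum_i th i.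
  by rewrite mulrC divfK// gt_eqF.
by apply/seteqP; split => w /=; rewrite mE -/(f w) mul1r mulN1r ler_normr => /orP.
Qed.

End gaussian_matrix_tails.

(** * Extreme singular values of a Gaussian matrix *)

Section euclidean_norm.
Variable R : realType.

Lemma enormE n (u : 'cV[R]_n) : enorm u = Num.sqrt (sqnorm u).
Proof. by []. Qed.

Lemma enorm_ge0 n (u : 'cV[R]_n) : 0 <= enorm u.
Proof. exact: sqrtr_ge0. Qed.

Lemma sqr_enorm n (u : 'cV[R]_n) : enorm u ^+ 2 = sqnorm u.
Proof. by rewrite enormE sqr_sqrtr// sqnorm_ge0. Qed.

Lemma enorm_le n (u : 'cV[R]_n) (c : R) : 0 <= c -> sqnorm u <= c ^+ 2 -> enorm u <= c.
Proof. by move=> c0 h; rewrite enormE -[leRHS]ger0_norm// -sqrtr_sqr ler_wsqrtr. Qed.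

Lemma enormZ n (c : R) (u : 'cV[R]_n) : enorm (c *: u) = `|c| * enorm u.
Proof.
rewrite !enormE -sqrtr_sqr -sqrtrM ?sqr_ge0//; congr Num.sqrt.
by rewrite /sqnorm mulr_sumr; apply: eq_bigr => i _; rewrite mxE exprMn.
Qed.

Lemma enorm0_eq n (u : 'cV[R]_n) : enorm u = 0 -> u = 0.
Proof.
move=> u0; have : sqnorm u == 0 by rewrite -sqr_enorm u0 expr0n.
rewrite /sqnorm psumr_eq0 => [/allP u00|i _]; last exact: sqr_ge0.
apply/matrixP => i j; rewrite ord1 mxE; apply/eqP.
by have := u00 i (mem_index_enum i); rewrite /= sqrf_eq0.
Qed.

Lemma enorm0 n : enorm (0 : 'cV[R]_n) = 0.
Proof.
by rewrite enormE /sqnorm big1 ?sqrtr0// => i _; rewrite mxE expr0n.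
Qed.

(** Cauchy-Schwarz, from the nonnegative sum of the squares of |v| a_i - |u| b_i. *)
Lemma sum_mul_le_enorm n (a b : 'I_n -> R) :
  \sum_i a i * b i <= enorm (\col_i a i) * enorm (\col_i b i).
Proof.
set u := \col_i a i; set v := \col_i b i.
have [u0|uN] := eqVneq (enorm u) 0.
  have a0 i : a i = 0 by have /matrixP/(_ i 0) := enorm0_eq u0; rewrite !mxE.
  by rewrite u0 mul0r big1// => i _; rewrite a0 mul0r.
have [v0|vN] := eqVneq (enorm v) 0.
  have b0 i : b i = 0 by have /matrixP/(_ i 0) := enorm0_eq v0; rewrite !mxE.
  by rewrite v0 mulr0 big1// => i _; rewrite b0 mulr0.
have up : 0 < enorm u by rewrite lt_neqAle eq_sym uN enorm_ge0.
have vp : 0 < enorm v by rewrite lt_neqAle eq_sym vN enorm_ge0.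
have Su : \sum_i a i ^+ 2 = enorm u ^+ 2.
  by rewrite sqr_enorm; apply: eq_bigr => i _; rewrite mxE.
have Sv : \sum_i b i ^+ 2 = enorm v ^+ 2.
  by rewrite sqr_enorm; apply: eq_bigr => i _; rewrite mxE.
have : 0 <= \sum_i (enorm v * a i - enorm u * b i) ^+ 2.
  by apply: sumr_ge0 => i _; exact: sqr_ge0.
have -> : \sum_i (enorm v * a i - enorm u * b i) ^+ 2 =
    enorm v ^+ 2 * (\sum_i a i ^+ 2) + enorm u ^+ 2 * (\sum_i b i ^+ 2) -
    2 * (enorm u * enorm v) * \sum_i a i * b i.
  rewrite !big_distrr/= -big_split -sumrB/=; apply: eq_bigr => i _.
  by ring.
rewrite Su Sv => h; have uv : 0 < 2 * (enorm u * enorm v) by rewrite !mulr_gt0.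
rewrite -(ler_pM2l uv); lra.
Qed.

Lemma enormD n (u v : 'cV[R]_n) : enorm (u + v) <= enorm u + enorm v.
Proof.
apply: enorm_le; first by rewrite addr_ge0 ?enorm_ge0.
have h := sum_mul_le_enorm (fun i => u i 0) (fun i => v i 0).
have cE (w : 'cV[R]_n) : \col_i w i 0 = w by apply/matrixP => i j; rewrite !mxE ord1.
rewrite !cE in h.
have -> : sqnorm (u + v) = enorm u ^+ 2 + 2 * (\sum_i u i 0 * v i 0) + enorm v ^+ 2.
  rewrite !sqr_enorm /sqnorm big_distrr/= -!big_split/=; apply: eq_bigr => i _.
  by rewrite mxE; ring.
by lra.
Qed.

Lemma enormN n (u : 'cV[R]_n) : enorm (- u) = enorm u.
Proof. by rewrite -scaleN1r enormZ normrN1 mul1r. Qed.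

Lemma enormB n (u v : 'cV[R]_n) : enorm u - enorm v <= enorm (u + v).
Proof.
by have := enormD (u + v) (- v); rewrite addrK enormN; lra.
Qed.

Lemma enorm_ge_coord n (u : 'cV[R]_n) i : `|u i 0| <= enorm u.
Proof.
rewrite enormE -sqrtr_sqr ler_wsqrtr// /sqnorm (bigD1 i)//= lerDl.
by apply: sumr_ge0 => j _; exact: sqr_ge0.
Qed.

Lemma enorm_le_coord n (u : 'cV[R]_n) (c : R) : 0 <= c ->
  (forall i, `|u i 0| <= c) -> enorm u <= Num.sqrt n%:R * c.
Proof.
move=> c0 uc; apply: enorm_le; first by rewrite mulr_ge0 ?sqrtr_ge0.
rewrite exprMn sqr_sqrtr ?ler0n// mulr_natl -[n in leRHS]card_ord -sumr_const.
apply: ler_sum => i _; rewrite -real_normK ?num_real//.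
by apply: lerXn2r; rewrite ?nnegrE.
Qed.

Lemma sum_norm_le_enorm n (u : 'cV[R]_n) :
  \sum_i `|u i 0| <= Num.sqrt n%:R * enorm u.
Proof.
have := sum_mul_le_enorm (fun i => `|u i 0|) (fun=> 1).
under eq_bigr do rewrite mulr1.
rewrite mulrC; congr (_ <= _ * _).
  by rewrite enormE /sqnorm; under eq_bigr do rewrite mxE expr1n;
    rewrite sumr_const card_ord.
rewrite !enormE; congr Num.sqrt; apply: eq_bigr => i _.
by rewrite mxE real_normK ?num_real.
Qed.

(** The Frobenius norm is a valid constant. Only finiteness matters: it makes the supremum in the
    net argument exist. *)
Lemma mulmx_enorm_bounded m n (A : 'M[R]_(m, n)) :
  exists2 F : R, 0 <= F & forall u, enorm (A *m u) <= F * enorm u.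
Proof.
exists (Num.sqrt (\sum_i \sum_j A i j ^+ 2)) => [|u]; first exact: sqrtr_ge0.
apply: enorm_le; first by rewrite mulr_ge0 ?sqrtr_ge0 ?enorm_ge0.
rewrite exprMn sqr_sqrtr; last first.
  by apply: sumr_ge0 => i _; apply: sumr_ge0 => j _; exact: sqr_ge0.
rewrite mulr_suml; apply: ler_sum => i _.
have cE : \col_j u j 0 = u by apply/matrixP => a b; rewrite !mxE ord1.
have h1 := sum_mul_le_enorm (fun j => A i j) (fun j => u j 0).
have h2 := sum_mul_le_enorm (fun j => - A i j) (fun j => u j 0).
have NE : \col_j - A i j = - \col_j A i j by apply/matrixP => a b; rewrite !mxE.
rewrite NE enormN cE in h2; rewrite cE in h1.
have -> : \sum_j A i j ^+ 2 = enorm (\col_j A i j) ^+ 2.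
  by rewrite sqr_enorm; apply: eq_bigr => j _; rewrite mxE.
rewrite -exprMn -real_normK ?num_real//.
apply: lerXn2r; rewrite ?nnegrE ?mulr_ge0 ?enorm_ge0//.
rewrite ler_norml mxE h1 andbT lerNl -sumrN.
under eq_bigr do rewrite -mulNr.
exact: h2.
Qed.

Let colK p (w : 'cV[R]_p) : \col_i w i 0 = w.
Proof. by apply/matrixP => i j; rewrite !mxE ord1. Qed.

Let mulmx_adjoint m n (A : 'M[R]_(m, n)) (u : 'cV[R]_n) (v : 'cV[R]_m) :
  \sum_i (A *m u) i 0 * v i 0 = \sum_j u j 0 * (A^T *m v) j 0.
Proof.
transitivity (((A *m u)^T *m v) 0 0).
  by rewrite [RHS]mxE; apply: eq_bigr => i _; rewrite [(A *m u)^T _ _]mxE.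
rewrite trmx_mul -mulmxA [LHS]mxE; apply: eq_bigr => j _.
by rewrite [u^T _ _]mxE.
Qed.

(** With z = A^T v, |z|^2 = (A z, v) <= S |z| |v|. *)
Lemma enorm_mul_trmx m n (A : 'M[R]_(m, n)) (S : R) (v : 'cV[R]_m) : 0 <= S ->
  (forall u, enorm (A *m u) <= S * enorm u) -> enorm (A^T *m v) <= S * enorm v.
Proof.
move=> S0 AS; set z := A^T *m v.
have h : enorm z ^+ 2 <= S * enorm z * enorm v.
  rewrite sqr_enorm /sqnorm.
  under eq_bigr do rewrite expr2.
  rewrite -mulmx_adjoint; apply: le_trans (sum_mul_le_enorm _ _) _; rewrite !colK.
  by rewrite ler_wpM2r ?enorm_ge0.
have [->|zN] := eqVneq (enorm z) 0; first by rewrite mulr_ge0 ?enorm_ge0.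
have zp : 0 < enorm z by rewrite lt_neqAle eq_sym zN enorm_ge0.
rewrite -(ler_pM2l zp) -expr2; apply: le_trans h _.
by rewrite [leRHS]mulrCA mulrA.
Qed.

(* The normal equations [A^T A y = A^T r] give both bounds from the extreme
   singular values of [A] alone. *)
Lemma normal_equations_bounds m n (A : 'M[R]_(m, n)) (r : 'cV[R]_m)
    (y : 'cV[R]_n) (s S : R) : 0 < s -> 0 <= S ->
  (forall u, s * enorm u <= enorm (A *m u) <= S * enorm u) ->
  A^T *m (A *m y) = A^T *m r ->
  s ^+ 2 * enorm y <= enorm (A^T *m r) <= S ^+ 2 * enorm y.
Proof.
move=> s0 S0 AS yE; rewrite -yE; apply/andP; split.
  have h : s ^+ 2 * enorm y ^+ 2 <= enorm y * enorm (A^T *m (A *m y)).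
    have := sum_mul_le_enorm (fun j => y j 0) (fun j => (A^T *m (A *m y)) j 0).
    rewrite !colK -mulmx_adjoint; apply: le_trans.
    rewrite -exprMn; apply: (@le_trans _ _ (enorm (A *m y) ^+ 2)).
      apply: lerXn2r; rewrite ?nnegrE ?mulr_ge0 ?enorm_ge0 ?(ltW s0)//.
      by have /andP[] := AS y.
    by rewrite sqr_enorm; under eq_bigr do rewrite -expr2.
  have [->|yN] := eqVneq (enorm y) 0; first by rewrite mulr0 enorm_ge0.
  have yp : 0 < enorm y by rewrite lt_neqAle eq_sym yN enorm_ge0.
  by rewrite -(ler_pM2l yp); apply: le_trans h; rewrite expr2 mulrCA.
apply: (@le_trans _ _ (S * enorm (A *m y))).
  by apply: enorm_mul_trmx => // u; have /andP[] := AS u.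
by rewrite expr2 -mulrA ler_wpM2l//; have /andP[] := AS y.
Qed.

End euclidean_norm.

(** * A lattice net of the Euclidean unit ball *)

Section lattice_net.
Variables (R : realType) (k N : nat).
Hypotheses (k0 : (0 < k)%N) (N1 : (1 < N)%N).

Let h : R := (N%:R * Num.sqrt k%:R)^-1.

(* Signs and absolute values, so that [grid_simplex] is an l1 ball: it contains
   a net of the Euclidean ball, and has at most [(8 (N + 1))^k] points,
   exponentially many in [k] where the full cube would have [k^(k/2)]. *)
Definition grid := {ffun 'I_k -> bool * 'I_(N * k).+1}.

Definition gridvec (z : grid) : 'cV[R]_k :=
  \col_l ((-1) ^+ (z l).1 * (z l).2%:R * h).

Definition grid_simplex : {set grid} :=
  finset (fun z : grid => \sum_l (z l).2 <= N * k)%N.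

Let sk0 : 0 < Num.sqrt k%:R :> R.
Proof. by rewrite sqrtr_gt0 ltr0n. Qed.

Let N0 : 0 < N%:R :> R.
Proof. by rewrite ltr0n ltnW. Qed.

Let h0 : 0 < h.
Proof. by rewrite invr_gt0 mulr_gt0. Qed.

(** Coordinates are truncated towards 0 to multiples of the mesh h = 1 / (N sqrt k). Each moves by
    less than h, so u moves by at most h sqrt k = 1 / N, and norms do not grow. The multipliers sum
    to at most |u|_1 / h <= sqrt k / h = N k. *)
Lemma grid_approx (u : 'cV[R]_k) : enorm u <= 1 ->
  exists2 z, z \in grid_simplex &
    enorm (u - gridvec z) <= N%:R^-1 /\ enorm (gridvec z) <= 1.
Proof.
move=> u1; pose a l := Num.truncn (`|u l 0| / h).
have aP l : (a l)%:R * h <= `|u l 0| < ((a l)%:R + 1) * h.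
  rewrite -ler_pdivlMr// -ltr_pdivrMr// natr1; apply: truncn_itv.
  by rewrite divr_ge0// ltW.
have suma : (\sum_l a l <= N * k)%N.
  rewrite -(ler_nat R) natr_sum -(ler_pM2r h0) mulr_suml.
  apply: (@le_trans _ _ (\sum_l `|u l 0|)).
    by apply: ler_sum => l _; have /andP[] := aP l.
  apply: le_trans (sum_norm_le_enorm _) _.
  apply: (@le_trans _ _ (Num.sqrt k%:R)); first by rewrite ler_piMr// ltW.
  rewrite le_eqVlt; apply/orP; left; apply/eqP.
  rewrite natrM /h -[X in _ = _ * X * _](sqr_sqrtr (ler0n R k)).
  move: sk0 N0; move: (Num.sqrt _) (N%:R : R) => p q p0 q0.
  by field; rewrite !gt_eqF.
have aB l : (a l < (N * k).+1)%N.
  by rewrite ltnS (leq_trans _ suma)// (bigD1 l)//= leq_addr.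
pose z : grid := [ffun l => (u l 0 < 0, Ordinal (aB l))].
have zE l : gridvec z l 0 = (-1) ^+ (u l 0 < 0)%R * (a l)%:R * h.
  by rewrite mxE ffunE.
have uE l : u l 0 = (-1) ^+ (u l 0 < 0)%R * `|u l 0|.
  by case: ltrP => [/ltr0_norm ->|/ger0_norm ->]; rewrite ?expr1 ?expr0 ?mulN1r ?opprK ?mul1r.
exists z; first by rewrite inE; under eq_bigr do rewrite ffunE.
split.
  have -> : N%:R^-1 = Num.sqrt k%:R * h :> R.
    by rewrite /h invfM mulrCA divff ?mulr1// gt_eqF.
  apply: enorm_le_coord; first exact: ltW.
  move=> l; rewrite mxE [X in _ + X]mxE zE {1}uE -mulrA -mulrBr normrM normrX normrN1 expr1n mul1r.
  by have /andP[h1 h2] := aP l; rewrite ger0_norm; lra.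
apply: enorm_le => //; apply: (@le_trans _ _ (sqnorm u)); last first.
  by rewrite -sqr_enorm; apply: lerXn2r; rewrite ?nnegrE ?enorm_ge0.
apply: ler_sum => l _; rewrite zE -mulrA exprMn sqrr_sign mul1r.
rewrite -[leRHS]real_normK ?num_real//; apply: lerXn2r; rewrite ?nnegrE//.
  by rewrite mulr_ge0// ltW.
by have /andP[] := aP l.
Qed.

Let geometric (q : R) n : 0 <= q < 1 -> \sum_(i < n) q ^+ i <= (1 - q)^-1.
Proof.
move=> /andP[q0 q1]; have q1' : 0 < 1 - q by rewrite subr_gt0.
rewrite -[leRHS]mul1r ler_pdivlMr// mulrC -opprB mulNr -subrX1 opprB.
by rewrite lerBlDr lerDl exprn_ge0.
Qed.

(** A generating-function count: on the simplex the product over l of e q^(a_l), q = exp(-1/N), is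
    at least 1. Summed over the whole grid, signs included, it factors into k terms, each at most 2
    e / (1 - q) <= 8 (N + 1). *)
Lemma card_grid_simplex : #|grid_simplex|%:R <= (8 * N.+1%:R) ^+ k :> R.
Proof.
pose q : R := expR (- N%:R^-1).
have q1 : q <= N%:R / N.+1%:R.
  rewrite /q expRN invf_ple ?posrE ?expR_gt0 ?divr_gt0// invf_div.
  by apply: le_trans (expR_ge1Dx _); rewrite -natr1 mulrDl divff ?gt_eqF// mul1r.
have q01 : 0 <= q < 1.
  rewrite expR_ge0/=; apply: le_lt_trans q1 _.
  by rewrite ltr_pdivrMr// mul1r ltr_nat.
have geo n : \sum_(i < n) q ^+ i <= N.+1%:R.
  apply: le_trans (geometric n q01) _.
  rewrite invf_ple ?posrE ?subr_gt0//; last by have /andP[] := q01.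
  have -> : N.+1%:R^-1 = 1 - N%:R / N.+1%:R :> R.
    by rewrite -natr1; field; rewrite natr1 pnatr_eq0.
  by rewrite lerB.
have e4 : expR 1 <= 4 :> R.
  have e2 : expR 2^-1 <= 2 :> R.
    apply: le_trans (expR_le_inv _) _; first by lra.
    by rewrite (_ : 1 - 2^-1 = 2^-1) ?invrK//; lra.
  rewrite (_ : expR 1 = expR 2^-1 * expR 2^-1); last first.
    by rewrite -expRD; congr expR; lra.
  by rewrite (_ : 4 = 2 * 2) -?natrM// natrM ler_pM ?expR_ge0.
rewrite -sum1_card natr_sum.
apply: (@le_trans _ _ (\sum_(z : grid) \prod_l (expR 1 * q ^+ (z l).2))).
  rewrite [leRHS](bigID (mem grid_simplex))/=.
  rewrite -[leLHS]addr0; apply: lerD; last first.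
    by apply: sumr_ge0 => z _; apply: prodr_ge0 => l _;
      rewrite mulr_ge0 ?exprn_ge0 ?expR_ge0.
  apply: ler_sum => z; rewrite inE => zN.
  rewrite big_split/= prodr_const card_ord -expRM_natl mulr1 prodrXr.
  rewrite /q -expRM_natl -expRD -[leLHS]expR0 ler_expR mulrN subr_ge0.
  rewrite ler_pdivrMr// mulrC -natrM ler_nat.
  exact: zN.
pose F (l : 'I_k) (p : bool * 'I_(N * k).+1) : R := expR 1 * q ^+ p.2.
rewrite -(bigA_distr_bigA F)/=.
apply: (@le_trans _ _ (\prod_(l < k) (8 * N.+1%:R))); last first.
  by rewrite prodr_const card_ord.
apply: ler_prod => l _; apply/andP; split.
  by apply: sumr_ge0 => p _; rewrite mulr_ge0 ?exprn_ge0 ?expR_ge0.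
rewrite /F -(pair_bigA _ (fun (_ : bool) (a : 'I_(N * k).+1) => expR 1 * q ^+ a))/=.
rewrite big_const card_bool/= addr0 -!big_distrr/=.
have S0 : 0 <= \sum_(i < (N * k).+1) q ^+ i.
  by apply: sumr_ge0 => i _; rewrite exprn_ge0 ?expR_ge0.
have := geo (N * k).+1; move: S0; move: (\sum_(i < _) _) => S S0 S1.
by have := expR_ge0 (1 : R); move: e4; move: (expR 1) => e; nra.
Qed.

(** The supremum M over the unit ball satisfies M <= U + M / N, hence M <= U N / (N - 1). Below, a
    unit vector has a net point of norm at least 1 - 1 / N, and the error costs at most M / N <= U /
    (N - 1). *)
Lemma net_bounds m (A : 'M[R]_(m, k)) (U l : R) : 0 <= U -> 0 <= l ->
  (forall z, z \in grid_simplex ->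
    l * enorm (gridvec z) <= enorm (A *m gridvec z) <= U * enorm (gridvec z)) ->
  forall u, (l * (1 - N%:R^-1) - U / N.-1%:R) * enorm u <= enorm (A *m u)
            <= U * (N%:R / N.-1%:R) * enorm u.
Proof.
move=> U0 l0 Az.
have NE : N%:R = N.-1%:R + 1 :> R by rewrite natr1 prednK// ltnW.
have M0 : 0 < N.-1%:R :> R by rewrite ltr0n -ltnS prednK// ltnW.
pose S := [set enorm (A *m u) | u in [set u | enorm u <= 1]].
have [F F0 AF] := mulmx_enorm_bounded A.
have hS : has_sup S.
  split; first by exists (enorm (A *m 0)); exists 0; rewrite //= enorm0.
  by exists F => _ [u /= u1 <-]; rewrite (le_trans (AF u))// ler_piMr.
pose M := sup S.
have SM u : enorm u <= 1 -> enorm (A *m u) <= M.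
  by move=> u1; apply: (sup_upper_bound hS); exists u.
have SMZ (u : 'cV[R]_k) (c : R) : 0 < c -> enorm u <= c -> enorm (A *m u) <= M * c.
  move=> c0 uc; have := SM (c^-1 *: u).
  rewrite -scalemxAr !enormZ ger0_norm ?invr_ge0 ?(ltW c0)//.
  by rewrite !(mulrC c^-1) !ler_pdivrMr// mul1r; exact.
have MU : M <= U + M * N%:R^-1.
  apply: sup_le_ub; first by case: hS.
  move=> _ [u /= u1 <-]; have [z zG [uz z1]] := grid_approx u1.
  have -> : A *m u = A *m gridvec z + A *m (u - gridvec z).
    by rewrite -mulmxDr addrC subrK.
  apply: le_trans (enormD _ _) _; apply: lerD.
    by have /andP[_ h2] := Az z zG; apply: le_trans h2 _; rewrite ler_piMr.
  by apply: SMZ => //; rewrite invr_gt0.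
have MU' : M <= U * (N%:R / N.-1%:R).
  rewrite mulrA ler_pdivlMr//.
  have := ler_wpM2r (ltW N0) MU; rewrite mulrDl mulfVK ?gt_eqF//.
  by rewrite {1}NE; lra.
have M_ge0 : 0 <= M by apply: le_trans (SM 0 _); rewrite ?mulmx0 enorm0.
have unit_lower u : enorm u = 1 ->
    l * (1 - N%:R^-1) - U / N.-1%:R <= enorm (A *m u).
  move=> u1; have u1' : enorm u <= 1 by rewrite u1.
  have [z zG [uz z1]] := grid_approx u1'.
  have zl : 1 - N%:R^-1 <= enorm (gridvec z).
    have := enormD (u - gridvec z) (gridvec z); rewrite subrK u1; lra.
  have -> : A *m u = A *m gridvec z + A *m (u - gridvec z).
    by rewrite -mulmxDr addrC subrK.
  apply: le_trans (enormB _ _); apply: lerB.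
    have /andP[h1 _] := Az z zG; apply: le_trans h1.
    by rewrite ler_wpM2l.
  have Ninv : 0 < N%:R^-1 :> R by rewrite invr_gt0.
  apply: le_trans (SMZ _ _ Ninv uz) _.
  rewrite ler_pdivrMr//; apply: le_trans MU' _.
  by rewrite le_eqVlt; apply/orP; left; apply/eqP; ring.
move=> u; have [u0|uN] := eqVneq (enorm u) 0.
  by rewrite (enorm0_eq u0) mulmx0 !enorm0 !mulr0 lexx.
have up : 0 < enorm u by rewrite lt_neqAle eq_sym uN enorm_ge0.
apply/andP; split.
  have := unit_lower ((enorm u)^-1 *: u).
  rewrite -scalemxAr !enormZ ger0_norm ?invr_ge0 ?enorm_ge0// mulVf// => /(_ erefl).
  by rewrite [leRHS]mulrC ler_pdivlMr.
by apply: le_trans (SMZ u _ up (lexx _)) _; rewrite ler_wpM2r ?enorm_ge0.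
Qed.

End lattice_net.

Lemma union_bound d (T : measurableType d) (R : realType) (P : probability T R)
    (I : finType) (Q : {set I}) (A : I -> set T) (c : R) :
  (forall i, measurable (A i)) -> (forall i, (P (A i) <= c%:E)%E) ->
  measurable [set w | exists2 i, i \in Q & A i w] /\
  (P [set w | exists2 i, i \in Q & A i w] <= (#|Q|%:R * c)%:E)%E.
Proof.
move=> mA PA.
have -> : [set w | exists2 i, i \in Q & A i w] = \big[setU/set0]_(i <- enum Q) A i.
  rewrite -bigcup_seq; apply/seteqP; split => w [i iQ Aiw]; exists i => //;
    by move: iQ; rewrite /= mem_enum.
rewrite cardE; elim: (enum Q) => [|i s [ms Ps]].
  by rewrite big_nil measure0 mul0r; split.
rewrite big_cons; split; first exact: measurableU.
apply: le_trans (measureU2 _ _ _) _ => //.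
by rewrite /= -natr1 mulrDl mul1r addrC EFinD; apply: leeD.
Qed.

Section gaussian_net.
Context d (T : measurableType d) (R : realType) (P : probability T R).
Variables (m k N : nat) (E : T -> 'M[R]_(m, k)).
Hypotheses (hE : gaussian_matrix P E) (k0 : (0 < k)%N) (N1 : (1 < N)%N).
Variables (h1 h2 s1 s2 q : R).
Hypotheses (h10 : 0 <= h1) (h20 : 0 <= h2) (s10 : 0 <= s1) (s20 : 0 <= s2 < 2^-1).
Hypothesis q2 : (Num.sqrt (1 - 2 * s2))^-1 * expR (- (s2 * h2)) <= q.
Hypothesis q1 : (Num.sqrt (1 + 2 * s1))^-1 * expR (s1 * h1) <= q.

(** [h1] and [h2] are squared thresholds for net points, [s1] and [s2] the Chernoff parameters, and
    [q] a common bound for the failure factor per row. They stay free because two different choices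
    are made later. *)
Lemma gaussian_singular_values : exists B : set T,
  [/\ measurable B, (P B <= ((8 * N.+1%:R) ^+ k * (2 * q ^+ m))%:E)%E &
  forall w, ~ B w -> forall u : 'cV[R]_k,
    (Num.sqrt h1 * (1 - N%:R^-1) - Num.sqrt h2 / N.-1%:R) * Num.sqrt m%:R * enorm u
      <= enorm (E w *m u)
      <= Num.sqrt h2 * (N%:R / N.-1%:R) * Num.sqrt m%:R * enorm u].
Proof.
have q0 : 0 <= q by apply: le_trans q1; rewrite mulr_ge0 ?expR_ge0// invr_ge0 sqrtr_ge0.
pose A2 (z : grid k N) := [set w | (h2 * m%:R * sqnorm (gridvec R z) <
   sqnorm (E w *m gridvec R z))%R].
pose A1 (z : grid k N) := [set w | (sqnorm (E w *m gridvec R z) <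
  h1 * m%:R * sqnorm (gridvec R z))%R].
have mE z := measurable_sqnorm_mulmx hE (gridvec R z).
have mA2 z : measurable (A2 z).
  rewrite (_ : A2 z = (fun w => sqnorm (E w *m gridvec R z)) @^-1`
     `](h2 * m%:R * sqnorm (gridvec R z)), +oo[%classic).
    by rewrite -[X in measurable X]setTI; apply: mE.
  by apply/seteqP; split => w /=; rewrite in_itv/= andbT.
have mA1 z : measurable (A1 z).
  rewrite (_ : A1 z = (fun w => sqnorm (E w *m gridvec R z)) @^-1`
     `]-oo, (h1 * m%:R * sqnorm (gridvec R z))[%classic).
    by rewrite -[X in measurable X]setTI; apply: mE.
  by apply/seteqP; split => w /=; rewrite in_itv/=.
have PA z : (P (A1 z `|` A2 z) <= (2 * q ^+ m)%:E)%E.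
  apply: le_trans (measureU2 _ _ _) _; [exact: mA1|exact: mA2|].
  rewrite -[2 in leRHS]/(1 + 1) mulrDl mul1r EFinD; apply: leeD.
    apply: le_trans (sqnorm_mulmx_lower hE _ _ s10) _.
    by rewrite lee_fin lerXn2r ?nnegrE// mulr_ge0 ?expR_ge0// invr_ge0 sqrtr_ge0.
  apply: le_trans (sqnorm_mulmx_upper hE _ _ s20) _.
  by rewrite lee_fin lerXn2r ?nnegrE// mulr_ge0 ?expR_ge0// invr_ge0 sqrtr_ge0.
have [mB PB] := union_bound (grid_simplex k N) (fun z => measurableU _ _ (mA1 z) (mA2 z)) PA.
exists [set w | exists2 z, z \in grid_simplex k N & (A1 z `|` A2 z) w]; split => //.
  apply: le_trans PB _; rewrite lee_fin ler_wpM2r ?mulr_ge0 ?exprn_ge0//.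
  exact: card_grid_simplex.
move=> w nB.
have sm : 0 <= Num.sqrt m%:R :> R by exact: sqrtr_ge0.
have hz z : z \in grid_simplex k N ->
    Num.sqrt h1 * Num.sqrt m%:R * enorm (gridvec R z) <= enorm (E w *m gridvec R z)
    <= Num.sqrt h2 * Num.sqrt m%:R * enorm (gridvec R z).
  move=> zG; rewrite !enormE -!sqrtrM ?mulr_ge0//.
  apply/andP; split; apply: ler_wsqrtr; rewrite leNgt; apply/negP => hh; apply: nB;
    exists z => //; [by left|by right].
move=> u; have := net_bounds k0 N1 (mulr_ge0 (sqrtr_ge0 h2) sm)
  (mulr_ge0 (sqrtr_ge0 h1) sm) hz u.
move=> /andP[b1 b2]; apply/andP; split.
  apply: le_trans b1; rewrite le_eqVlt; apply/orP; left; apply/eqP; ring.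
by apply: le_trans b2 _; rewrite le_eqVlt; apply/orP; left; apply/eqP; ring.
Qed.

End gaussian_net.

(** * Measurability of the reconstruction error *)

Lemma measurable_invr (R : realType) : measurable_fun [set: R] (@GRing.inv R).
Proof.
have mN0 : measurable [set x : R | x != 0].
  rewrite (_ : [set x | _] = ~` [set 0]); first exact: measurableC.
  by apply/seteqP; split => x /eqP.
rewrite -(setUv [set x : R | x != 0]); apply/measurable_funU => //.
  exact: measurableC.
split; last first.
  apply: (eq_measurable_fun (cst (0 : R))) => [x|]; last exact: measurable_cst.
  by rewrite inE /= => /negP; rewrite negbK => /eqP ->; rewrite invr0.
apply: open_continuous_measurable_fun.
  rewrite (_ : [set x | _] = ~` [set 0]); first exact/closed_openC/accessible_closed_set1/hausdorff_accessible/norm_hausdorff.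
  by apply/seteqP; split => x /eqP.
by move=> x; rewrite inE /= => x0; exact: inv_continuous.
Qed.

Section measurable_matrix.
Context d (T : measurableType d) (R : realType).

Definition measurable_mx m n (A : T -> 'M[R]_(m, n)) :=
  forall i j, measurable_fun [set: T] (fun w => A w i j).

Lemma measurable_mulmx m n p (A : T -> 'M[R]_(m, n)) (B : T -> 'M[R]_(n, p)) :
  measurable_mx A -> measurable_mx B -> measurable_mx (fun w => A w *m B w).
Proof.
move=> mA mB i j; under eq_fun do rewrite mxE.
by apply: measurable_sum => l; apply: measurable_funM; [exact: mA|exact: mB].
Qed.

Lemma measurable_trmx m n (A : T -> 'M[R]_(m, n)) :
  measurable_mx A -> measurable_mx (fun w => (A w)^T).
Proof. by move=> mA i j; under eq_fun do rewrite mxE; exact: mA. Qed.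

Lemma measurable_det n (A : T -> 'M[R]_n) :
  measurable_mx A -> measurable_fun [set: T] (fun w => \det (A w)).
Proof.
move=> mA; apply: measurable_sum => s; apply: measurable_funM => //.
by apply: measurable_prod => i _; exact: mA.
Qed.

Lemma measurable_invmx n (A : T -> 'M[R]_n) : (forall w, A w \in unitmx) ->
  measurable_mx A -> measurable_mx (fun w => invmx (A w)).
Proof.
move=> uA mA i j.
rewrite (_ : (fun w => _) = (fun w => (\det (A w))^-1 * cofactor (A w) j i)); last first.
  by apply/funext => w; rewrite /invmx uA !mxE.
apply: measurable_funM.
  by apply: (measurableT_comp (@measurable_invr R)); exact: measurable_det.
apply: measurable_funM => //; apply: measurable_det => a b.
by under eq_fun do rewrite !mxE; exact: mA.
Qed.

Lemma measurable_enorm n (A : T -> 'cV[R]_n) : measurable_mx A ->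
  measurable_fun [set: T] (fun w => enorm (A w)).
Proof.
move=> mA; apply: (measurableT_comp (f := @Num.sqrt R)).
  by apply: continuous_measurable_fun; exact: sqrt_continuous.
by apply: measurable_sum => i; apply: measurable_funX; exact: mA.
Qed.

End measurable_matrix.

Section tikhonov.
Variables (R : realType) (m n : nat) (A : 'M[R]_(m, n)).

Let B (t : R) := A^T *m A + t%:M.

(** Coercivity: (u, B u) = |A u|^2 + t |u|^2, combined with Cauchy-Schwarz. *)
Lemma tikhonov_enorm (t : R) (u : 'cV[R]_n) : 0 <= t -> t * enorm u <= enorm (B t *m u).
Proof.
move=> t0; have cE p (w : 'cV[R]_p) : \col_i w i 0 = w.
  by apply/matrixP => i j; rewrite !mxE ord1.
have h : t * enorm u ^+ 2 <= enorm u * enorm (B t *m u).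
  have := sum_mul_le_enorm (fun j => u j 0) (fun j => (B t *m u) j 0).
  rewrite !cE; apply: le_trans.
  have -> : \sum_j u j 0 * (B t *m u) j 0 = (u^T *m (B t *m u)) 0 0.
    by rewrite [RHS]mxE; apply: eq_bigr => j _; rewrite [u^T _ _]mxE.
  have -> : u^T *m (B t *m u) = (A *m u)^T *m (A *m u) + t *: (u^T *m u).
    by rewrite /B mulmxDl mulmxDr mul_scalar_mx -scalemxAr trmx_mul !mulmxA.
  have sqE p (v : 'cV[R]_p) : (v^T *m v) 0 0 = sqnorm v.
    by rewrite mxE; apply: eq_bigr => j _; rewrite mxE expr2.
  by rewrite mxE [X in _ + X]mxE !sqE sqr_enorm lerDr sqnorm_ge0.
have [->|uN] := eqVneq (enorm u) 0; first by rewrite mulr0 enorm_ge0.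
have up : 0 < enorm u by rewrite lt_neqAle eq_sym uN enorm_ge0.
by rewrite -(ler_pM2l up); apply: le_trans h; rewrite expr2 mulrCA.
Qed.

Lemma tikhonov_unitmx (t : R) : 0 < t -> B t \in unitmx.
Proof.
move=> t0; rewrite -row_free_unit; apply: inj_row_free => v vB.
have BT : (B t)^T = B t by rewrite /B raddfD/= trmx_mul trmxK tr_scalar_mx.
have : enorm (v^T) = 0.
  apply/eqP; rewrite eq_le enorm_ge0 andbT -(ler_pM2l t0) mulr0.
  apply: le_trans (tikhonov_enorm _ (ltW t0)) _.
  by rewrite -BT -trmx_mul vB trmx0 enorm0.
by move/enorm0_eq => /(congr1 trmx); rewrite trmxK trmx0.
Qed.

(* X = A^T A W with W = X X^T X, hence
   (A^T A + t)^-1 A^T = X - t (W - t (A^T A + t)^-1 W). *)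
Lemma tikhonov_cvg i j :
  (invmx (B l.+1%:R^-1) *m A^T) i j @[l --> \oo] --> mpinv A i j.
Proof.
have [p1 p2 p3 p4] := mpinvP A; set X := mpinv A in p1 p2 p3 p4 *.
pose G := A^T *m A; pose W := X *m X^T *m X.
have AT : A^T = G *m X.
  by rewrite /G -mulmxA -p3 -{1}p1 trmx_mul.
have XW : X = G *m W.
  rewrite /W !mulmxA -AT -{1}p2 -p4 trmx_mul.
  by [].
pose K : R := `|W i j| + enorm (col j W).
have K0 : 0 <= K by rewrite addr_ge0 ?enorm_ge0.
have bound (t : R) : 0 < t -> `|(invmx (B t) *m A^T) i j - X i j| <= t * K.
  move=> t0; have uB := tikhonov_unitmx t0.
  have BG (Y : 'M[R]_(n, m)) : invmx (B t) *m (G *m Y) = Y - t *: (invmx (B t) *m Y).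
    have -> : G *m Y = B t *m Y - t *: Y.
      by rewrite /B mulmxDl mul_scalar_mx addrK.
    by rewrite mulmxBr mulKmx// -scalemxAr.
  have -> : invmx (B t) *m A^T = X - t *: (W - t *: (invmx (B t) *m W)).
    by rewrite AT BG {2}XW BG.
  have -> : (X - t *: (W - t *: (invmx (B t) *m W))) i j - X i j =
      - (t * (W i j - t * (invmx (B t) *m W) i j)).
    by rewrite !mxE addrAC subrr add0r.
  rewrite normrN normrM (gtr0_norm t0) ler_pM2l//.
  apply: le_trans (ler_normB _ _) _; rewrite lerD2l normrM (gtr0_norm t0).
  apply: (@le_trans _ _ (t * enorm (col j (invmx (B t) *m W)))).
    rewrite ler_pM2l//; have := enorm_ge_coord (col j (invmx (B t) *m W)) i.
    by rewrite [col _ _ _ _]mxE.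
  apply: le_trans (tikhonov_enorm _ (ltW t0)) _.
  by rewrite colE mulmxA mulKVmx// -colE.
have hc : (l.+1%:R^-1 : R) * K @[l --> \oo] --> 0.
  by rewrite -(mul0r K); apply: cvgMl; exact: cvg_harmonic.
apply/cvgrPdistC_lt => e e0.
have /cvgr0_norm_lt /(_ e e0) := hc.
apply: filterS => l le.
apply: le_lt_trans (bound _ _) _; first by rewrite invr_gt0.
exact: le_lt_trans (ler_norm _) le.
Qed.

End tikhonov.

(** The pseudoinverse is discontinuous where the rank drops, so measurability is obtained from a
    pointwise limit of regularized inverses, each measurable by Cramer's rule. *)
Lemma measurable_mpinv d (T : measurableType d) (R : realType) m n
    (A : T -> 'M[R]_(m, n)) :
  measurable_mx A -> measurable_mx (fun w => mpinv (A w)).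
Proof.
move=> mA i j.
pose f (l : nat) w := (invmx ((A w)^T *m A w + (l.+1%:R^-1)%:M) *m (A w)^T) i j.
apply/measurable_EFinP.
apply: (emeasurable_fun_cvg (fun l => EFin \o f l)) => [l|w _].
  apply/measurable_EFinP; apply: measurable_mulmx => [a b|]; last exact: measurable_trmx.
  apply: measurable_invmx => [w|c e]; first by apply: tikhonov_unitmx; rewrite invr_gt0.
  under eq_fun do rewrite mxE [X in _ + X]mxE.
  apply: measurable_funD => //; apply: measurable_mulmx => //.
  exact: measurable_trmx.
by apply: cvg_EFin; [exact: nearW|exact: tikhonov_cvg].
Qed.

Lemma measurable_recon_error d (T : measurableType d) (R : realType) m k
    (delta : R) (E : T -> 'M[R]_(m, k)) (x : 'cV[R]_k) :
  0 < delta -> measurable_mx E ->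
  measurable_fun [set: T] (fun w => recon_error delta (E w) x).
Proof.
move=> d0 mE; apply: measurable_enorm => i j.
under eq_fun do rewrite mxE [X in _ + X]mxE.
apply: measurable_funB => //; apply: measurable_mulmx; first exact: measurable_mpinv.
move=> a b; under eq_fun do rewrite mxE.
apply: (measurableT_comp (measurable_quantizer d0)).
by apply: measurable_mulmx => // *; exact: measurable_cst.
Qed.

(** * Error bounds *)

(** A^T = A^T A A^+, the transpose of A A^+ A = A since A A^+ is symmetric; this is valid at every
    rank. *)
Lemma recon_normal_equations (R : realType) m k (A : 'M[R]_(m, k)) (x : 'cV[R]_k)
    (q : 'cV[R]_m) :
  A^T *m (A *m (x - mpinv A *m q)) = A^T *m (A *m x - q).
Proof.
have [p1 _ p3 _] := mpinvP A.
have AT : A^T = A^T *m A *m mpinv A by rewrite -mulmxA -p3 -{1}p1 trmx_mul.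
by rewrite !mulmxBr !mulmxA -AT.
Qed.

Lemma msq_residual (R : realType) m (delta : R) (v : 'cV[R]_m) :
  v - msq delta v = \col_i residual delta (v i 0).
Proof. by apply/matrixP => i j; rewrite !mxE ord1. Qed.

(** Squaring reduces the numerical conditions on Chernoff factors to an inequality with a single
    exponential. *)
Lemma invsqrt_expR_le (R : realType) (a b c s : R) : 0 < a -> 0 < s ->
  s ^+ 2 * expR (2 * (b - c)) <= a -> (Num.sqrt a)^-1 * expR b <= expR c / s.
Proof.
move=> a0 s0 h; have sa : 0 < Num.sqrt a by rewrite sqrtr_gt0.
rewrite mulrC ler_pdivrMr// mulrAC ler_pdivlMr//.
have -> : expR b = expR c * expR (b - c) by rewrite -expRD addrC subrK.
rewrite -mulrA ler_pM2l ?expR_gt0// -(@ler_pXn2r _ 2) ?nnegrE ?mulr_ge0 ?expR_ge0 ?(ltW s0) ?(ltW sa)//.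
by rewrite exprMn -expRM_natl sqr_sqrtr ?(ltW a0)// mulrC.
Qed.

Section high_probability_events.
Context d (T : measurableType d) (R : realType) (P : probability T R).
Variables (m k : nat) (E : T -> 'M[R]_(m, k)).
Hypotheses (hE : gaussian_matrix P E) (k0 : (0 < k)%N).

(** The scale 1000 makes the discretization error U / 999 small against the lower threshold, and
    gives at most (8008)^k <= 10^(4k) net points. *)
Let net_scale : exists N : nat, [/\ (1 < N)%N, N%:R = 1000 :> R, N.-1%:R = 999 :> R
  & 8 * N.+1%:R <= 10 ^+ 4 :> R].
Proof.
exists 1000%N; split => //.
by rewrite -natrM -natrX ler_nat.
Qed.

Lemma singular_values_coarse : (4 * k <= m)%N -> exists B : set T,
  [/\ measurable B, (P B <= (2 * expR (- (m%:R / 8)))%:E)%E &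
  forall w, ~ B w -> forall u : 'cV[R]_k,
    Num.sqrt m%:R / 100 * enorm u <= enorm (E w *m u) <= 6 * Num.sqrt m%:R * enorm u].
Proof.
move=> km; have [N [N1 NE NpE N10]] := net_scale.
(* The factor 1/10 per row absorbs the cardinality 10^(4k) <= 10^m. The lower threshold 1/50 leaves
   (1/50)(999/1000) - 5/999 >= 1/100; its parameter 1250 is close to the optimum (50^2 - 1) / 2. *)
pose q : R := expR (- 8^-1) / 10.
have q2 : (Num.sqrt (1 - 2 * 4^-1))^-1 * expR (- (4^-1 * 25)) <= q.
  apply: invsqrt_expR_le; [lra|lra|].
  have -> : 2 * (- (4^-1 * 25) - - 8^-1) = - (49 / 4) :> R by field.
  rewrite expRN ler_pdivrMr ?expR_gt0//.
  have -> : 49 / 4 = 8%:R * (49 / 32) :> R by field.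
  rewrite expRM_natl; have := expR_ge1Dx (49 / 32 : R); move: (expR _) => e he.
  have : 2 ^+ 8 <= e ^+ 8 by rewrite lerXn2r ?nnegrE//; lra.
  by rewrite (_ : 2 ^+ 8 = 256); [lra|rewrite -natrX].
have q1 : (Num.sqrt (1 + 2 * 1250))^-1 * expR (1250 * (50 ^- 2)) <= q.
  apply: invsqrt_expR_le; [lra|lra|].
  have -> : 2 * (1250 * 50 ^- 2 - - 8^-1) = 2%:R * (5 / 8) :> R by field.
  rewrite expRM_natl; have e8 : expR (5 / 8) <= 8 / 3 :> R.
    have := @expR_le_inv R (5 / 8).
    rewrite (_ : (1 - 5 / 8)^-1 = 8 / 3); last by field.
    by apply; lra.
  have := expR_ge0 (5 / 8 : R); move: (expR _) e8 => e; nra.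
have h10 : 0 <= 50 ^- 2 :> R by rewrite invr_ge0 exprn_ge0.
have s20 : 0 <= (4^-1 : R) < 2^-1 by apply/andP; split; lra.
have [B [mB PB Bw]] := @gaussian_singular_values _ _ _ P m k N E hE k0 N1
  (50 ^- 2) 25 1250 4^-1 q h10 (ler0n _ _) (ler0n _ _) s20 q2 q1.
exists B; split => //.
  apply: le_trans PB _; rewrite lee_fin mulrCA ler_pM2l//.
  apply: (@le_trans _ _ (10 ^+ (4 * k) * q ^+ m)).
    rewrite ler_wpM2r ?exprn_ge0 ?divr_ge0 ?expR_ge0// exprM.
    by rewrite lerXn2r ?nnegrE ?mulr_ge0.
  apply: (@le_trans _ _ (10 ^+ m * q ^+ m)).
    by rewrite ler_wpM2r ?exprn_ge0 ?divr_ge0 ?expR_ge0// ler_weXn2l// ler1n.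
  rewrite -exprMn /q mulrC divfK// -expRM_natl.
  by rewrite mulrN.
move=> w /Bw h u; have /andP[h1 h2] := h u.
have sm : 0 <= Num.sqrt m%:R :> R by exact: sqrtr_ge0.
rewrite (_ : 50 ^- 2 = (50^-1) ^+ 2) in h1; last by rewrite exprVn.
have s25 : Num.sqrt 25 = 5 :> R.
  by rewrite (_ : 25 = 5 ^+ 2) ?sqrtr_sqr ?ger0_norm// -natrX.
rewrite sqrtr_sqr ger0_norm ?invr_ge0// s25 NE NpE in h1.
rewrite s25 NE NpE in h2.
apply/andP; split.
  apply: le_trans h1; rewrite ler_wpM2r ?enorm_ge0// mulrC ler_wpM2r//.
  by lra.
apply: le_trans h2 _; rewrite ler_wpM2r ?enorm_ge0// ler_wpM2r//.
by lra.
Qed.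

Lemma singular_values_fine : exists B : set T,
  [/\ measurable B, (P B <= (2 * expR (16 * k%:R - m%:R / 25))%:E)%E &
  forall w, ~ B w -> forall u : 'cV[R]_k,
    Num.sqrt m%:R / 2 * enorm u <= enorm (E w *m u) <= 3 / 2 * Num.sqrt m%:R * enorm u].
Proof.
have [N [N1 NE NpE N10]] := net_scale.
(* The thresholds 11/20 and 7/5 leave room for the discretization error inside [1/2, 3/2]. The net
   is no longer absorbed by q: it contributes exp(16 k), as 10^4 <= 2^16 <= e^16. *)
pose q : R := expR (- 25^-1).
have q2 : (Num.sqrt (1 - 2 * 4^-1))^-1 * expR (- (4^-1 * (7 / 5) ^+ 2)) <= q.
  rewrite -[q]divr1; apply: invsqrt_expR_le; [lra|lra|].
  have -> : 2 * (- (4^-1 * (7 / 5) ^+ 2) - - 25^-1) = - (2%:R * (9 / 20)) :> R by field.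
  have -> : 1 - 2 * 4^-1 = 2^-1 :> R by field.
  rewrite expRN expr1n mul1r expRM_natl lef_pV2 ?posrE ?exprn_gt0 ?expR_gt0//.
  have := expR_ge1Dx (9 / 20 : R); move: (expR _) => e he; nra.
have q1 : (Num.sqrt (1 + 2 * 2^-1))^-1 * expR (2^-1 * (11 / 20) ^+ 2) <= q.
  rewrite -[q]divr1; apply: invsqrt_expR_le; [lra|lra|].
  have -> : 2 * (2^-1 * (11 / 20) ^+ 2 - - 25^-1) = 153 / 400 :> R by field.
  rewrite expr1n mul1r; apply: le_trans (expR_le_inv _) _; first by lra.
  rewrite (_ : (1 - 153 / 400)^-1 = 400 / 247); last by field.
  by lra.
have s20 : 0 <= (4^-1 : R) < 2^-1 by apply/andP; split; lra.
have s10 : 0 <= 2^-1 :> R by lra.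
have [B [mB PB Bw]] := @gaussian_singular_values _ _ _ P m k N E hE k0 N1
  ((11 / 20) ^+ 2) ((7 / 5) ^+ 2) 2^-1 4^-1 q (sqr_ge0 _) (sqr_ge0 _) s10 s20 q2 q1.
exists B; split => //.
  apply: le_trans PB _; rewrite lee_fin mulrCA ler_pM2l//.
  rewrite expRD [in leRHS]mulrC mulrC ler_pM ?exprn_ge0 ?mulr_ge0 ?expR_ge0//.
    rewrite expRM_natr lerXn2r ?nnegrE ?mulr_ge0 ?expR_ge0//.
    apply: le_trans N10 _.
    rewrite -[16]mulr1 expRM_natl.
    apply: (@le_trans _ _ (2 ^+ 16)); first by rewrite -!natrX ler_nat.
    by rewrite lerXn2r ?nnegrE ?expR_ge0//; have := expR_ge1Dx (1 : R); lra.
  by rewrite /q -expRM_natl mulrN.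
move=> w /Bw h u; have /andP[h1 h2] := h u.
have sm : 0 <= Num.sqrt m%:R :> R by exact: sqrtr_ge0.
rewrite !sqrtr_sqr !ger0_norm ?divr_ge0// NE NpE in h1.
rewrite sqrtr_sqr ger0_norm ?divr_ge0// NE NpE in h2.
apply/andP; split.
  apply: le_trans h1; rewrite ler_wpM2r ?enorm_ge0// mulrC ler_wpM2r//.
  by lra.
apply: le_trans h2 _; rewrite ler_wpM2r ?enorm_ge0// ler_wpM2r//.
by lra.
Qed.

End high_probability_events.

(** The normal equations give (m / 100^2) e <= 6 sqrt m |r|, and |r| <= sqrt m delta / 2. The bound
    does not involve x. *)
Lemma coarse_recon_error (R : realType) m k (A : 'M[R]_(m, k)) (x : 'cV[R]_k) (delta : R) :
  (0 < m)%N -> 0 < delta ->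
  (forall u : 'cV[R]_k,
    Num.sqrt m%:R / 100 * enorm u <= enorm (A *m u) <= 6 * Num.sqrt m%:R * enorm u) ->
  recon_error delta A x <= 3 * (100 ^+ 2 * delta).
Proof.
move=> m0 d0 Au; have m0R : 0 < m%:R :> R by rewrite ltr0n.
have sm : 0 < Num.sqrt m%:R :> R by rewrite sqrtr_gt0.
have ss : Num.sqrt m%:R ^+ 2 = m%:R :> R by rewrite sqr_sqrtr// ltW.
have s0 : 0 < Num.sqrt m%:R / 100 :> R by rewrite divr_gt0.
have S0 : 0 <= 6 * Num.sqrt m%:R :> R by rewrite mulr_ge0// ltW.
have /andP[h _] := normal_equations_bounds s0 S0 Au
  (recon_normal_equations A x (msq delta (A *m x))).
have hr : enorm (A *m x - msq delta (A *m x)) <= Num.sqrt m%:R * (delta / 2).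
  apply: enorm_le_coord => [|i]; first by rewrite divr_ge0 ?(ltW d0).
  by rewrite msq_residual mxE; exact: residual_bound.
have hA u : enorm (A *m u) <= 6 * Num.sqrt m%:R * enorm u by have /andP[] := Au u.
have := le_trans h (enorm_mul_trmx (A *m x - msq delta (A *m x)) S0 hA).
rewrite -/(recon_error delta A x) expr_div_n ss => h2.
have : m%:R / 100 ^+ 2 * recon_error delta A x <= m%:R * (3 * delta).
  apply: le_trans h2 _; apply: le_trans (ler_wpM2l S0 hr) _.
  by rewrite -[X in _ <= X * _]ss le_eqVlt; apply/orP; left; apply/eqP; field.
rewrite -mulrA ler_pM2l// ler_pdivrMl ?exprn_gt0// => h3.
by rewrite mulrCA.
Qed.

(** The squared singular value bounds are m / 4 and 9 m / 4; dividing m (theta |x| + eps) and m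
    (theta |x| - eps) by them produces the factors 4 and 4/9. *)
Lemma fine_recon_error (R : realType) m k (A : 'M[R]_(m, k)) (x : 'cV[R]_k)
    (delta theta eps : R) :
  (0 < m)%N -> 0 <= theta -> 
  (forall u : 'cV[R]_k,
    Num.sqrt m%:R / 2 * enorm u <= enorm (A *m u) <= 3 / 2 * Num.sqrt m%:R * enorm u) ->
  enorm (A^T *m (A *m x - msq delta (A *m x)) - (m%:R * theta) *: x) <= m%:R * eps ->
  4 / 9 * (theta * enorm x - eps) <= recon_error delta A x <= 4 * (theta * enorm x + eps).
Proof.
move=> m0 t0 Au; have m0R : 0 < m%:R :> R by rewrite ltr0n.
have sm : 0 < Num.sqrt m%:R :> R by rewrite sqrtr_gt0.
have ss : Num.sqrt m%:R ^+ 2 = m%:R :> R by rewrite sqr_sqrtr// ltW.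
have s0 : 0 < Num.sqrt m%:R / 2 :> R by rewrite divr_gt0.
have S0 : 0 <= 3 / 2 * Num.sqrt m%:R :> R by rewrite mulr_ge0// ltW.
have /andP[] := normal_equations_bounds s0 S0 Au
  (recon_normal_equations A x (msq delta (A *m x))).
rewrite -/(recon_error delta A x) !exprMn ss exprVn.
set v := A^T *m _; set u := _ *: x => h1 h2 h3.
have hu : enorm u = m%:R * (theta * enorm x).
  by rewrite enormZ ger0_norm ?mulr_ge0// mulrA.
have v1 := enormD u (v - u); have v2 := enormB u (v - u).
rewrite addrCA subrr addr0 in v1 v2; rewrite hu in v1 v2.
have v3 := le_trans h1 (le_trans v1 (lerD (lexx _) h3)).
have v4 := le_trans (lerB (lexx _) h3) (le_trans v2 h2).
rewrite -mulrDr -mulrA ler_pM2l// in v3.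
rewrite -mulrBr [leRHS]mulrAC [leRHS]mulrC ler_pM2l// in v4.
move: v3 v4; rewrite -natrX -[3 ^+ 2]natrX.
move: (theta * enorm x) (recon_error _ _ _) => a e v3 v4; apply/andP; split; lra.
Qed.

(** With t = r / delta, 2 t <= 1 + t^2 <= 1 + 2 pi^2 t^2 <= exp(2 pi^2 t^2). Hence the bias never
    exceeds [delta]. *)
Lemma two_expR_le (R : realType) (r delta : R) : 0 < delta ->
  2 * r * expR (- (2 * pi ^+ 2 * r ^+ 2 / delta ^+ 2)) <= delta.
Proof.
move=> d0; rewrite expRN ler_pdivrMr ?expR_gt0//.
have -> : 2 * pi ^+ 2 * r ^+ 2 / delta ^+ 2 = 2 * pi ^+ 2 * (r / delta) ^+ 2.
  by rewrite expr_div_n [RHS]mulrA.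
have := expR_ge1Dx (2 * pi ^+ 2 * (r / delta) ^+ 2).
have -> : 2 * r = delta * (2 * (r / delta)) by rewrite mulrCA [delta * _]mulrC divfK ?gt_eqF.
rewrite ler_pM2l//; have := @pi_ge2 R; set t := r / delta; set p := pi; set e := expR _ => p2 e1.
have pt : t ^+ 2 <= p ^+ 2 * t ^+ 2 by rewrite ler_peMl ?sqr_ge0//; nra.
have := sqr_ge0 (t - 1); nra.
Qed.

(* When [m <= 1000 k ln k ln(e^2/c2)] the slack term dominates the trivial bound
   on the error, and the lower bound of the theorem is negative. *)
Lemma coarse_regime_bounds (R : realType) (e r delta s A A' M : R) :
  0 < delta -> 0 <= r -> 1 <= M -> 0 <= e <= 3 * (M * delta) ->
  32^-1 <= s -> 4 <= A -> 0 < A' ->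
  let bias := 2 * r * expR (- (2 * pi ^+ 2 * r ^+ 2 / delta ^+ 2)) in
  let bias' := 2 * r * expR (- (8 * pi ^+ 2 * r ^+ 2 / delta ^+ 2)) in
  e < A * (bias + 40 * M * s * delta) /\ A' * (bias - bias' - 40 * M * s * delta) < e.
Proof.
move=> d0 r0 M1 /andP[e0 e1] s0 A4 A0 bias bias'.
have b1 : bias <= delta by exact: two_expR_le.
have b0 : 0 <= bias by rewrite !mulr_ge0 ?expR_ge0.
have b'0 : 0 <= bias' by rewrite !mulr_ge0 ?expR_ge0.
have dM : delta <= M * delta by rewrite ler_peMl// ltW.
(* The slack is at least (40/32) M delta. Four times it is 5 M delta, above the error bound 3 M
   delta, and it exceeds the bias, which is at most M delta. *)
have sd : 32^-1 * (M * delta) <= s * (M * delta) by rewrite ler_wpM2r//; lra.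
have -> : 40 * M * s * delta = 40 * (s * (M * delta)) by ring.
move: bias bias' (M * delta) (s * (M * delta)) b1 b0 b'0 e1 dM sd.
move=> b b' D t b1 b0 b'0 e1 dM sd; split.
  apply: (@lt_le_trans _ _ (4 * (b + 40 * t))); first by lra.
  by rewrite ler_wpM2r//; lra.
by apply: lt_le_trans e0; rewrite pmulr_rlt0//; lra.
Qed.

Lemma fine_regime_bounds (R : realType) (e r delta s A A' M theta a : R) :
  0 < delta -> 0 <= r -> 1 <= M -> 0 <= e -> 0 < s -> 4 <= A -> 0 < A' <= 4 / 9 ->
  2 * (expR (- a) - expR (- (4 * a))) <= theta <= 2 * expR (- a) ->
  4 / 9 * (theta * r - 8 * s * delta) <= e <= 4 * (theta * r + 8 * s * delta) ->
  let bias := 2 * r * expR (- a) in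
  let bias' := 2 * r * expR (- (4 * a)) in
  e < A * (bias + 40 * M * s * delta) /\ A' * (bias - bias' - 40 * M * s * delta) < e.
Proof.
move=> d0 r0 M1 e0 s0 A4 /andP[A0 A9] /andP[t1 t2] /andP[e1 e2] bias bias'.
have b1 : theta * r <= bias by rewrite /bias [leRHS]mulrAC; exact: ler_wpM2r.
have b2 : bias - bias' <= theta * r.
  by rewrite /bias /bias' -mulrBr [leLHS]mulrAC; exact: ler_wpM2r.
have b0 : 0 <= bias by rewrite !mulr_ge0 ?expR_ge0.
have t0 : 0 < s * delta by rewrite mulr_gt0.
have tM : s * delta <= M * (s * delta) by rewrite ler_peMl// ltW.
have -> : 40 * M * s * delta = 40 * (M * (s * delta)) by ring.
move: e1 e2; rewrite -!(mulrA _ s).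
move: bias bias' (s * delta) (M * (s * delta)) (theta * r) t0 b0 b1 b2 tM.
move=> b b' t D w t0 b0 b1 b2 tM e1 e2; split.
  apply: le_lt_trans e2 _.
  apply: (@lt_le_trans _ _ (4 * (b + 40 * D))); first by lra.
  by rewrite ler_wpM2r//; lra.
(* [A'] may be replaced by 4/9 only when the bracket is nonnegative; otherwise the lower bound is
   negative. *)
have [h|h] := ltP (b - b' - 40 * D) 0.
  by apply: lt_le_trans e0; rewrite pmulr_rlt0.
apply: lt_le_trans e1.
apply: (@le_lt_trans _ _ (4 / 9 * (b - b' - 40 * D))); last by lra.
by rewrite ler_wpM2r.
Qed.

Lemma trmx_mul_residual (R : realType) m k (A : 'M[R]_(m, k)) (x : 'cV[R]_k) (delta : R) j :
  (A^T *m (A *m x - msq delta (A *m x))) j 0 =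
  \sum_i residual delta ((A *m x) i 0) * A i j.
Proof.
by rewrite mxE; apply: eq_bigr => i _; rewrite mxE msq_residual mxE mulrC.
Qed.

Lemma measurable_residual_sum d (T : measurableType d) (R : realType)
    (P : probability T R) m k (E : T -> 'M[R]_(m, k)) (x : 'cV[R]_k) (delta b c : R) (j : 'I_k) :
  gaussian_matrix P E -> 0 < delta -> measurable [set w | (b <=
    `|\sum_i residual delta ((E w *m x) i 0) * E w i j - c|)%R].
Proof.
move=> hE d0; set f := fun w => `|\sum_i residual delta ((E w *m x) i 0) * E w i j - c|.
suff mf : measurable_fun setT f.
  rewrite (_ : [set w | _] = f @^-1` `[b, +oo[%classic).
    by rewrite -[X in measurable X]setTI; apply: mf.
  by apply/seteqP; split => w /=; rewrite in_itv/= andbT.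
apply: measurableT_comp => //; apply: measurable_funB => //.
apply: measurable_sum => i; apply: measurable_funM.
  exact: (measurableT_comp (measurable_residual d0) (measurable_mulmx_row hE x i)).
exact: gaussian_matrix_measurable hE i j.
Qed.

(** * The regime of many measurements, and the conclusion *)

Section regimes.
Context d (T : measurableType d) (R : realType) (P : probability T R).
Variables (m k : nat) (E : T -> 'M[R]_(m, k)) (x : 'cV[R]_k) (delta : R).
Hypotheses (hE : gaussian_matrix P E) (k3 : (3 <= k)%N) (m0 : (0 < m)%N) (d0 : 0 < delta).
Variables (l K s : R).
Hypotheses (l2 : 2 <= l) (K1 : 1 <= K) (kK : k%:R = expR K) (s0 : 0 < s).
Hypothesis (ms2 : m%:R * s ^+ 2 = l * K * k%:R).

(** Here [l] stands for ln(e^2 / c2), [K] for ln k and [s] for sqrt(l K / lambda), so exp(2 - l) is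
    c2. The singular values and the k coordinates of E^T r each account for at most half of it. *)
Lemma fine_regime : 1000 * s ^+ 2 <= 1 -> exists (B : set T) (theta : R),
  let a := 2 * pi ^+ 2 * sqnorm x / delta ^+ 2 in
  [/\ measurable B, (P B <= (expR (2 - l))%:E)%E,
    2 * (expR (- a) - expR (- (4 * a))) <= theta <= 2 * expR (- a) &
  forall w, ~ B w -> 4 / 9 * (theta * enorm x - 8 * s * delta) <= recon_error delta (E w) x
     <= 4 * (theta * enorm x + 8 * s * delta)].
Proof.
move=> s1000.
have k0 : (0 < k)%N by exact: leq_trans k3.
have k0R : 0 < k%:R :> R by rewrite ltr0n.
have m0R : 0 < m%:R :> R by rewrite ltr0n.
have k3R : 3 <= k%:R :> R by rewrite ler_nat.
have sk : 0 < Num.sqrt k%:R :> R by rewrite sqrtr_gt0.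
have ssk : Num.sqrt k%:R ^+ 2 = k%:R :> R by rewrite sqr_sqrtr// ltW.
have [B1 [mB1 PB1 B1w]] := singular_values_fine hE k0.
(* Coordinate deviations m beta delta add up to sqrt k times that in norm, that is m (8 s delta).
   Each has exponent m beta^2 / 16 = 4 l K, enough for a union over k = exp K coordinates. *)
pose beta := 8 * s / Num.sqrt k%:R.
have beta2 : m%:R * beta ^+ 2 / 16 = 4 * (l * K).
  rewrite /beta expr_div_n exprMn ssk.
  rewrite (_ : _ / 16 = m%:R * s ^+ 2 * (4 / k%:R)); last by field; rewrite gt_eqF.
  by rewrite ms2; field; rewrite gt_eqF.
have beta04 : 0 <= beta <= 4.
  rewrite divr_ge0 ?mulr_ge0 ?(ltW s0) ?(ltW sk)//= ler_pdivrMr//.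
  have : 1 <= Num.sqrt k%:R :> R by nra.
  nra.
have [theta [ht hdev]] := residual_deviation hE x m0 d0 beta04.
exists (B1 `|` [set w | exists2 j, j \in [set: 'I_k]%SET &
   (m%:R * beta * delta <= `|\sum_i residual delta ((E w *m x) i 0) * E w i j
       - m%:R * theta * x j 0|)%R]), theta => /=.
have [mB2 PB2] := @union_bound _ _ _ P _ [set: 'I_k]%SET _
  (2 * expR (- (m%:R * beta ^+ 2 / 16)))
  (fun j => measurable_residual_sum x _ _ j hE d0) hdev.
split => //.
- exact: measurableU.
- apply: le_trans (measureU2 _ _ _) _ => //.
  apply: le_trans (leeD PB1 PB2) _; rewrite -EFinD lee_fin cardsT card_ord beta2.
  rewrite mulrCA [in X in _ + X]kK -expRD.
  (* The 4 combines the factor 2 of the tails with the halving of the probability; writing it as at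
     most e^3 leaves linear inequalities between exponents. *)
  have h4 : 4 <= expR 3 :> R by apply: le_trans (expR_ge1Dx _); lra.
  have g1 : 4 * expR (16 * k%:R - m%:R / 25) <= expR (2 - l).
    apply: (@le_trans _ _ (expR 3 * expR (16 * k%:R - m%:R / 25))).
      by rewrite ler_wpM2r ?expR_ge0.
    rewrite -expRD ler_expR.
    have hm : 1000 * (l * K * k%:R) <= m%:R by rewrite -ms2; nra.
    have h1 : l <= l * K by apply: ler_peMr => //; apply: le_trans l2.
    have h2 : l * k%:R <= l * K * k%:R by rewrite ler_wpM2r// ltW.
    have h3 : 2 * k%:R <= l * k%:R by rewrite ler_wpM2r// ltW.
    have h5 : l * 3 <= l * k%:R by rewrite ler_wpM2l//; apply: le_trans l2.
    lra.
  have g2 : 4 * expR (K + - (4 * (l * K))) <= expR (2 - l).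
    apply: (@le_trans _ _ (expR 3 * expR (K + - (4 * (l * K))))).
      by rewrite ler_wpM2r ?expR_ge0.
    rewrite -expRD ler_expR.
    have h1 : l <= l * K by apply: ler_peMr => //; apply: le_trans l2.
    have h2 : 2 * K <= l * K by rewrite ler_wpM2r//; apply: le_trans K1.
    by move: l2 K1; lra.
  lra.
move=> w /not_orP[/B1w hs hd]; apply: fine_recon_error => //.
  case/andP: ht => ht _; apply: le_trans ht; rewrite mulr_ge0// subr_ge0 ler_expR lerN2.
  have a0 : 0 <= 2 * pi ^+ 2 * sqnorm x / delta ^+ 2.
    by rewrite divr_ge0 ?sqr_ge0// mulr_ge0 ?sqnorm_ge0// mulr_ge0 ?sqr_ge0.
  by move: (_ / _) a0 => a; lra.
rewrite (_ : m%:R * (8 * s * delta) = Num.sqrt k%:R * (m%:R * beta * delta)); last first.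
  by rewrite /beta; field; rewrite gt_eqF.
apply: enorm_le_coord => [|j].
  by rewrite mulr_ge0 ?(ltW d0)// mulr_ge0//; case/andP: beta04.
rewrite mxE trmx_mul_residual (_ : (- (_ *: x)) j 0 = - (m%:R * theta * x j 0)); last by rewrite !mxE.
rewrite leNgt; apply/negP => h; apply: hd; exists j; rewrite ?inE//=.
exact: ltW.
Qed.

End regimes.

(** It turns k >= 3 into ln k >= 1. The proof uses e^(1/6) <= 6/5 and (6/5)^6 <= 3. *)
Lemma expR1_le3 (R : realType) : expR 1 <= 3 :> R.
Proof.
have -> : 1 = 6%:R * 6^-1 :> R by rewrite divff.
rewrite expRM_natl; apply: (@le_trans _ _ ((6 / 5) ^+ 6)).
  rewrite lerXn2r ?nnegrE ?expR_ge0 ?divr_ge0//.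
  apply: le_trans (expR_le_inv _) _; first by lra.
  by rewrite (_ : (1 - 6^-1)^-1 = 6 / 5) //; field.
by lra.
Qed.

Lemma probability_compl_le d (T : measurableType d) (R : realType) (P : probability T R)
    (B S : set T) (c : R) : measurable B -> measurable S -> (P B <= c%:E)%E ->
  (forall w, ~ B w -> S w) -> ((1 - c)%:E <= P S)%E.
Proof.
move=> mB mS PB BS; apply: (@le_trans _ _ (P (~` B))).
  by rewrite probability_setC// EFinB; apply: leeB.
by apply: le_measure; rewrite ?inE//; exact: measurableC.
Qed.

Theorem corollary3p9 (R : realType) :
  exists C : R, 0 < C /\
  forall (k : nat) (x : 'cV[R]_k) (delta : R) (m : nat)
    (d : measure_display) (T : measurableType d) (P : probability T R)
    (E : T -> 'M[R]_(m, k)),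
  (3 <= k)%N -> 0 < delta ->
  let lambda : R := m%:R / k%:R in
  4 < lambda ->
  gaussian_matrix P E ->
  let A : R := (1 / 2 - (Num.sqrt lambda)^-1) ^- 2 in
  let A' : R := (3 / 2 + (Num.sqrt lambda)^-1) ^- 2 in
  forall c2 : R, 0 < c2 < 1 ->
  let c1 : R := C * Num.sqrt (ln (expR 2 * c2^-1)) in
  is_true ((1 - 2 * expR (- (m%:R / 8)) - c2)%:E <=
   P [set w |
      (recon_error delta (E w) x <
         A * (2 * enorm x * expR (- (2 * pi ^+ 2 * enorm x ^+ 2 / delta ^+ 2))
              + c1 * Num.sqrt (ln k%:R) * (Num.sqrt lambda)^-1 * delta))%R
     /\
      (recon_error delta (E w) x >
         A' * (2 * enorm x * expR (- (2 * pi ^+ 2 * enorm x ^+ 2 / delta ^+ 2))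
               - 2 * enorm x * expR (- (8 * pi ^+ 2 * enorm x ^+ 2 / delta ^+ 2))
               - c1 * Num.sqrt (ln k%:R) * (Num.sqrt lambda)^-1 * delta))%R])%E.
Proof.
(* 100^2 is the squared inverse of the coarse lower singular value constant; 40 exceeds 32 by enough
   for the coarse regime, where s > 1/32, and dominates the 8 of the fine one. *)
exists (40 * 100 ^+ 2); split; first by rewrite mulr_gt0// exprn_gt0.
move=> k x delta m d T P E k3 d0 lambda lam4 hE A A' c2 /andP[c20 c21] c1.
have k0 : (0 < k)%N by exact: leq_trans k3.
have k0R : 0 < k%:R :> R by rewrite ltr0n.
have km : (4 * k <= m)%N.
  by move: lam4; rewrite /lambda ltr_pdivlMr// -natrM ltr_nat => /ltnW.
have m0 : (0 < m)%N by apply: leq_trans km; rewrite muln_gt0.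
have m0R : 0 < m%:R :> R by rewrite ltr0n.
have sl2 : 2 <= Num.sqrt lambda.
  rewrite -(@ler_pXn2r _ 2) ?nnegrE ?sqrtr_ge0// sqr_sqrtr; last by lra.
  by rewrite -natrX ltW.
have sl0 : 0 < Num.sqrt lambda by apply: lt_le_trans sl2.
have slV : 0 < (Num.sqrt lambda)^-1 < 2^-1.
  rewrite invr_gt0 sl0 ltf_pV2 ?posrE//.
  rewrite -(@ltr_pXn2r _ 2) ?nnegrE ?sqrtr_ge0// sqr_sqrtr; last by lra.
  by rewrite -natrX.
have A4 : 4 <= A.
  have -> : 4 = (2^-1) ^- 2 :> R by field.
  rewrite lef_pV2 ?posrE ?exprn_gt0 ?invr_gt0//; last by lra.
  by rewrite lerXn2r ?nnegrE//; lra.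
have A'9 : 0 < A' <= 4 / 9.
  rewrite invr_gt0 exprn_gt0/=; last by lra.
  have -> : 4 / 9 = (3 / 2) ^- 2 :> R by field.
  rewrite lef_pV2 ?posrE ?exprn_gt0//; try lra.
  by rewrite lerXn2r ?nnegrE//; lra.
set l := ln (expR 2 * c2^-1) in c1 *.
have lE : expR l = expR 2 * c2^-1 by rewrite lnK// posrE mulr_gt0 ?expR_gt0 ?invr_gt0.
have l2 : 2 <= l.
  by rewrite -ler_expR lE ler_peMr ?expR_ge0// invf_ge1// ltW.
have c2E : expR (2 - l) = c2.
  by rewrite expRD expRN lE invfM invrK mulrA divff ?mul1r// gt_eqF ?expR_gt0.
have kK : k%:R = expR (ln k%:R) :> R by rewrite lnK.
have K1 : 1 <= ln k%:R :> R.
  by rewrite -ler_expR -kK; apply: le_trans (expR1_le3 R) _; rewrite ler_nat.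
set K := ln k%:R in kK K1 *.
pose s := Num.sqrt l * Num.sqrt K * (Num.sqrt lambda)^-1.
have s0 : 0 < s by rewrite !mulr_gt0 ?invr_gt0// sqrtr_gt0; lra.
have ms2 : m%:R * s ^+ 2 = l * K * k%:R.
  rewrite /s !exprMn exprVn !sqr_sqrtr; try lra.
  by rewrite /lambda; field; rewrite !gt_eqF.
have slackE : c1 * Num.sqrt K * (Num.sqrt lambda)^-1 * delta = 40 * 100 ^+ 2 * s * delta.
  by rewrite /c1 /s -!mulrA.
have M1 : 1 <= 100 ^+ 2 :> R by rewrite -natrX ler1n.
have r0 := enorm_ge0 x; have e0 w : 0 <= recon_error delta (E w) x by exact: enorm_ge0.
rewrite slackE; set S := (X in P X).
suff [B [mB PB BS]] : exists B : set T, [/\ measurable B,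
    (P B <= (2 * expR (- (m%:R / 8)) + c2)%:E)%E & forall w, ~ B w -> S w].
  rewrite -addrA -opprD; apply: probability_compl_le PB BS => //.
  have mr := measurable_recon_error x d0 (gaussian_matrix_measurable hE).
  rewrite /S; set u := A * _; set v := A' * _.
  rewrite (_ : [set w | _] = (fun w => recon_error delta (E w) x) @^-1` `]v, u[%classic).
    by rewrite -[X in measurable X]setTI; apply: mr.
  by apply/seteqP; split => w /=; rewrite in_itv/=; [case=> -> ->|case/andP].
(* Since m s^2 = l K k, the first case is m >= 1000 l K k. *)
have [s1|s1] := leP (1000 * s ^+ 2) 1.
  have [B [theta [mB PB ht Bw]]] := fine_regime x hE k3 m0 d0 l2 K1 kK s0 ms2 s1.
  exists B; split => //.
    by apply: le_trans PB _; rewrite lee_fin c2E lerDr mulr_ge0 ?expR_ge0.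
  move=> w /Bw h; rewrite /S/=.
  have := fine_regime_bounds d0 r0 M1 (e0 w) s0 A4 A'9 ht h.
  rewrite -sqr_enorm /= => -[h1 h2]; split => //.
  apply: le_lt_trans h2; rewrite le_eqVlt; apply/orP; left; apply/eqP.
  by congr (_ * (_ - _ * expR (- _) - _)); field; rewrite gt_eqF.
have [B [mB PB Bw]] := singular_values_coarse hE k0 km.
exists B; split => //.
  by apply: le_trans PB _; rewrite lee_fin lerDl ltW.
move=> w /Bw h; apply: coarse_regime_bounds => //.
- by rewrite e0 coarse_recon_error.
(* 1000 <= 32^2, so the failure of the first case gives s > 1/32. *)
- have : 1 < (32 * s) ^+ 2 by rewrite exprMn; apply: lt_le_trans s1 _; rewrite ler_wpM2r ?sqr_ge0// -natrX ler_nat.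
  rewrite expr_gt1 ?mulr_ge0 ?(ltW s0)// => h1; lra.
- by case/andP: A'9.
Qed.
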